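(* Let $\mathbb{H}_1=\{(z_1,z_2)\in\mathbb{C}^2: |z_1|<|z_2|<1\}$ and let $\widetilde{\boldsymbol{B}^\infty}$ be the $L^\infty$ sub-Bergman projection on $\mathbb{H}_1$. Then $\widetilde{\boldsymbol{B}^\infty}$ maps $L^p_1(\mathbb{H}_1)\to L^p_1(\mathbb{H}_1)$ boundedly for all $1<p<4$.
   Context: For an open set $\Omega\subset\mathbb{C}^n$, $1<p<\infty$ and an integer $k\ge 0$, $L^p_k(\Omega)$ is the $L^p$ Sobolev space of order $k$: the measurable functions $f$ with $\|f\|_{L^p_k(\Omega)}=\big(\sum_{|\alpha|\le k}\int_\Omega|\partial^\alpha f|^p\,dV\big)^{1/p}<\infty$, where $\partial^\alpha$ runs over all partial derivatives (in the real coordinates, equivalently in $z_i,\bar z_i$) taken in the distributional sense and $dV$ is Lebesgue measure. Let $\mathcal{S}(\mathbb{H}_1,L^\infty)=\{\alpha=(\alpha_1,\alpha_2)\in\mathbb{Z}^2:\alpha_1\ge 0,\ \alpha_1+\alpha_2\ge 0\}$, the set of exponents of monomials $z^\alpha=z_1^{\alpha_1}z_2^{\alpha_2}$ that are bounded on $\mathbb{H}_1$. The $L^\infty$ sub-Bergman kernel is $$\widetilde{B^\infty}(z,w)=\sum_{\alpha\in\mathcal{S}(\mathbb{H}_1,L^\infty)}\frac{z^\alpha\,\bar w^\alpha}{\|z^\alpha\|^2_{L^2(\mathbb{H}_1)}},$$ and the $L^\infty$ sub-Bergman projection is $\widetilde{\boldsymbol{B}^\infty}f(z)=\int_{\mathbb{H}_1}\widetilde{B^\infty}(z,w)f(w)\,dV(w)$,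 whenever the integral converges. *)

(* Defs.v *)
From HB Require Import structures.
From mathcomp Require Import all_boot all_order all_algebra.
From mathcomp Require Import all_classical all_reals all_analysis.
From mathcomp Require Import complex.

Set Implicit Arguments.
Unset Strict Implicit.
Unset Printing Implicit Defensive.

Import Order.TTheory GRing.Theory Num.Theory.
Import numFieldNormedType.Exports.

Local Open Scope classical_set_scope.
Local Open Scope ring_scope.
Local Open Scope complex_scope.

(* C^2 is represented by its real coordinates ((x1, y1), (x2, y2)), so that it
   carries the product topology and normed space structure over R; [z1] and
   [z2] are the complex coordinates. [mC2 R] is the same carrier, with the
   product Borel sigma-algebra on which Lebesgue measure is defined (the
   measurable sets are the same, but [measurableTypeR R] has another display
   than the canonical instance on [R]). *)
Notation C2 R := ((R * R) * (R * R))%type.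
Notation mC2 R := ((measurableTypeR R * measurableTypeR R) *
                   (measurableTypeR R * measurableTypeR R))%type.

(* [Normc.normc : R[i] -> R] is the real-valued modulus; the library's [`|z|]
   takes its values in R[i]. *)
Notation modulus := Normc.normc.

Section LebesgueMeasureC2.
Variable R : realType.

Definition z1 (z : C2 R) : R[i] := z.1.1 +i* z.1.2.
Definition z2 (z : C2 R) : R[i] := z.2.1 +i* z.2.2.

Definition area : set (measurableTypeR R * measurableTypeR R)%type -> \bar R :=
  (@lebesgue_measure R \x @lebesgue_measure R)%E.

HB.instance Definition _ := Measure.on area.

Lemma area_sigma_finite : sigma_finite setT area.
Proof.
exists (fun n => `[- n%:R, n%:R] `*` `[- n%:R, n%:R]).
  apply/seteqP; split=> // -[x y] _.
  exists (Num.truncn (Num.max `|x| `|y|)).+1 => //=.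
  have := truncnS_gt (Num.max `|x| `|y|).
  rewrite gt_max => /andP[/ltW xn /ltW yn].
  by rewrite !in_itv/= -!ler_norml.
move=> n; split; first exact: measurableX.
rewrite /area product_measure1E//= !lebesgue_measure_itv/=.
by case: ifP => _; rewrite ?mul0e -?EFinD -?EFinM ltry.
Qed.

HB.instance Definition _ :=
  Measure_isSigmaFinite.Build _ _ _ area area_sigma_finite.

Definition dV : {measure set (mC2 R) -> \bar R} := (area \x area)%E.

End LebesgueMeasureC2.

Arguments dV {R}.

Section ComplexIntegration.
Variable R : realType.
Implicit Types (D : set (C2 R)) (f : C2 R -> R[i]).

Definition cmeasurable D f :=
  measurable_fun (D : set (mC2 R)) (fun z => complex.Re (f z)) /\
  measurable_fun (D : set (mC2 R)) (fun z => complex.Im (f z)).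

Definition cintegrable D f :=
  dV.-integrable D (fun z => (complex.Re (f z))%:E) /\
  dV.-integrable D (fun z => (complex.Im (f z))%:E).

Definition cintegral D f : R[i] :=
  (\int[dV]_(z in D) complex.Re (f z)) +i* (\int[dV]_(z in D) complex.Im (f z)).

Definition clocally_integrable D f :=
  cmeasurable D f /\
  forall K : set (C2 R), compact K -> K `<=` D ->
    (\int[dV]_(z in K) (modulus (f z))%:E < +oo)%E.

Definition L2_normsq D f : R := \int[dV]_(z in D) (modulus (f z) ^+ 2).

End ComplexIntegration.

Section Sobolev.
Variable R : realType.
Implicit Types (Om : set (C2 R)) (phi : C2 R -> R) (f g : C2 R -> R[i]).

Definition dir (j : 'I_4) : C2 R :=
  (((j == 0 :> nat)%:R, (j == 1 :> nat)%:R),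
   ((j == 2 :> nat)%:R, (j == 3 :> nat)%:R)).

Definition partial (j : 'I_4) phi : C2 R -> R := fun z => 'D_(dir j) phi z.

Definition multi_partial (a : 'I_4 -> nat) phi : C2 R -> R :=
  foldr (fun j => iter (a j) (partial j)) phi (enum 'I_4).

(* C^oo: all iterated partial derivatives, in any order, exist everywhere and
   are continuous. *)
Definition smooth phi :=
  forall s : seq 'I_4, continuous (foldr partial phi s) /\
    forall j z, derivable (foldr partial phi s) z (dir j).

(* Real-valued test functions suffice: they span the complex-valued ones. *)
Definition test_function Om phi :=
  smooth phi /\
  exists K : set (C2 R), [/\ compact K, K `<=` Om & forall z, ~ K z -> phi z = 0].

Definition mi_order (a : 'I_4 -> nat) : nat := (\sum_j a j)%N.

Definition is_weak_partial Om (a : 'I_4 -> nat) f g :=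
  [/\ clocally_integrable Om f, clocally_integrable Om g &
      forall phi, test_function Om phi ->
        cintegral Om (fun z => f z * (multi_partial a phi z)%:C) =
        (-1) ^+ mi_order a * cintegral Om (fun z => g z * (phi z)%:C)].

(* A representative of the distributional derivative of f when it is a
   function, which is then unique almost everywhere. *)
Definition weak_partial Om (a : 'I_4 -> nat) f : C2 R -> R[i] :=
  xget (fun=> 0) [set g | is_weak_partial Om a f g].

(* Meaningful when the distributional derivatives of f of order at most k are
   functions; [sobolev] requires it. The multi-indices of order at most k are
   enumerated inside a finite type. *)
Definition sobolev_norm Om (k : nat) (p : R) f : \bar R :=
  ((\sum_(a : {ffun 'I_4 -> 'I_k.+1} | (mi_order (fun j => a j) <= k)%N)
      \int[dV]_(z in Om)
        (modulus (weak_partial Om (fun j => a j) f z) `^ p)%:E) `^ p^-1)%E.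

Definition sobolev Om (k : nat) (p : R) f :=
  (forall a : 'I_4 -> nat, (mi_order a <= k)%N ->
     exists g, is_weak_partial Om a f g) /\
  (sobolev_norm Om k p f < +oo)%E.

End Sobolev.

Section UnorderedSums.
Variables (R : realType) (I : choiceType).

(* Sum of an absolutely summable family: the sum of the positive parts minus
   the sum of the negative parts, componentwise in the complex case. *)
Definition rsum (A : set I) (u : I -> R) : R :=
  fine (\esum_(i in A) (Num.max (u i) 0)%:E -
        \esum_(i in A) (Num.max (- u i) 0)%:E)%E.

Definition csum (A : set I) (u : I -> R[i]) : R[i] :=
  rsum A (fun i => complex.Re (u i)) +i* rsum A (fun i => complex.Im (u i)).

End UnorderedSums.

Definition bounded_exponents : set (int * int) :=
  [set a | 0 <= a.1 /\ 0 <= a.1 + a.2].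

Section HartogsTriangle.
Variable R : realType.

Definition hartogs : set (C2 R) :=
  [set z | modulus (z1 z) < modulus (z2 z) /\ modulus (z2 z) < 1].

Definition monomial (a : int * int) (z : C2 R) : R[i] :=
  z1 z ^ a.1 * z2 z ^ a.2.

Definition sub_bergman_kernel (z w : C2 R) : R[i] :=
  csum bounded_exponents (fun a =>
    monomial a z * (monomial a w)^* / (L2_normsq hartogs (monomial a))%:C).

Definition sub_bergman_integrand (f : C2 R -> R[i]) (z w : C2 R) : R[i] :=
  sub_bergman_kernel z w * f w.

Definition sub_bergman (f : C2 R -> R[i]) (z : C2 R) : R[i] :=
  cintegral hartogs (sub_bergman_integrand f z).

End HartogsTriangle.

Arguments hartogs {R}.

(* Main.v *)
From HB Require Import structures.
Require Import Defs.
From mathcomp Require Import all_boot all_order all_algebra.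
From mathcomp Require Import all_classical all_reals all_analysis.
From mathcomp Require Import measurable_realfun complex.
From mathcomp Require Import ring lra.

(** Write u = z1/z2 and v = z2. In these coordinates the Hartogs triangle H is
    the product of the unit disc and the punctured unit disc, with measure
    |v|^2 dA(u) dA(v), so that all monomials are orthogonal with explicit norms,
      || z^a ||^2 = A^2 / ((a1 + 1) (a1 + a2 + 2)),   A the area of the disc,
    and the sum defining the kernel is elementary. With s = u(z) conj u(w) and
    t = z2 conj w2,
      K(z,w) = A^-2 (1-s)^-2 (2-t) (1-t)^-2.

    Size of K. Up to constants, |K| is at most the positive kernel
      Q(z,w) = |z2|^-1 |1-s|^-2 |1-t|^-2,
    which is bounded on L^p(H) for 1 < p < 4 by a Schur test with the weight
    ((1-|u|^2)(1-|v|^2))^(-1/(pq)). With the Jacobian |v|^2, one of the two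
    Schur integrals contains |v|^(2-p), integrable on the disc exactly for
    p < 4. The Schur integrals reduce to the one-dimensional estimate
      int_0^1 t^-g (1-t)^-d (1-tr)^-1 dt <= C (1-r)^-d
    because the circular mean of |1 - z a|^-2 is computed by the mean value
    property of the Poisson kernel.

    Derivatives. Differentiating under the integral, the weak z_j-derivative of
    the projection of f has kernel D_j = dK/dz_j, which is more singular than Q.
    But D_j is a tangential derivative in w: for the rotation field
    X_j = x_j d/dy_j - y_j d/dx_j in the variable w_j there is an explicit M_j with
      D_j = i X_j M_j,   |w_j M_j| <= C Q.
    Integration by parts moves X_j onto f. There is no boundary term: H is a
    Reinhardt domain, so it is exhausted by compactly supported smooth cutoffs
    invariant under rotation, which X_j annihilates. Hence the derivative is
    -i int M_j X_j f, its modulus is at most C int Q (|df/dx_j| + |df/dy_j|),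
    and the boundedness of Q on L^p concludes.

    What remains is the calculus that gives a meaning to these steps: a class of
    explicit functions closed under differentiation, from which test functions
    are made; the fundamental lemma of the calculus of variations, by which a
    weak derivative is determined almost everywhere; integration by parts against
    test functions; and Fubini for kernels that are bounded when the first
    variable stays in a compact subset of H. *)

Import Order.TTheory GRing.Theory Num.Theory.
Import numFieldNormedType.Exports.
Local Open Scope classical_set_scope.
Local Open Scope ring_scope.
Local Open Scope complex_scope.
Set Implicit Arguments.
Unset Strict Implicit.
Unset Printing Implicit Defensive.

(** * Change of variables in the plane *)

Section affine.
Variable R : realType.
Local Notation leb := (@lebesgue_measure R).

(** Both sides are integrals against measures that agree on half-open
    intervals; uniqueness of Lebesgue measure does the rest. *)
Lemma lebesgue_affine (c d : R) (g : measurableTypeR R -> \bar R) : c != 0 ->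
  measurable_fun setT g -> (forall x, (0 <= g x)%E) ->
  (\int[leb]_x g (c * x + d)%R = (`|c|^-1)%:E * \int[leb]_x g x)%E.
Proof.
move=> c0 mg g0.
pose phi : measurableTypeR R -> measurableTypeR R := fun x => c * x + d.
have mphi : measurable_fun setT phi.
  by apply: (@measurable_funD _ (measurableTypeR R) R) => //; exact: measurable_funM.
have c1 : 0 <= `|c| by [].
pose mu : {measure set (measurableTypeR R) -> \bar R} := mscale (NngNum c1) (measure_function_pushforward__canonical__measure_function_Measure leb mphi).
have E : forall A, measurable A -> leb A = mu A.
  apply: lebesgue_measure_unique => X /ocitvP [->|[[a b] /= ab ->]].
    by rewrite /mu !measure0.
  rewrite /mu /mscale /= lebesgue_measure_itv/= lte_fin ab /pushforward.
  have [cp|cn|ce] := ltrgt0P c.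
  - have -> : phi @^-1` `]a, b] = `](a - d) / c, (b - d) / c]%classic.
      apply/seteqP; split => x; rewrite /phi /= !in_itv/= ltr_pdivrMr// ler_pdivlMr// ;
      move=> /andP[h1 h2]; apply/andP; split; lra.
    rewrite lebesgue_measure_itv/= lte_fin ltr_pM2r ?invr_gt0// ltrD2r ab.
    by rewrite -!EFinD -EFinM; congr EFin; field; lra.
  - have -> : phi @^-1` `]a, b] = `[(b - d) / c, (a - d) / c[%classic.
      apply/seteqP; split => x; rewrite /phi /= !in_itv/= ltr_ndivlMr// ler_ndivrMr// ;
      move=> /andP[h1 h2]; apply/andP; split; lra.
    rewrite lebesgue_measure_itv/= lte_fin ltr_nM2r ?invr_lt0// ltrD2r ab.
    by rewrite -!EFinD -EFinM; congr EFin; field; lra.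
  - by rewrite ce eqxx in c0.
transitivity (\int[pushforward leb phi]_x g x)%E.
  by rewrite ge0_integral_pushforward.
rewrite [in RHS](eq_measure_integral mu); last by move=> A mA _; (exact: E || exact/esym/E).
rewrite /mu ge0_integral_mscale//= muleA -EFinM mulVf ?mul1e//.
by rewrite normr_eq0.
Qed.

End affine.

Section plane.
Variable R : realType.
Local Notation leb := (@lebesgue_measure R).
Local Notation mP := (measurableTypeR R * measurableTypeR R)%type.

Lemma area_tonelli1 (g : mP -> \bar R) : measurable_fun setT g ->
  (forall x, (0 <= g x)%E) ->
  (\int[@area R]_z g z = \int[leb]_x \int[leb]_y g (x, y))%E.
Proof. by move=> mg g0; exact: (@fubini_tonelli1 _ _ _ _ _ leb leb). Qed.

Lemma area_tonelli2 (g : mP -> \bar R) : measurable_fun setT g ->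
  (forall x, (0 <= g x)%E) ->
  (\int[@area R]_z g z = \int[leb]_y \int[leb]_x g (x, y))%E.
Proof. 
move=> mg g0; rewrite (area_tonelli1 mg g0).
exact: (@fubini_tonelli _ _ _ _ _ leb leb).
Qed.

Definition cmulP (a b : R) (z : mP) : mP :=
  (a * z.1 - b * z.2, b * z.1 + a * z.2).

Lemma measurable_affine2 (a b : R) :
  measurable_fun setT (fun z : mP => a * z.1 + b * z.2).
Proof.
apply: (@measurable_funD _ mP R); apply: (@measurable_funM _ mP R) => //.
Qed.

Lemma measurable_cmulP a b : measurable_fun setT (cmulP a b).
Proof.
apply: measurable_fun_pair.
  under eq_fun do rewrite -mulNr.
  exact: measurable_affine2.
exact: measurable_affine2.
Qed.

(** Shears act on one coordinate at a time, so that Tonelli reduces them to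
    affine changes of one variable. *)
Lemma area_shear1 (c d : R) (g : mP -> \bar R) : c != 0 ->
  measurable_fun setT g -> (forall x, (0 <= g x)%E) ->
  (\int[@area R]_z g (c * z.1 + d * z.2, z.2)%R =
    (`|c|^-1)%:E * \int[@area R]_z g z)%E.
Proof.
move=> c0 mg g0.
have m1 : measurable_fun setT (fun z : mP => g (c * z.1 + d * z.2, z.2)%R).
  apply: (measurableT_comp mg); apply: measurable_fun_pair => //.
  exact: measurable_affine2.
rewrite (area_tonelli2 m1)// (area_tonelli2 mg)//.
transitivity (\int[leb]_y ((`|c|^-1)%:E * \int[leb]_x g (x, y)))%E.
  apply: eq_integral => y _ /=.
  rewrite (@lebesgue_affine R c (d * y) (fun x => g (x, y)))//.
  exact: measurable_fun_pair1.
rewrite ge0_integralZl//=.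
- exact: (@measurable_fun_fubini_tonelli_G _ _ _ _ _ leb).
- by move=> y _; exact: integral_ge0.

Qed.

Lemma area_shear2 (c d : R) (g : mP -> \bar R) : c != 0 ->
  measurable_fun setT g -> (forall x, (0 <= g x)%E) ->
  (\int[@area R]_z g (z.1, d * z.1 + c * z.2)%R =
    (`|c|^-1)%:E * \int[@area R]_z g z)%E.
Proof.
move=> c0 mg g0.
have m1 : measurable_fun setT (fun z : mP => g (z.1, d * z.1 + c * z.2)%R).
  apply: (measurableT_comp mg); apply: measurable_fun_pair => //.
  exact: measurable_affine2.
rewrite (area_tonelli1 m1)// (area_tonelli1 mg)//.
transitivity (\int[leb]_x ((`|c|^-1)%:E * \int[leb]_y g (x, y)))%E.
  apply: eq_integral => x _ /=.
  under eq_integral => y _ do rewrite addrC.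
  rewrite (@lebesgue_affine R c (d * x) (fun y => g (x, y)))//.
  exact: measurable_fun_pair2.
rewrite ge0_integralZl//=.
- exact: (@measurable_fun_fubini_tonelli_F _ _ _ _ _ leb).
- by move=> y _; exact: integral_ge0.

Qed.

(** With nonzero real part, multiplication is a composition of two shears; and
    i b = (1+i) (b/2) (1+i). *)
Lemma area_cmul (a b : R) (g : mP -> \bar R) : a ^+ 2 + b ^+ 2 != 0 ->
  measurable_fun setT g -> (forall x, (0 <= g x)%E) ->
  (\int[@area R]_z g (cmulP a b z) =
    ((a ^+ 2 + b ^+ 2)^-1)%:E * \int[@area R]_z g z)%E.
Proof.
wlog a0 : a b g / a != 0 => [nz|] ab mg g0.
  have [a0|a0] := eqVneq a 0; last exact: nz.
  subst a; have b0 : b != 0 by apply: contra_neq ab => ->; ring.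
  under eq_integral => z _.
    have -> : cmulP 0 b z = cmulP 1 1 (cmulP (b / 2) (b / 2) z).
      by rewrite /cmulP/=; congr pair; field.
    over.
  rewrite (nz (b / 2) (b / 2) (fun z => g (cmulP 1 1 z)))//; last 3 first.
  - by rewrite mulf_neq0.
  - rewrite paddr_eq0 ?sqr_ge0// andbb expf_eq0/=; exact: mulf_neq0.
  - exact: (measurableT_comp mg (measurable_cmulP 1 1)).
  rewrite (nz 1 1 g)//.
  rewrite muleA -EFinM; congr (_%:E * _)%E; field.
  by rewrite b0/= -mulr2n mulrn_eq0/= expf_eq0.
have q0 : (a ^+ 2 + b ^+ 2) / a != 0 by rewrite mulf_neq0// invr_eq0.
pose g1 (z : mP) := g (z.1, b / a * z.1 + (a ^+ 2 + b ^+ 2) / a * z.2).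
have mg1 : measurable_fun setT g1.
  apply: (measurableT_comp mg); apply: measurable_fun_pair => //.
  exact: measurable_affine2.
transitivity (\int[@area R]_z g1 (a * z.1 + (-b) * z.2, z.2)%R)%E.
  by apply: eq_integral => z _; rewrite /g1 /cmulP/=; congr g; congr pair; field.
rewrite (@area_shear1 a (-b) g1)//.
rewrite /g1 (@area_shear2 ((a ^+ 2 + b ^+ 2) / a) (b / a) g)// muleA -EFinM.
have -> : `|a|^-1 / `|(a ^+ 2 + b ^+ 2) / a| = (a ^+ 2 + b ^+ 2)^-1.
  by rewrite -invfM -normrM mulrC divfK// ger0_norm// addr_ge0// sqr_ge0.
- by [].
- by move=> z; exact: g0.
Qed.

End plane.

(** * Integrals of radial functions *)

Section radial.
Variable R : realType.
Local Notation leb := (@lebesgue_measure R).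
Local Notation mP := (measurableTypeR R * measurableTypeR R)%type.

Definition nsq (z : mP) : R := z.1 ^+ 2 + z.2 ^+ 2.

Lemma nsq_ge0 z : 0 <= nsq z.
Proof. by rewrite addr_ge0// sqr_ge0. Qed.

Lemma measurable_nsq : measurable_fun setT (nsq : mP -> measurableTypeR R).
Proof.
by apply: (@measurable_funD _ mP R); apply: (@measurable_funX _ mP R).
Qed.

Lemma nsq_cmulP a b z : nsq (cmulP a b z) = (a ^+ 2 + b ^+ 2) * nsq z.
Proof. by rewrite /nsq /cmulP/=; ring. Qed.

Definition disk (r : R) : set mP := [set z | nsq z <= r].

Lemma measurable_disk r : measurable (disk r).
Proof.
rewrite [disk r](_ : _ = setT `&` nsq @^-1` `]-oo, r]%classic).
  by apply: measurable_nsq => //; exact: measurable_itv.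
by rewrite setTI; apply/seteqP; split => z; rewrite /disk/= in_itv.
Qed.

Lemma area_square (r : R) : 0 <= r ->
  area (`[-r, r] `*` `[-r, r]) = ((r + r) ^+ 2)%:E.
Proof.
move=> r0; rewrite /area product_measure1E//=; [|exact: measurable_itv..].
rewrite !lebesgue_measure_itv/= lte_fin.
have [rr|] := ltP (-r) r; first by rewrite -EFinD -EFinM; congr EFin; ring.
move=> rr; have -> : r = 0 by lra.
by rewrite mul0e addr0 expr0n. 
Qed.

Lemma disk_sub_square r : disk (r ^+ 2) `<=` `[-`|r|, `|r|] `*` `[-`|r|, `|r|].
Proof.
move=> [x y]; rewrite /disk /nsq/= => h; rewrite !in_itv/= -!ler_norml.
have := sqr_ge0 x; have := sqr_ge0 y => y0 x0.
by split; rewrite -ler_sqr ?nnegrE// !real_normK ?num_real//; lra.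
Qed.

Definition disk_area : R := fine (area (disk 1)).

Lemma area_disk1 : area (disk 1) = disk_area%:E.
Proof.
rewrite fineK// ge0_fin_numE//.
apply: (@le_lt_trans _ _ (area (`[-`|1 : R|, `|1 : R|] `*` `[-`|1 : R|, `|1|]))).
  apply: le_measure; rewrite ?inE//; last first.
    by have := @disk_sub_square 1; rewrite expr1n.
  - by apply: measurableX; exact: measurable_itv.
  - exact: measurable_disk.
by rewrite area_square// ltry.
Qed.

Lemma disk_area_gt0 : 0 < disk_area.
Proof.
rewrite -lte_fin -area_disk1.
apply: (@lt_le_trans _ _ (area (`[-2^-1, 2^-1] `*` `[-2^-1, 2^-1]))).
  by rewrite area_square// lte_fin; apply: exprn_gt0; lra.
apply: le_measure; rewrite ?inE//.
- by apply: measurableX; exact: measurable_itv.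
- exact: measurable_disk.
- move=> [x y] /=; rewrite !in_itv/= => -[/andP[? ?] /andP[? ?]].
  by rewrite /disk/nsq/=; nra.
Qed.

(** Discs of radius r are images of the unit disc under multiplication by a
    complex number. *)
Lemma area_diskE r : area (disk r) = (disk_area * Num.max r 0)%:E.
Proof.
have [r0|r0|->] := ltgtP r 0.
- rewrite (_ : disk r = set0) ?measure0 ?mulr0//.
  by apply/seteqP; split => // z /= /(le_trans (nsq_ge0 z)); rewrite leNgt r0.
- have s0 : Num.sqrt r != 0 by rewrite sqrtr_eq0 -ltNge.
  have E : (Num.sqrt r)^-1 ^+ 2 + 0 ^+ 2 = r^-1.
    by rewrite expr0n addr0 exprVn sqr_sqrtr// ltW.
  have := @area_cmul R (Num.sqrt r)^-1 0 (EFin \o \1_(disk 1)).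
  rewrite E => /(_ _ _ _); rewrite invrK => h.
  transitivity (\int[@area R]_z (\1_(disk r) z)%:E)%E.
    by rewrite integral_indic// ?setIT//; exact: measurable_disk.
  transitivity (\int[@area R]_z (EFin \o \1_(disk 1)) (cmulP (Num.sqrt r)^-1 0 z))%E.
    apply: eq_integral => z _ /=; congr (_%:E).
    rewrite !indicE; congr (_%:R); congr nat_of_bool.
    apply/idP/idP; rewrite !inE /disk/= nsq_cmulP E mulrC;
      by rewrite ler_pdivrMr// mul1r.
  rewrite h.
  + rewrite integral_indic//= ; last exact: measurable_disk.
    by rewrite setIT area_disk1 mulrC EFinM.
  + by rewrite invr_neq0// gt_eqF.
  + by apply/measurable_EFinP; apply: measurable_indic; exact: measurable_disk.
  + by move=> x; rewrite lee_fin.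
- rewrite mulr0; apply/eqP; rewrite eq_le measure_ge0 andbT.
  have -> : disk 0 = disk (0 ^+ 2) by rewrite expr0n.
  apply: (@le_trans _ _ (area (`[-`|0 : R|, `|0 : R|] `*` `[-`|0 : R|, `|0|]))).
    apply: le_measure; rewrite ?inE//; last exact: disk_sub_square.
    - exact: measurable_disk.
    - by apply: measurableX; exact: measurable_itv.
  by rewrite area_square// normr0 addr0 expr0n.
Qed.

(** Polar integration in the variable |z|^2: the image of the area under |z|^2
    is a multiple of Lebesgue measure on the half-line, by the formula for the
    area of discs. *)
Lemma radial_integral (F : measurableTypeR R -> \bar R) :
  measurable_fun setT F -> (forall t, (0 <= F t)%E) ->
  (\int[@area R]_z F (nsq z) = disk_area%:E * \int[leb]_(t in `[0%R, +oo[) F t)%E.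
Proof.
move=> mF F0.
have d0 : 0 <= disk_area by rewrite ltW// disk_area_gt0.
have mI : measurable (`[0%R, +oo[%classic : set (measurableTypeR R)).
  exact: measurable_itv.
pose mu1 : {measure set (measurableTypeR R) -> \bar R} :=
  measure_function_pushforward__canonical__measure_function_Measure
   (@area R) measurable_nsq.
pose mu2 : {measure set (measurableTypeR R) -> \bar R} :=
  mscale (NngNum d0) (mrestr leb mI).
have E : forall A, measurable A -> mu1 A = mu2 A.
  move=> A mA.
  apply: (@g_sigma_algebra_measure_unique _ R (measurableTypeR R) (@ocitv R) _
    (fun n => `]- n%:R, n%:R]%classic) _ _ mu1 mu2 _ _ _ A mA) => //.
  - by move=> X oX; exact: sub_sigma_algebra.
  - by move=> n; exact: is_ocitv.
  - apply/seteqP; split=> // x _.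
    exists (Num.truncn `|x|).+1 => //=.
    have := truncnS_gt `|x|; rewrite in_itv/= => h.
    by move: h; rewrite ltr_norml => /andP[-> /ltW ->].
  - exact: ocitvI.
  - move=> X /ocitvP [->|[[a b] /= ab ->]]; first by rewrite !measure0.
    rewrite /mu1 /mu2 /mscale /= /pushforward /mrestr.
    have -> : nsq @^-1` `]a, b] = disk b `\` disk a.
      apply/seteqP; split => z; rewrite /disk /= in_itv/=.
        by move=> /andP[h1 h2]; split => //; apply/negP; rewrite -ltNge.
      by move=> [-> /negP]; rewrite -ltNge => ->.
    have ba : disk b `&` disk a = disk a.
      by apply/setIidPr => z; rewrite /disk/= => h; lra.
    have -> : area (disk b `\` disk a) = (area (disk b) - area (disk b `&` disk a))%E.
      apply: (measureD (mu := @area R)); try exact: measurable_disk.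
      by change (area (disk b) < +oo)%E; rewrite area_diskE ltry.
    rewrite ba !area_diskE.
    have -> : `]a, b] `&` `[0%R, +oo[ =
        [set` Interval (if a < 0 then BLeft 0 else BRight a) (BRight b)].
      apply/seteqP; split => z /=; rewrite !in_itv/= andbT.
        by move=> [/andP[? ?] ?]; case: ifPn => _ /=; apply/andP; split.
      case: ifPn => /= h /andP[? ?]; split; rewrite -?leNgt in h *; lra.
    rewrite lebesgue_measure_itv.
    have [a0|a0] := ltP a 0.
      have [b0|b0] := ltP 0 b.
        by rewrite /= lte_fin b0 mulr0 sube0 oppr0 adde0 EFinM.
      by rewrite /= lte_fin ltNge b0/= !mulr0 sube0 mule0.
    have b0 : 0 < b by lra.
    by rewrite (max_idPl (ltW b0))/= lte_fin ab -!EFinD -EFinM mulrBr.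
  - move=> n; rewrite /mu1/= /pushforward.
    apply: (@le_lt_trans _ _ (area (disk n%:R))).
      apply: le_measure; rewrite ?inE//.
      + by rewrite -[X in measurable X]setTI; apply: measurable_nsq => //; exact: measurable_itv.
      + exact: measurable_disk.
      + by move=> z; rewrite /disk/= in_itv/= => /andP[].
    by rewrite area_diskE ltry.
transitivity (\int[mu1]_(x in `[0%R, +oo[) F x)%E.
  rewrite ge0_integral_pushforward//; first last.
  - exact: measurable_funTS.
  - exact: measurable_nsq.
  congr integral; apply/seteqP; split => // z _ /=.
  by rewrite in_itv/= nsq_ge0.
have mF' : measurable_fun (`[0%R, +oo[%classic : set (measurableTypeR R)) F.
  exact: measurable_funTS.
rewrite (eq_measure_integral (mscale (NngNum d0) leb)).
  by rewrite ge0_integral_mscale.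
move=> A mA AD; rewrite E// /mu2 /mscale/= /mrestr.
by congr (_ * leb _)%E; apply/setIidPl.
Qed.

End radial.

(** * Complex numbers through their real and imaginary parts *)

Section complex_basics.
Variable R : realType.
Implicit Types x y z : R[i].
Local Notation Re := (@complex.Re R).
Local Notation Im := (@complex.Im R).

(** The squared modulus, with real values. *)
Definition normsq z : R := Re z ^+ 2 + Im z ^+ 2.

Lemma normsq_ge0 z : 0 <= normsq z. Proof. by rewrite addr_ge0// sqr_ge0. Qed.

Lemma normsq_eq0 z : (normsq z == 0) = (z == 0).
Proof.
case: z => a b; rewrite /normsq/= paddr_eq0 ?sqr_ge0// !sqrf_eq0.
by rewrite eq_complex.
Qed.

Lemma normsq_gt0 z : (0 < normsq z) = (z != 0).
Proof. by rewrite lt_neqAle normsq_ge0 eq_sym normsq_eq0 andbT. Qed.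

Lemma normsqM x y : normsq (x * y) = normsq x * normsq y.
Proof. by case: x => a b; case: y => c d; rewrite /normsq/=; ring. Qed.

Lemma normsq1 : normsq 1 = 1. Proof. by rewrite /normsq/= expr1n expr0n addr0. Qed.

Lemma normsq0 : normsq 0 = 0. Proof. by rewrite /normsq/= expr0n addr0. Qed.

Lemma normsqX x n : normsq (x ^+ n) = normsq x ^+ n.
Proof. by elim: n => [|n IH]; rewrite ?expr0 ?normsq1// !exprS normsqM IH. Qed.

Lemma normsqV x : normsq x^-1 = (normsq x)^-1.
Proof.
have [->|x0] := eqVneq x 0; first by rewrite invr0 normsq0 invr0.
apply: (@mulfI _ (normsq x)); first by rewrite normsq_eq0.
by rewrite -normsqM !divff ?normsq1// normsq_eq0.
Qed.

Lemma normsqN x : normsq (- x) = normsq x.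
Proof. by case: x => a b; rewrite /normsq/= !sqrrN. Qed.

Lemma normsqJ x : normsq (x^*)%C = normsq x.
Proof. by case: x => a b; rewrite /normsq/= sqrrN. Qed.

Lemma normc_sqrt x : Normc.normc x = Num.sqrt (normsq x).
Proof. by case: x. Qed.

Lemma normsq_normc x : normsq x = Normc.normc x ^+ 2.
Proof. by rewrite normc_sqrt sqr_sqrtr// normsq_ge0. Qed.

Lemma normc_ge0 x : 0 <= Normc.normc x.
Proof. by rewrite normc_sqrt sqrtr_ge0. Qed.

Lemma normcJ x : Normc.normc (x^*)%C = Normc.normc x.
Proof. by rewrite !normc_sqrt normsqJ. Qed.

Lemma normcXn x n : Normc.normc (x ^+ n) = Normc.normc x ^+ n.
Proof.
by elim: n => [|n IH]; rewrite ?expr0 ?normc_sqrt ?normsq1 ?sqrtr1// !exprS -!normc_sqrt Normc.normcM IH.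
Qed.

Lemma normc_sub1 x : 1 - Normc.normc x <= Normc.normc (1 - x).
Proof.
have := le_normcD (1 - x) x; rewrite subrK Normc.normc1; lra.
Qed.

Lemma normc_Re x : `|Re x| <= Normc.normc x.
Proof.
rewrite normc_sqrt -[`|_|]ger0_norm// -sqrtr_sqr ler_wsqrtr// real_normK ?num_real//.
by rewrite /normsq lerDl sqr_ge0.
Qed.

Lemma normc_Im x : `|Im x| <= Normc.normc x.
Proof.
rewrite normc_sqrt -[`|_|]ger0_norm// -sqrtr_sqr ler_wsqrtr// real_normK ?num_real//.
by rewrite /normsq lerDr sqr_ge0.
Qed.

Lemma normc_le_ReIm x : Normc.normc x <= `|Re x| + `|Im x|.
Proof.
rewrite normc_sqrt -[leRHS]ger0_norm ?addr_ge0// -sqrtr_sqr ler_wsqrtr//.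
rewrite sqrrD !real_normK ?num_real// /normsq.
by rewrite -addrA lerD2l lerDr mulrn_wge0// mulr_ge0.
Qed.

Lemma ReJ x : Re (x^*)%C = Re x. Proof. by case: x. Qed.
Lemma ImJ x : Im (x^*)%C = - Im x. Proof. by case: x. Qed.
Lemma ReV x : Re x^-1 = Re x * (normsq x)^-1. Proof. by case: x. Qed.
Lemma ImV x : Im x^-1 = - (Im x * (normsq x)^-1). Proof. by case: x => a b; rewrite /= -?mulNr. Qed.

Section complex_measurability.
Context d (T : measurableType d).
Implicit Types f g : T -> R[i].

Definition cmeas f := measurable_fun setT (fun t => Re (f t)) /\
  measurable_fun setT (fun t => Im (f t)).

Lemma cmeas_cst c : cmeas (fun=> c).
Proof. by split; exact: measurable_cst. Qed.

Lemma cmeasD f g : cmeas f -> cmeas g -> cmeas (fun t => f t + g t).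
Proof.
move=> [f1 f2] [g1 g2]; split.
  under eq_fun do rewrite raddfD. exact: measurable_funD.
under eq_fun do rewrite raddfD. exact: measurable_funD.
Qed.

Lemma cmeasN f : cmeas f -> cmeas (fun t => - f t).
Proof.
move=> [f1 f2]; split.
  under eq_fun do rewrite raddfN. exact: measurableT_comp.
under eq_fun do rewrite raddfN. exact: measurableT_comp.
Qed.

Lemma cmeasB f g : cmeas f -> cmeas g -> cmeas (fun t => f t - g t).
Proof. by move=> hf hg; apply: cmeasD => //; exact: cmeasN. Qed.

Lemma ReM x y : Re (x * y) = Re x * Re y - Im x * Im y.
Proof. by case: x; case: y. Qed.

Lemma ImM x y : Im (x * y) = Re x * Im y + Im x * Re y.
Proof. by case: x => a b; case: y => c e /=; rewrite addrC; ring. Qed.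

Lemma cmeasM f g : cmeas f -> cmeas g -> cmeas (fun t => f t * g t).
Proof.
move=> [f1 f2] [g1 g2]; split.
  under eq_fun do rewrite ReM.
  by apply: measurable_funB; apply: measurable_funM.
under eq_fun do rewrite ImM.
by apply: measurable_funD; apply: measurable_funM.
Qed.

Lemma cmeasX f n : cmeas f -> cmeas (fun t => f t ^+ n).
Proof.
move=> hf; elim: n => [|n IH]; first exact: cmeas_cst.
by under eq_fun do rewrite exprS; exact: cmeasM.
Qed.

Lemma cmeasJ f : cmeas f -> cmeas (fun t => (f t)^*)%C.
Proof.
move=> [f1 f2]; split.
  by under eq_fun do rewrite ReJ.
under eq_fun do rewrite ImJ.
exact: measurableT_comp.
Qed.

Lemma cmeas_normsq f : cmeas f -> measurable_fun setT (fun t => normsq (f t)).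
Proof. by move=> [f1 f2]; apply: measurable_funD; exact: measurable_funX. Qed.

Lemma measurable_inv_ge0 (f : T -> R) : (forall t, 0 <= f t) ->
  measurable_fun setT f -> measurable_fun setT (fun t => (f t)^-1).
Proof.
move=> f0 mf.
rewrite (_ : (fun t => (f t)^-1) = (fun t => (f t) `^ (-1))).
  exact: (measurableT_comp (@measurable_powR R (-1))).
by apply/funext => t; rewrite powR_inv1.
Qed.

Lemma cmeasV f : cmeas f -> cmeas (fun t => (f t)^-1).
Proof.
move=> hf; have [f1 f2] := hf.
have m : measurable_fun setT (fun t => (normsq (f t))^-1).
  by apply: measurable_inv_ge0; [move=> t; exact: normsq_ge0|exact: cmeas_normsq].
split.
  under eq_fun do rewrite ReV.
  exact: measurable_funM.
under eq_fun do rewrite ImV.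
by apply: measurableT_comp => //; exact: measurable_funM.
Qed.

Lemma cmeas_normc f : cmeas f -> measurable_fun setT (fun t => Normc.normc (f t)).
Proof.
move=> hf; under eq_fun do rewrite normc_sqrt.
by apply: (measurableT_comp (continuous_measurable_fun (@sqrt_continuous R))); exact: cmeas_normsq.
Qed.

Lemma cmeas_real (f : T -> R) : measurable_fun setT f -> cmeas (fun t => (f t)%:C).
Proof. by move=> mf; split => //=; exact: measurable_cst. Qed.

End complex_measurability.

End complex_basics.

(** Writing 1/f = f/f^2 reduces to a nonnegative denominator; the value 0 of
    the inverse at 0 is the right one. *)
Lemma measurable_inv (R : realType) d (T : measurableType d) (f : T -> R) :
  measurable_fun setT f -> measurable_fun setT (fun t => (f t)^-1).
Proof.
move=> mf; rewrite (_ : (fun t => (f t)^-1) = (fun t => f t * (f t ^+ 2)^-1)).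
  apply: measurable_funM => //; apply: measurable_inv_ge0.
    by move=> t; exact: sqr_ge0.
  exact: measurable_funX.
apply/funext => t; have [->|t0] := eqVneq (f t) 0; first by rewrite invr0 mul0r.
by field.
Qed.

(** * Circular means of the Poisson kernel *)

Section mean_value.
Variable R : realType.
Local Notation leb := (@lebesgue_measure R).
Local Notation mP := (measurableTypeR R * measurableTypeR R)%type.

Definition toC (z : mP) : R[i] := z.1 +i* z.2.

Lemma cmeas_toC : cmeas toC.
Proof. by split; [exact: measurable_fst|exact: measurable_snd]. Qed.

(** Multiplication by c scales areas by |c|^2. *)
Lemma area_mulC (c : R[i]) (G : R[i] -> \bar R) : c != 0 ->
  measurable_fun setT (fun z : mP => G (toC z)) -> (forall x, (0 <= G x)%E) ->
  (\int[@area R]_z G (c * toC z)%R = (normsq c)^-1%:E * \int[@area R]_z G (toC z))%E.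
Proof.
case: c => a b c0 mG G0.
rewrite -(@area_cmul R a b (fun z => G (toC z)))//; last first.
  by rewrite -[X in X != _]/(normsq (a +i* b)) normsq_eq0.
by apply: eq_integral => -[x y] _; congr G; rewrite /toC /cmulP/=; apply/eqP;
  rewrite eq_complex/= eqxx/= [X in X == _]addrC.
Qed.

(** The rotations by these numbers exchange the powers x^(2^k) and -x^(2^k). *)
Lemma exists_root_m1 k : exists2 w : R[i], w ^+ (2 ^ k) = -1 & normsq w = 1.
Proof.
have [w wE] : exists w : R[i], w ^+ (2 ^ k) = -1.
  elim: k => [|k [w wE]]; first by exists (-1).
  by exists (sqrtc w); rewrite expnS exprM sqr_sqrtc.
exists w => //; have := congr1 (@normsq R) wE; rewrite normsqX normsqN normsq1 => /eqP.
by rewrite pexpr_eq1 ?expn_gt0 ?normsq_ge0// => /eqP.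
Qed.

Definition poisson (x : R[i]) : R := (1 - normsq x) / normsq (1 - x).

(** The Poisson kernel is 1 + 2 Re (x + x^2 + ...), so the odd terms cancel. *)
Lemma poissonD x : normsq x < 1 ->
  poisson x + poisson (- x) = 2 * poisson (x ^+ 2).
Proof.
move=> x1.
have h1 : 1 - x != 0.
  by apply/negP; rewrite subr_eq0 => /eqP xe; move: x1; rewrite -xe normsq1 ltxx.
have h2 : 1 + x != 0.
  apply/negP; rewrite addr_eq0 => /eqP xe; move: x1.
  by rewrite -(normsqN x) -xe normsq1 ltxx.
have E : 1 - x ^+ 2 = (1 - x) * (1 + x) by ring.
rewrite /poisson E normsqX normsqN opprK normsqM.
have n1 : normsq (1 - x) != 0 by rewrite normsq_eq0.
have n2 : normsq (1 + x) != 0 by rewrite normsq_eq0.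
have : normsq (1 + x) + normsq (1 - x) = 2 * (1 + normsq x).
  by case: x {x1 h1 h2 E n1 n2} => a b; rewrite /normsq /=; ring.
move: n1 n2; set A := normsq _; set B := normsq _ => n1 n2 AB.
rewrite [RHS](_ : _ = (1 - normsq x) * (B + A) / (A * B)); first by field; rewrite n1 n2.
by rewrite AB; field; rewrite n1 n2.
Qed.

Lemma poisson_ge0 x : normsq x <= 1 -> 0 <= poisson x.
Proof. by move=> x1; rewrite divr_ge0 ?normsq_ge0// subr_ge0. Qed.

Lemma poisson_le4 x : normsq x <= 4^-1 -> poisson x <= 4.
Proof.
move=> x4.
have nx : Normc.normc x <= 2^-1.
  rewrite normc_sqrt -[leRHS]ger0_norm// -sqrtr_sqr ler_wsqrtr//.
  by apply: (le_trans x4); lra.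
have n1 : 2^-1 <= Normc.normc (1 - x).
  by apply: le_trans (normc_sub1 x); lra.
have n2 : 4^-1 <= normsq (1 - x).
  rewrite normsq_normc.
  have -> : (4^-1 : R) = 2^-1 ^+ 2 by field.
  by rewrite ler_sqr ?nnegrE ?normc_ge0.
rewrite /poisson ler_pdivrMr; last by lra.
have := normsq_ge0 x; lra.
Qed.

Lemma measurable_poisson d (T : measurableType d) (f : T -> R[i]) :
  cmeas f -> measurable_fun setT (fun t => poisson (f t)).
Proof.
move=> hf; apply: measurable_funM.
  by apply: measurable_funB => //; exact: cmeas_normsq.
apply: measurable_inv_ge0; first by move=> t; exact: normsq_ge0.
by apply: cmeas_normsq; apply: cmeasB => //; exact: cmeas_cst.
Qed.

Section doubling.
Variables (F : R -> R) (a : R[i]).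
Hypothesis mF : measurable_fun setT F.
Hypothesis F0 : forall t, 0 <= F t.
Hypothesis F1 : forall t, 1 <= t -> F t = 0.
Hypothesis a1 : normsq a < 1.

Let I k := (\int[@area R]_z (F (normsq (toC z)) * poisson ((toC z * a) ^+ (2 ^ k)))%:E)%E.

Let integrand_ge0 k x : 0 <= F (normsq x) * poisson ((x * a) ^+ (2 ^ k)).
Proof.
have [h|h] := leP 1 (normsq x); first by rewrite F1// mul0r.
rewrite mulr_ge0// poisson_ge0// normsqX normsqM exprn_ile1 ?mulr_ge0 ?normsq_ge0//.
by rewrite mulr_ile1 ?normsq_ge0// ltW.
Qed.

Let mintegrand (g : mP -> R[i]) : cmeas g ->
  measurable_fun setT (fun z : mP => (F (normsq (toC z)) * poisson (g z))%:E).
Proof.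
move=> mg; apply/measurable_EFinP; apply: measurable_funM.
  by apply: (measurableT_comp mF); exact: measurable_nsq.
exact: measurable_poisson.
Qed.

Let mpow k : cmeas (fun z => (toC z * a) ^+ (2 ^ k)).
Proof.
by apply: cmeasX; apply: cmeasM; [exact: cmeas_toC|exact: cmeas_cst].
Qed.

Let doubling k : I k = I k.+1.
Proof.
have [w wE w1] := exists_root_m1 k.
have w0 : w != 0 by rewrite -normsq_gt0 w1.
have Ik : I k = (\int[@area R]_z
    (F (normsq (toC z)) * poisson (- (toC z * a) ^+ (2 ^ k)))%:E)%E.
  have := @area_mulC w (fun x => (F (normsq x) * poisson ((x * a) ^+ (2 ^ k)))%:E) w0.
  rewrite w1 invr1 mul1e /I => <-.
  - apply: eq_integral => z _; rewrite normsqM w1 mul1r.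
    by rewrite -mulrA exprMn wE mulN1r.
  - exact: mintegrand.
  - by move=> x; rewrite lee_fin.
have g0 x : 0 <= F (normsq x) * poisson (- (x * a) ^+ (2 ^ k)).
  have [h|h] := leP 1 (normsq x); first by rewrite F1// mul0r.
  rewrite mulr_ge0// poisson_ge0// normsqN normsqX normsqM exprn_ile1 ?mulr_ge0 ?normsq_ge0//.
  by rewrite mulr_ile1 ?normsq_ge0// ltW.
have E2 : (I k + I k = 2%:E * I k.+1)%E.
  rewrite {2}Ik /I -ge0_integralD//=; first last.
  - by apply: mintegrand; apply: cmeasN.
  - by move=> z _; rewrite lee_fin.
  - exact: mintegrand.
  - by move=> z _; rewrite lee_fin.
  rewrite -ge0_integralZl//=; first last.
  - by move=> z _; rewrite lee_fin.
  - exact: mintegrand.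
  apply: eq_integral => z _; rewrite -EFinD -EFinM; congr EFin.
  rewrite -mulrDr; have [h|h] := leP 1 (normsq (toC z)); first by rewrite F1// !mul0r mulr0.
  rewrite poissonD.
    by rewrite -exprM -expnSr mulrCA.
  rewrite normsqX normsqM exprn_ilt1// ?mulr_ge0 ?normsq_ge0// -?lt0n ?expn_gt0//.
  by rewrite -[ltRHS]mul1r ltr_pM ?normsq_ge0.
have : (2%:E * I k = 2%:E * I k.+1)%E.
  by rewrite -E2 mule_natl mule2n.
have h2 : (2 : R) != 0 by [].
move=> /(congr1 (fun y => (2^-1)%:E * y)%E).
by rewrite !muleA -!EFinM mulVf// !mul1e.
Qed.

(** The mean of the Poisson kernel over circles is 1. Rotation invariance and
    the doubling formula replace z a by its power (z a)^(2^k), and for k large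
    this is so small that the kernel is at most 4; the constant 4 saves a
    limit. *)
Lemma poisson_mean : (\int[@area R]_z (F (normsq (toC z)) * poisson (toC z * a))%:E <=
  4%:E * \int[@area R]_z (F (normsq (toC z)))%:E)%E.
Proof.
have Ik k : I 0 = I k by elim: k => // k ->; exact: doubling.
have [k hk] : exists k, normsq a ^+ (2 ^ k) <= 4^-1.
  have := @cvg_expr R (normsq a); rewrite ger0_norm ?normsq_ge0// => /(_ a1).
  have q : (0 : R) < 4^-1 by rewrite invr_gt0.
  move=> /cvgrPdist_le /(_ _ q) [N _ h].
  exists N; have := h (2 ^ N)%N; rewrite /= => /(_ (ltnW (ltn_expl N (isT : (1 < 2)%N)))).
  by rewrite sub0r normrN ger0_norm// exprn_ge0// normsq_ge0.
have -> : (\int[@area R]_z (F (normsq (toC z)) * poisson (toC z * a))%:E)%E = I 0.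
  by [].
rewrite (Ik k) /I -ge0_integralZl//=; first last.
- by move=> z _; rewrite lee_fin.
- by apply/measurable_EFinP; apply: (measurableT_comp mF); exact: measurable_nsq.
apply: ge0_le_integral => //=.
- by move=> z _; rewrite lee_fin.
- exact: mintegrand.
- apply: measurable_funeM.
  by apply/measurable_EFinP; apply: (measurableT_comp mF); exact: measurable_nsq.
move=> z _; rewrite -EFinM lee_fin [leRHS]mulrC.
have [h|h] := leP 1 (normsq (toC z)); first by rewrite F1// !mul0r.
apply: ler_wpM2l => //; apply: poisson_le4.
rewrite normsqX normsqM; apply: le_trans hk; rewrite exprMn ler_piMl ?exprn_ge0 ?normsq_ge0//.
by rewrite exprn_ile1 ?normsq_ge0// ltW.
Qed.

End doubling.

(** On |z|^2 = t the kernel |1 - z a|^-2 is the Poisson kernel of z a divided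
    by 1 - t |a|^2. *)
Lemma radial_kernel_le (F : R -> R) (a : R[i]) :
  measurable_fun setT F -> (forall t, 0 <= F t) -> (forall t, 1 <= t -> F t = 0) ->
  normsq a < 1 ->
  (\int[@area R]_z (F (normsq (toC z)) / normsq (1 - toC z * a))%:E <=
   (4 * disk_area R)%:E * \int[leb]_(t in `[0%R, +oo[) (F t / (1 - t * normsq a))%:E)%E.
Proof.
move=> mF F0 F1 a1.
pose F' t : R := F t / `|1 - t * normsq a|.
have mF' : measurable_fun setT F'.
  apply: measurable_funM => //; apply: measurable_inv_ge0 => //.
  apply: measurableT_comp => //; apply: measurable_funB => //.
  exact: measurable_funM.
have F'0 t : 0 <= F' t by rewrite divr_ge0.
have F'1 t : 1 <= t -> F' t = 0 by move=> t1; rewrite /F' F1// mul0r.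
have pos t : 0 <= t -> t < 1 -> 0 < 1 - t * normsq a.
  move=> t0 t1; rewrite subr_gt0 -[ltRHS]mul1r.
  by have := normsq_ge0 a; nra.
apply: (@le_trans _ _ (4%:E * \int[@area R]_z (F' (normsq (toC z)))%:E)%E).
  apply: le_trans (poisson_mean mF' F'0 F'1 a1).
  rewrite le_eqVlt; apply/orP; left; apply/eqP; apply: eq_integral => z _.
  congr EFin; have [h|h] := leP 1 (normsq (toC z)); first by rewrite F'1// F1// !mul0r.
  have p := pos _ (normsq_ge0 _) h.
  rewrite /F' /poisson normsqM (ger0_norm (ltW p)).
  by rewrite mulrA divfK// gt_eqF.
rewrite EFinM -muleA lee_pmul2l//.
rewrite (_ : (fun z => _) = (fun z => (EFin \o F') (nsq z)))//.
rewrite radial_integral//; first last.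
- exact/measurable_EFinP.
rewrite lee_pmul2l//; last by rewrite lte_fin disk_area_gt0.
rewrite le_eqVlt; apply/orP; left; apply/eqP; apply: eq_integral => t.
rewrite inE/= in_itv/= andbT => t0; congr EFin.
have [h|h] := leP 1 t; first by rewrite F'1// F1// mul0r.
by rewrite /F' ger0_norm// ltW// pos.
Qed.

End mean_value.

(** * One-variable Forelli-Rudin estimates *)

Section power_integrals.
Variable R : realType.
Local Notation leb := (@lebesgue_measure R).

Lemma powR_continuous_gt0 (c x : R) : 0 < x -> {for x, continuous (fun t : R => t `^ c)}.
Proof.
move=> x0; apply: differentiable_continuous; apply/derivable1_diffP.
exact: (@ex_derive _ _ _ _ _ _ _ (is_derive1_powR c x0)).
Qed.

Lemma integral_powR (c a b : R) : 0 < a -> a <= b -> c != 0 ->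
  (\int[leb]_(x in `[a, b]) (x `^ (c - 1))%:E = ((b `^ c - a `^ c) / c)%:E)%E.
Proof.
move=> a0; rewrite le_eqVlt => /orP[/eqP <- _|ab c0].
  by rewrite set_itv1 integral_set1 subrr mul0r.
pose F : R -> R := c^-1 \*: (fun x : R => x `^ c).
have dF (x : R) : 0 < x -> is_derive x 1 F (x `^ (c - 1)).
  move=> x0; have h := is_derive1_powR c x0.
  rewrite [X in is_derive _ _ _ X](_ : _ = c^-1 *: (c * x `^ (c - 1))); last first.
    by rewrite /GRing.scale/= mulrA mulVf// mul1r.
  exact: is_deriveZ.
have cF (x : R) : 0 < x -> {for x, continuous F}.
  move=> x0; apply: differentiable_continuous; apply/derivable1_diffP.
  exact: (@ex_derive _ _ _ _ _ _ _ (dF x x0)).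
rewrite (@continuous_FTC2 R _ F)//.
- by rewrite /F -EFinB /= /GRing.scale/= -mulrBr mulrC.
- apply: continuous_in_subspaceT => x; rewrite inE/= in_itv/= => /andP[ax _].
  by apply: powR_continuous_gt0; lra.
- split.
  + move=> x; rewrite in_itv/= => /andP[ax _].
    have x0 : 0 < x by lra.
    exact: (@ex_derive _ _ _ _ _ _ _ (dF x x0)).
  + by apply: cvg_at_right_filter; exact: cF.
  + by apply: cvg_at_left_filter; apply: cF; lra.
- move=> x; rewrite in_itv/= => /andP[ax _]; have x0 : 0 < x by lra.
  by rewrite derive1E; exact: (@derive_val _ _ _ _ _ _ _ (dF x x0)).
Qed.

Lemma measurable_powRE (c : R) D : measurable_fun (D : set (measurableTypeR R)) (fun x : R => (x `^ c)%:E).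
Proof.
apply/measurable_EFinP; apply: measurable_funTS; exact: measurable_powR.
Qed.

(** Monotone limit of the integrals over [b/(n+1), b]. *)
Lemma integral_powR0_le (k b : R) : k < 1 -> 0 < b ->
  (\int[leb]_(x in `]0%R, b]) (x `^ (- k))%:E <= (b `^ (1 - k) / (1 - k))%:E)%E.
Proof.
move=> k1 b0.
pose F n := `[b / n.+1%:R, b]%classic : set (measurableTypeR R).
have <- : \bigcup_n F n = `]0%R, b]%classic.
  apply/seteqP; split => x.
    move=> [n _]; rewrite /F/= !in_itv/= => /andP[h ->]; rewrite andbT.
    by apply: lt_le_trans h; rewrite divr_gt0.
  rewrite /= in_itv/= => /andP[x0 xb].
  exists (Num.truncn (b / x)) => //; rewrite /F /= in_itv/= xb andbT.
  rewrite ler_pdivrMr// mulrC -ler_pdivrMr//; apply/ltW; exact: truncnS_gt.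
have h := @ge0_nondecreasing_set_cvg_integral _ _ _ F (fun x => (x `^ (- k))%:E) leb.
have {h} : (\int[leb]_(x in F i) (x `^ (- k))%:E)%E @[i --> \oo] -->
    (\int[leb]_(x in \bigcup_n F n) (x `^ (- k))%:E)%E.
  apply: h.
  - move=> n m nm; apply/subsetPset => x; rewrite /F/= !in_itv/= => /andP[h ->].
    rewrite andbT; apply: le_trans h; rewrite ler_pM2l// lef_pV2 ?posrE//.
    by rewrite ler_nat.
  - by move=> i; exact: measurable_itv.
  - by move=> i; exact: measurable_powRE.
  - by move=> i x _; rewrite lee_fin powR_ge0.
move=> h; rewrite -(cvg_lim _ h)//.
apply: lime_le; first by apply/cvg_ex; eexists; exact: h.
near=> n; rewrite /F.
have := @integral_powR (1 - k) (b / n.+1%:R) b.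
rewrite (_ : 1 - k - 1 = - k); last by ring.
move=> ->; rewrite ?lee_fin.
- rewrite ler_pM2r ?invr_gt0 ?subr_gt0//.
  by rewrite gerBl powR_ge0.
- by rewrite divr_gt0.
- by rewrite ler_pdivrMr// ler_peMr ?ler1n// ltW.
- by rewrite gt_eqF// subr_gt0.
Unshelve. all: by end_near.
Qed.

Lemma integral_powR1_le (d s : R) : 0 < d -> 0 < s ->
  (\int[leb]_(x in `[s, 1%R]) (x `^ (- d - 1))%:E <= (s `^ (- d) / d)%:E)%E.
Proof.
move=> d0 s0; have [s1|s1] := leP s 1; last first.
  rewrite set_itv_ge ?integral_set0 ?lee_fin ?divr_ge0 ?powR_ge0 ?ltW//.
  by rewrite bnd_simp -ltNge.
rewrite integral_powR// ?oppr_eq0 ?gt_eqF// lee_fin.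
rewrite powR1 invrN mulrN -mulNr opprB ler_pM2r ?invr_gt0//.
by rewrite gerBl.
Qed.

End power_integrals.

Section forelli_rudin_1d.
Variable R : realType.
Local Notation leb := (@lebesgue_measure R).

(** The weight t^-g (1-t)^-d on [0,1). *)
Definition radial_weight (g d t : R) : R := t `^ (- g) * (1 - t) `^ (- d) * \1_(`[0, 1[%classic : set R) t.

Lemma radial_weight_ge0 g d t : 0 <= radial_weight g d t.
Proof. by rewrite !mulr_ge0 ?powR_ge0. Qed.

Lemma radial_weight_ge1 g d t : 1 <= t -> radial_weight g d t = 0.
Proof.
by move=> t1; rewrite /radial_weight indicE memNset ?mulr0//= in_itv/= => /andP[_]; lra.
Qed.

Lemma measurable_radial_weight g d : measurable_fun setT (radial_weight g d).
Proof.
apply: measurable_funM; last by apply: measurable_indic; exact: measurable_itv.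
apply: measurable_funM; first exact: measurable_powR.
apply: (measurableT_comp (@measurable_powR R (- d))).
exact: measurable_funB.
Qed.

Lemma inv_le2 (x : R) : 2^-1 <= x -> x^-1 <= 2.
Proof. by move=> x2; rewrite -[leRHS]invrK lef_pV2 ?posrE//; lra. Qed.

Lemma powRN_le_inv (x c : R) : 0 < x -> x <= 1 -> c <= 1 -> x `^ (- c) <= x^-1.
Proof.
move=> x0 x1 c1; rewrite -[leRHS]powR_inv1; last exact: ltW.
by apply: ger_powR; rewrite ?x0// lerN2.
Qed.

(** Cut at t = 1/2 and at 1 - t = 1 - r: near 0 the factor t^-g is integrable,
    on 1 - t <= 1 - r one bounds 1/(1-tr) by 1/(1-r), and in between 1/(1-tr)
    is comparable to 1/(1-t). *)
Lemma forelli_rudin1 (g d : R) : g < 1 -> 0 < d -> d < 1 ->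
  exists2 C, 0 <= C & forall r, 0 <= r -> r < 1 ->
  (\int[leb]_(t in `[0%R, +oo[) (radial_weight g d t / (1 - t * r))%:E <= (C * (1 - r) `^ (- d))%:E)%E.
Proof.
move=> g1 d0 d1.
exists (4 / (1 - g) + 2 / (1 - d) + 2 / d).
  by rewrite !addr_ge0// divr_ge0// ltW// subr_gt0.
move=> r r0 r1; set s := 1 - r.
have s0 : 0 < s by rewrite /s; lra.
have s1 : s <= 1 by rewrite /s; lra.
pose h1 : measurableTypeR R -> \bar R := (fun t : R => (t `^ (- g))%:E) \_ `]0%R, 1%R].
pose h2 : measurableTypeR R -> \bar R := (fun t : R => (t `^ (- d))%:E) \_ `]0%R, s].
pose h3 : measurableTypeR R -> \bar R := (fun t : R => (t `^ (- d - 1))%:E) \_ `[s, 1%R].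
have mh (c : R) (i : interval R) :
    measurable_fun setT ((fun t : R => (t `^ c)%:E) \_ [set` i] : measurableTypeR R -> \bar R).
  apply/(measurable_restrictT _ _).1; first exact: measurable_itv.
  exact: measurable_powRE.
have hp (c : R) (i : interval R) x : (0 <= ((fun t : R => (t `^ c)%:E) \_ [set` i]) x)%E.
  by rewrite patchE; case: ifPn => // _; rewrite lee_fin powR_ge0.
have mh' (c : R) (i : interval R) :
    measurable_fun setT (fun x : measurableTypeR R => ((fun t : R => (t `^ c)%:E) \_ [set` i] : measurableTypeR R -> \bar R) (-1 * x + 1)).
  apply: (measurableT_comp (mh c i)) => /=.
  apply: measurable_funD => //; exact: measurable_funM.
have key (t : R) : 0 < t -> ((radial_weight g d t / (1 - t * r))%:E <=
    4%:E * h1 t + ((2 / s)%:E * h2 (-1 * t + 1)%R + 2%:E * h3 (-1 * t + 1)%R))%E.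
  move=> t0; have [t1|t1] := leP 1 t.
    rewrite radial_weight_ge1// mul0r.
    rewrite adde_ge0 ?mule_ge0 ?hp// adde_ge0// mule_ge0 ?hp// lee_fin divr_ge0//.
    exact: ltW.
  have p1 : 0 < 1 - t * r by nra.
  rewrite /radial_weight indicE mem_set/= ?in_itv/= ?(ltW t0)// mulr1.
  have -> : -1 * t + 1 = 1 - t by ring.
  have D0 : 0 <= (1 - t * r)^-1 by rewrite invr_ge0 ltW.
  have A0 : 0 <= t `^ (- g) by exact: powR_ge0.
  have B0 : 0 <= (1 - t) `^ (- d) by exact: powR_ge0.
  have z2 : (0 <= (2 / s)%:E * h2 (1 - t)%R)%E.
    by rewrite mule_ge0 ?hp// lee_fin divr_ge0// ltW.
  have z3 : (0 <= 2%:E * h3 (1 - t)%R)%E by rewrite mule_ge0 ?hp.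
  have z1 : (0 <= 4%:E * h1 t)%E by rewrite mule_ge0 ?hp.
  have [t2|t2] := leP t 2^-1.
    apply: (@le_trans _ _ (4%:E * h1 t)%E); last by rewrite leeDl// adde_ge0.
    have -> : h1 t = (t `^ (- g))%:E.
      by rewrite /h1 patchE ifT// inE/= in_itv/= t0 ltW.
    rewrite -EFinM lee_fin.
    have B2 : (1 - t) `^ (- d) <= 2.
      apply: (@le_trans _ _ (1 - t)^-1); last by apply: inv_le2; lra.
      by apply: powRN_le_inv; rewrite ?subr_gt0 ?gerBl ?ltW.
    have D2 : (1 - t * r)^-1 <= 2.
      by apply: inv_le2; nra.
    rewrite -mulrA mulrC; apply: ler_wpM2r => //.
    by rewrite (_ : 4 = 2 * 2 :> R) ?ler_pM//; ring.
  have A2 : t `^ (- g) <= 2.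
    apply: (@le_trans _ _ t^-1); last by apply: inv_le2; exact: ltW.
    by apply: powRN_le_inv; rewrite ?ltW.
  have [ts|ts] := leP (1 - t) s.
    apply: (@le_trans _ _ ((2 / s)%:E * h2 (1 - t)%R)%E); last first.
      by apply: (@le_trans _ _ ((2 / s)%:E * h2 (1 - t)%R + 2%:E * h3 (1 - t)%R)%E); rewrite ?leeDl ?leeDr.
    have -> : h2 (1 - t) = ((1 - t) `^ (- d))%:E.
      by rewrite /h2 patchE ifT// inE/= in_itv/= ts subr_gt0 t1.
    rewrite -EFinM lee_fin.
    rewrite mulrAC; apply: ler_wpM2r => //; apply: ler_pM => //.
    by rewrite lef_pV2 ?posrE// /s; nra.
  apply: (@le_trans _ _ (2%:E * h3 (1 - t)%R)%E); last first.
    by apply: (@le_trans _ _ ((2 / s)%:E * h2 (1 - t)%R + 2%:E * h3 (1 - t)%R)%E); rewrite ?leeDr.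
  have -> : h3 (1 - t) = ((1 - t) `^ (- d - 1))%:E.
    by rewrite /h3 patchE ifT// inE/= in_itv/= (ltW ts) gerBl (ltW t0).
  rewrite -EFinM lee_fin.
  rewrite -mulrA; apply: ler_pM => //; first by rewrite mulr_ge0.
  rewrite powRD; last by apply/implyP => _; rewrite gt_eqF// subr_gt0.
  apply: ler_wpM2l => //; rewrite powR_inv1 ?subr_ge0 ?(ltW t1)//.
  by rewrite lef_pV2 ?posrE ?subr_gt0//; nra.
have i1 : (\int[leb]_t h1 t <= (1 - g)^-1%:E)%E.
  rewrite /h1 -integral_mkcond.
  by have := @integral_powR0_le R g 1 g1 ltr01; rewrite powR1 mul1r.
have aff (h : measurableTypeR R -> \bar R) : measurable_fun setT h -> (forall x, (0 <= h x)%E) ->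
    (\int[leb]_t h (-1 * t + 1)%R = \int[leb]_t h t)%E.
  move=> mh0 h0; rewrite (@lebesgue_affine R (-1) 1 h)//.
  by rewrite normrN1 invr1 mul1e.
have i2 : (\int[leb]_t h2 (-1 * t + 1)%R <= (s `^ (1 - d) / (1 - d))%:E)%E.
  rewrite aff; [|exact: mh|exact: hp].
  by rewrite /h2 -integral_mkcond; exact: integral_powR0_le.
have i3 : (\int[leb]_t h3 (-1 * t + 1)%R <= (s `^ (- d) / d)%:E)%E.
  rewrite aff; [|exact: mh|exact: hp].
  by rewrite /h3 -integral_mkcond; exact: integral_powR1_le.
pose G (t : measurableTypeR R) :=
  (4%:E * h1 t + ((2 / s)%:E * h2 (-1 * t + 1)%R + 2%:E * h3 (-1 * t + 1)%R))%E.
have m1 : measurable_fun setT (fun t => 4%:E * h1 t)%E by apply: measurable_funeM; exact: mh.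
have m2 : measurable_fun setT (fun t : measurableTypeR R => (2 / s)%:E * h2 (-1 * t + 1)%R)%E.
  by apply: measurable_funeM; exact: mh'.
have m3 : measurable_fun setT (fun t : measurableTypeR R => 2%:E * h3 (-1 * t + 1)%R)%E.
  by apply: measurable_funeM; exact: mh'.
have p1 (t : R) : (0 <= 4%:E * h1 t)%E by rewrite mule_ge0 ?hp.
have p2 (t : R) : (0 <= (2 / s)%:E * h2 (-1 * t + 1)%R)%E.
  by rewrite mule_ge0 ?hp// lee_fin divr_ge0// ltW.
have p3 (t : R) : (0 <= 2%:E * h3 (-1 * t + 1)%R)%E by rewrite mule_ge0 ?hp.
have mG : measurable_fun setT G.
  by apply: emeasurable_funD => //; apply: emeasurable_funD.
have pG t : (0 <= G t)%E by rewrite !adde_ge0.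
have mfr : measurable_fun setT (fun t : measurableTypeR R => (radial_weight g d t * `|1 - t * r|^-1)%:E).
  apply/measurable_EFinP; apply: measurable_funM; first exact: measurable_radial_weight.
  apply: measurable_inv_ge0 => //; apply: measurableT_comp => //.
  by apply: measurable_funB => //; exact: measurable_funM.
apply: (@le_trans _ _ (\int[leb]_t G t)%E).
  have Eo : (\int[leb]_(t in `[0%R, +oo[) (radial_weight g d t / (1 - t * r))%:E =
      \int[leb]_(t in `]0%R, +oo[) (radial_weight g d t / (1 - t * r))%:E)%E.
    rewrite integral_itv_obnd_cbnd//.
    apply/measurable_EFinP; apply: measurable_funTS; apply: measurable_funM; first exact: measurable_radial_weight.
    by apply: measurable_inv; apply: measurable_funB => //; exact: measurable_funM.
  apply: (@le_trans _ _ (\int[leb]_(t in `]0%R, +oo[) G t)%E); last first.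
    by apply: ge0_subset_integral => //; exact: measurable_itv.
  rewrite Eo.
  have E (t : R) : t \in `]0%R, +oo[%classic -> (radial_weight g d t / (1 - t * r))%:E =
      (radial_weight g d t * `|1 - t * r|^-1)%:E.
    rewrite inE/= in_itv/= andbT => t0; congr EFin.
    have [t1|t1] := leP 1 t; first by rewrite radial_weight_ge1// !mul0r.
    by rewrite ger0_norm//; nra.
  under eq_integral => t tD do rewrite (E t tD).
  apply: ge0_le_integral => //.
  - by move=> t _; rewrite lee_fin mulr_ge0 ?radial_weight_ge0.
  - exact: measurable_funTS.
  - exact: measurable_funTS.
  - by move=> t tD; rewrite -E ?inE//; apply: key; move: tD; rewrite /= in_itv/= andbT.
rewrite ge0_integralD//; [|by move=> x _; rewrite adde_ge0|exact: emeasurable_funD].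
rewrite ge0_integralD// !ge0_integralZl//; try (by move=> *; exact: hp);
  try exact: mh; try exact: mh'; last by rewrite lee_fin divr_ge0// ltW.
apply: (@le_trans _ _ (4%:E * (1 - g)^-1%:E + ((2 / s)%:E * (s `^ (1 - d) / (1 - d))%:E + 2%:E * (s `^ (- d) / d)%:E))%E).
  by apply: leeD; [|apply: leeD]; rewrite lee_wpmul2l// lee_fin divr_ge0// ltW.
rewrite -!EFinM -!EFinD lee_fin addrA [leRHS]mulrDl [X in _ <= X + _]mulrDl.
have s1' : 1 <= s `^ (- d).
  by rewrite -[leLHS](powRr0 s); apply: ger_powR; rewrite ?s0// oppr_le0 ltW.
apply: lerD; last by rewrite -!mulrA [d^-1 * _]mulrC.
apply: lerD; first by rewrite ler_peMr// divr_ge0// subr_ge0 ltW.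
rewrite powRD; last by apply/implyP => _; rewrite gt_eqF.
rewrite powRr1; last exact: ltW.
rewrite le_eqVlt; apply/orP; left; apply/eqP; field.
by rewrite !gt_eqF// subr_gt0.
Qed.

End forelli_rudin_1d.

(** * Forelli-Rudin estimates on the Hartogs triangle *)

Section hartogs_integrals.
Variable R : realType.
Local Notation leb := (@lebesgue_measure R).
Local Notation mP := (measurableTypeR R * measurableTypeR R)%type.
Implicit Types z w : mC2 R.

Lemma forelli_rudin2 (g d : R) : g < 1 -> 0 < d -> d < 1 ->
  exists2 C, 0 <= C & forall a : R[i], normsq a < 1 ->
  (\int[@area R]_z (radial_weight g d (normsq (toC z)) / normsq (1 - toC z * a))%:E <=
    (C * (1 - normsq a) `^ (- d))%:E)%E.
Proof.
move=> g1 d0 d1; have [C C0 hC] := forelli_rudin1 g1 d0 d1.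
have k0 : 0 <= 4 * disk_area R by rewrite mulr_ge0// ltW// disk_area_gt0.
exists (4 * disk_area R * C); first by rewrite mulr_ge0.
move=> a a1.
apply: (le_trans (radial_kernel_le (measurable_radial_weight g d) (radial_weight_ge0 g d) _ a1)).
  by move=> t; exact: radial_weight_ge1.
rewrite -[X in (_ <= X%:E)%E]mulrA [X in (_ <= X)%E]EFinM; apply: lee_wpmul2l => //; rewrite ?lee_fin//.
by apply: hC => //; exact: normsq_ge0.
Qed.

Lemma dV_tonelli2 (G : mC2 R -> \bar R) : measurable_fun setT G ->
  (forall z, (0 <= G z)%E) ->
  (\int[@dV R]_z G z = \int[@area R]_y \int[@area R]_x G (x, y))%E.
Proof.
move=> mG G0.
transitivity (\int[@area R]_x \int[@area R]_y G (x, y))%E.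
  exact: (@fubini_tonelli1 _ _ _ _ _ (@area R) (@area R)).
exact: (@fubini_tonelli _ _ _ _ _ (@area R) (@area R)).
Qed.

Lemma cmeas_z1 : cmeas (fun z : mC2 R => z1 z).
Proof.
split; [exact: (measurableT_comp measurable_fst measurable_fst)|
  exact: (measurableT_comp measurable_snd measurable_fst)].
Qed.

Lemma cmeas_z2 : cmeas (fun z : mC2 R => z2 z).
Proof.
split; [exact: (measurableT_comp measurable_fst measurable_snd)|
  exact: (measurableT_comp measurable_snd measurable_snd)].
Qed.

Lemma cmeas_comp d d' (T : measurableType d) (T' : measurableType d')
  (f : T' -> R[i]) (g : T -> T') : measurable_fun setT g -> cmeas f -> cmeas (f \o g).
Proof. by move=> mg [f1 f2]; split; [exact: (measurableT_comp f1 mg)|exact: (measurableT_comp f2 mg)]. Qed.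

Lemma measurable_pairC (A : R[i] -> \bar R) : measurable_fun setT (fun z : mP => A (toC z)) ->
  forall d (T : measurableType d) (f : T -> R[i]), cmeas f -> measurable_fun setT (fun t => A (f t)).
Proof.
move=> mA d T f [f1 f2].
rewrite (_ : (fun t => A (f t)) = (fun z : mP => A (toC z)) \o (fun t => (complex.Re (f t), complex.Im (f t)))).
  by apply: measurableT_comp => //; apply: measurable_fun_pair.
by apply/funext => t /=; rewrite /toC/=; case: (f t).
Qed.

(** For fixed z2 the substitution z1 = u z2 contributes the Jacobian |z2|^2. *)
Lemma hartogs_product (A B : R[i] -> \bar R) :
  measurable_fun setT (fun z : mP => A (toC z)) ->
  measurable_fun setT (fun z : mP => B (toC z)) ->
  (forall x, (0 <= A x)%E) -> (forall x, (0 <= B x)%E) -> B 0 = 0%E ->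
  (\int[@dV R]_z (A (z1 z / z2 z)%R * B (z2 z)) =
   \int[@area R]_x A (toC x) * \int[@area R]_y ((normsq (toC y))%:E * B (toC y)))%E.
Proof.
move=> mA mB A0 B0 B00.
have mAB : measurable_fun setT (fun z : mC2 R => A (z1 z / z2 z)%R * B (z2 z))%E.
  apply: emeasurable_funM.
    by apply: (measurable_pairC mA); apply: cmeasM; [exact: cmeas_z1|apply: cmeasV; exact: cmeas_z2].
  by apply: (measurable_pairC mB); exact: cmeas_z2.
rewrite dV_tonelli2//; last by move=> z; rewrite mule_ge0.
rewrite -ge0_integralZl//; first last.
- exact: integral_ge0.
- by move=> y _; rewrite mule_ge0// lee_fin normsq_ge0.
- apply: emeasurable_funM => //; apply/measurable_EFinP.
  by apply: cmeas_normsq; exact: cmeas_toC.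
apply: eq_integral => y _.
rewrite /z1 /z2 /= -[y.1 +i* y.2]/(toC y).
have [y0|y0] := eqVneq (toC y) 0.
  rewrite y0 B00 !mule0; under eq_integral do rewrite mule0.
  exact: integral0.
have mAy : measurable_fun setT (fun x : mP => A ((toC y)^-1 * toC x)).
  by apply: (measurable_pairC mA); apply: cmeasM; [exact: cmeas_cst|exact: cmeas_toC].
under eq_integral => x _.
  rewrite -[x.1 +i* x.2]/(toC x) mulrC.
  over.
rewrite ge0_integralZr//.
rewrite area_mulC ?invr_eq0// normsqV invrK.
by rewrite muleCA muleA.
Qed.

End hartogs_integrals.

Section schur.
Variable R : realType.
Local Notation leb := (@lebesgue_measure R).
Local Notation mP := (measurableTypeR R * measurableTypeR R)%type.
Local Notation H := (@hartogs R).

Lemma hartogsE (z : C2 R) : hartogs z <-> (normsq (z1 z) < normsq (z2 z) /\ normsq (z2 z) < 1).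
Proof.
rewrite -[hartogs z]/(modulus (z1 z) < modulus (z2 z) /\ modulus (z2 z) < 1) !normc_sqrt.
split => -[h1 h2].
  split.
    rewrite ltNge; apply/negP => h; move: h1; rewrite ltNge => /negP; apply.
    exact: ler_wsqrtr.
  rewrite ltNge; apply/negP => h; move: h2; rewrite ltNge => /negP; apply.
  by rewrite -sqrtr1; exact: ler_wsqrtr.
split.
  by rewrite ltr_sqrt// (le_lt_trans (normsq_ge0 (z1 z))).
by rewrite -sqrtr1 ltr_sqrt.
Qed.

Lemma hartogs_u (z : C2 R) : hartogs z ->
  [/\ z2 z != 0, normsq (z1 z / z2 z) < 1, 0 < normsq (z2 z) & normsq (z2 z) < 1].
Proof.
move=> /hartogsE[h1 h2].
have p : 0 < normsq (z2 z) by rewrite (le_lt_trans (normsq_ge0 (z1 z))).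
split => //; first by rewrite -normsq_gt0.
by rewrite normsqM normsqV ltr_pdivrMr// mul1r.
Qed.

Lemma hartogs_of_u (z : C2 R) :
  z2 z != 0 -> normsq (z1 z / z2 z) < 1 -> normsq (z2 z) < 1 -> hartogs z.
Proof.
move=> p h1 h2; apply/hartogsE; split => //.
by move: h1; rewrite normsqM normsqV ltr_pdivrMr ?normsq_gt0// mul1r.
Qed.

Lemma measurable_gt0 d (T : measurableType d) (f : T -> R) :
  measurable_fun setT f -> measurable [set t | 0 < f t].
Proof.
move=> mf; rewrite (_ : [set t | _] = setT `&` f @^-1` `]0, +oo[%classic).
  by apply: mf => //; exact: measurable_itv.
by rewrite setTI; apply/seteqP; split => t /=; rewrite in_itv/= andbT.
Qed.

Lemma measurable_hartogs : measurable (hartogs : set (mC2 R)).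
Proof.
rewrite (_ : hartogs = [set z : mC2 R | 0 < normsq (z2 z) - normsq (z1 z)] `&`
    [set z : mC2 R | 0 < 1 - normsq (z2 z)]).
  apply: measurableI; apply: measurable_gt0; apply: measurable_funB => //;
    apply: cmeas_normsq; [exact: cmeas_z2|exact: cmeas_z1|exact: cmeas_z2].
by apply/seteqP; split => z; rewrite hartogsE/= !subr_gt0.
Qed.

Definition fibre (z : C2 R) := z1 z / z2 z.
Definition sarg (z w : C2 R) : R[i] := fibre z * (fibre w)^*.
Definition targ (z w : C2 R) : R[i] := z2 z * (z2 w)^*.
(** The two arguments u(z) conj u(w) and z2 conj w2 are the variables of the
    Bergman kernels of the factors; this is the product of the moduli of these
    kernels. *)
Definition abs_kernel (z w : C2 R) : R := (normsq (1 - sarg z w))^-1 * (normsq (1 - targ z w))^-1.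
(** The weight of the Schur test, a power of the product of the defining
    functions of the two discs. *)
Definition schur_weight (d : R) (z : C2 R) : R := (1 - normsq (fibre z)) `^ (- d) * (1 - normsq (z2 z)) `^ (- d).

Lemma abs_kernelC z w : abs_kernel z w = abs_kernel w z.
Proof.
have E (x y : R[i]) : normsq (1 - x * y^*) = normsq (1 - y * x^*).
  rewrite -[LHS]normsqJ; congr normsq; rewrite rmorphB rmorph1 rmorphM /= conjcK.
  by rewrite mulrC.
by rewrite /abs_kernel /sarg /targ (E (fibre z) (fibre w)) (E (z2 z) (z2 w)).
Qed.

Lemma abs_kernel_ge0 z w : 0 <= abs_kernel z w.
Proof. by rewrite mulr_ge0 ?invr_ge0 ?normsq_ge0. Qed.

Lemma schur_weight_ge0 d z : 0 <= schur_weight d z.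
Proof. by rewrite mulr_ge0 ?powR_ge0. Qed.

Lemma schur_weight_gt0 d z : hartogs z -> 0 < schur_weight d z.
Proof.
by move=> /hartogs_u[_ h _ h']; rewrite mulr_gt0 ?powR_gt0 ?subr_gt0.
Qed.

(** The integral is a product of two planar ones; |z2|^(2(-g-1)) times the
    Jacobian |z2|^2 leaves the integrable power |z2|^(-2g). *)
Lemma forelli_rudin_hartogs (g d : R) : g < 1 -> 0 < d -> d < 1 ->
  exists2 C, 0 <= C & forall w, hartogs w ->
  (\int[@dV R]_(z in H) (normsq (z2 z) `^ (- g - 1) * schur_weight d z * abs_kernel z w)%:E <=
    (C * schur_weight d w)%:E)%E.
Proof.
move=> g1 d0 d1.
have [C1 C10 h1] := forelli_rudin2 ltr01 d0 d1.
have [C2 C20 h2] := forelli_rudin2 g1 d0 d1.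
exists (C1 * C2); first exact: mulr_ge0.
move=> w /hartogs_u[w20 wu _ wv].
pose a := (fibre w)^*; pose b := (z2 w)^*.
pose A (x : R[i]) := (radial_weight 0 d (normsq x) / normsq (1 - x * a))%:E.
pose B (y : R[i]) := (if y == 0 then 0%:E else ((normsq y)^-1 * radial_weight g d (normsq y) / normsq (1 - y * b))%:E).
have mf (e : R[i]) g' : measurable_fun setT (fun z : mP => radial_weight g' d (normsq (toC z)) / normsq (1 - toC z * e)).
  apply: measurable_funM.
    by apply: (measurableT_comp (measurable_radial_weight g' d)); exact: measurable_nsq.
  apply: measurable_inv; apply: cmeas_normsq; apply: cmeasB; first exact: cmeas_cst.
  by apply: cmeasM; [exact: cmeas_toC|exact: cmeas_cst].
have fp g' (e x : R[i]) : 0 <= radial_weight g' d (normsq x) / normsq (1 - x * e).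
  by rewrite divr_ge0 ?radial_weight_ge0 ?normsq_ge0.
have BE y : B y = (\1_[set x : R[i] | x != 0] y * ((normsq y)^-1 * radial_weight g d (normsq y) / normsq (1 - y * b)))%:E.
  rewrite /B indicE; case: eqVneq => [->|y0]; first by rewrite memNset ?mul0r//= eqxx.
  by rewrite mem_set// mul1r.
have mB : measurable_fun setT (fun z : mP => B (toC z)).
  under eq_fun do rewrite BE -mulrA.
  apply/measurable_EFinP; apply: measurable_funM.
    rewrite (_ : (fun z : mP => _) = \1_[set z : mP | 0 < normsq (toC z)]).
      apply: measurable_indic; apply: measurable_gt0; exact: measurable_nsq.
    apply/funext => z; rewrite !indicE; congr (_%:R); congr nat_of_bool.
    by apply/idP/idP; rewrite !inE/= normsq_gt0.
  apply: measurable_funM; last exact: mf.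
  by apply: measurable_inv; exact: measurable_nsq.
have B0 y : (0 <= B y)%E.
  rewrite /B; case: ifP => // _; rewrite lee_fin -mulrA mulr_ge0// invr_ge0.
  exact: normsq_ge0.
have A0 x : (0 <= A x)%E by rewrite lee_fin fp.
have mA : measurable_fun setT (fun z : mP => A (toC z)).
  by apply/measurable_EFinP; exact: mf.
have B00 : B 0 = 0%E by rewrite /B eqxx.
have mAB : measurable_fun setT (fun z : mC2 R => A (z1 z / z2 z)%R * B (z2 z))%E.
  apply: emeasurable_funM.
    by apply: (measurable_pairC mA); apply: cmeasM; [exact: cmeas_z1|apply: cmeasV; exact: cmeas_z2].
  by apply: (measurable_pairC mB); exact: cmeas_z2.
apply: (@le_trans _ _ (\int[@dV R]_z (A (z1 z / z2 z)%R * B (z2 z)))%E).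
  rewrite [leLHS](_ : _ = (\int[@dV R]_(z in H) (A (z1 z / z2 z)%R * B (z2 z)))%E).
    apply: ge0_subset_integral => //; first exact: measurable_hartogs.
    by move=> z _; rewrite mule_ge0.
  apply: eq_integral => z; rewrite inE => /hartogs_u[z0 zu zp zv].
  rewrite /B (negbTE z0) -EFinM; congr EFin.
  rewrite /radial_weight !indicE !mem_set/= ?in_itv/= ?normsq_ge0 ?zu ?zv// !mulr1.
  rewrite oppr0 powRr0 mul1r powRD; last by apply/implyP => _; rewrite gt_eqF.
  rewrite powR_inv1 ?normsq_ge0// /schur_weight /abs_kernel /sarg /targ -/a -/b -/(fibre z).
  ring.
rewrite hartogs_product// [leRHS](_ : _ = ((C1 * (1 - normsq a) `^ (- d))%:E * (C2 * (1 - normsq b) `^ (- d))%:E)%E); last first.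
  by rewrite -EFinM /schur_weight !normsqJ; congr EFin; ring.
apply: lee_pmul.
- exact: integral_ge0.
- by apply: integral_ge0 => y _; rewrite mule_ge0// lee_fin normsq_ge0.
- by apply: h1; rewrite /a normsqJ.
apply: le_trans (h2 b _); last by rewrite /b normsqJ.
apply: ge0_le_integral => //.
- by move=> y _; rewrite mule_ge0// lee_fin normsq_ge0.
- by apply: emeasurable_funM => //; apply/measurable_EFinP; exact: measurable_nsq.
- by apply/measurable_EFinP; exact: mf.
move=> y _; rewrite /B; case: eqVneq => [y0|y0]; first by rewrite mule0 lee_fin fp.
rewrite -EFinM lee_fin mulrA mulrA divff ?mul1r// gt_eqF// normsq_gt0//.
Qed.

End schur.

(** * Schur test *)

Lemma lee_poweR (R : realType) (r : R) (x y : \bar R) : 0 <= r ->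
  (0 <= x)%E -> (x <= y)%E -> (x `^ r <= y `^ r)%E.
Proof.
move=> r0 x0 xy; apply: gt0_ler_poweR => //; rewrite in_itv/= ?leey ?andbT//.
exact: le_trans xy.
Qed.

Section schur_test.
Context d (T : measurableType d) (R : realType) (mu : {sigma_finite_measure set T -> \bar R}).
Variables (p q : R) (K : T * T -> R) (h m : T -> R) (C1 C2 : R).
Hypotheses (p0 : 0 < p) (q0 : 0 < q) (pq : p^-1 + q^-1 = 1).
Hypotheses (mK : measurable_fun setT K) (K0 : forall x, 0 <= K x).
Hypotheses (mh : measurable_fun setT h) (h0 : forall x, 0 <= h x).
Hypotheses (mm : measurable_fun setT m) (m0 : forall x, 0 <= m x).
Hypothesis Kh : forall z w, K (z, w) != 0 -> 0 < h w.
Hypotheses (C10 : 0 <= C1) (C20 : 0 <= C2).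
Hypothesis S1 : forall z, (\int[mu]_w (K (z, w) * h w `^ q)%:E <= (C1 * h z `^ q)%:E)%E.
Hypothesis S2 : forall w, (\int[mu]_z (m z * K (z, w) * h z `^ p)%:E <= (C2 * h w `^ p)%:E)%E.

Let mpow (f : T -> R) c : measurable_fun setT f -> measurable_fun setT (fun t => f t `^ c).
Proof. by move=> mf; exact: (measurableT_comp (@measurable_powR R c) mf). Qed.

Let mK1 z : measurable_fun setT (fun w => K (z, w)).
Proof. exact: measurable_fun_pair2. Qed.
Let mK2 w : measurable_fun setT (fun z => K (z, w)).
Proof. exact: measurable_fun_pair1. Qed.

(** Hoelder, after writing K g = (K^(1/q) h) (K^(1/p) g / h). Where the weight
    may vanish, so does the kernel. *)
Lemma schur_pointwise (g : T -> R) z : measurable_fun setT g -> (forall x, 0 <= g x) ->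
  ((\int[mu]_w (K (z, w) * g w)%:E) `^ p <=
   (C1 `^ (p / q) * h z `^ p)%:E *
     \int[mu]_w (K (z, w) * (h w)^-1 `^ p * g w `^ p)%:E)%E.
Proof.
move=> mg g0.
pose F1 w := K (z, w) `^ q^-1 * h w.
pose F2 w := K (z, w) `^ p^-1 * ((h w)^-1 * g w).
have mF1 : measurable_fun setT F1 by apply: measurable_funM => //; exact: mpow.
have mF2 : measurable_fun setT F2.
  apply: measurable_funM; first exact: mpow.
  by apply: measurable_funM => //; exact: measurable_inv.
have F12 w : F1 w * F2 w = K (z, w) * g w.
  rewrite /F1 /F2; have [Kw|Kw] := eqVneq (K (z, w)) 0.
    by rewrite Kw !powR0 ?invr_eq0 ?gt_eqF// !mul0r.
  have hw := Kh Kw.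
  rewrite [LHS](_ : _ = (K (z, w) `^ q^-1 * K (z, w) `^ p^-1) * g w); last first.
    by field; rewrite gt_eqF.
  rewrite -powRD; last by rewrite addrC pq; apply/implyP => /eqP; move/eqP; rewrite oner_eq0.
  by rewrite addrC pq powRr1.
have HO := hoelder mu mF1 mF2 q0 p0.
rewrite addrC in HO; have {}HO := HO pq.
move: HO; rewrite Lnorm1 => HO.
have J1 : (\int[mu]_w (K (z, w) * g w)%:E = \int[mu]_x `|(EFin \o (F1 \* F2)%R) x|)%E.
  apply: eq_integral => w _ /=; rewrite F12 ger0_norm//.
  by rewrite mulr_ge0.
rewrite J1.
have i0 : (0 <= \int[mu]_x `|(EFin \o (F1 \* F2)%R) x|)%E by exact: integral_ge0.
apply: le_trans.
  by apply: (lee_poweR _ _ HO) => //; exact: ltW.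
rewrite poweRM ?Lnorm_ge0// poweR_Lnorm ?gt_eqF//.
have F10 w : 0 <= F1 w by rewrite mulr_ge0 ?powR_ge0.
have F20 w : 0 <= F2 w by rewrite !mulr_ge0 ?powR_ge0// invr_ge0.
have -> : (\int[mu]_x `|(EFin \o F2) x| `^ p =
    \int[mu]_w (K (z, w) * (h w)^-1 `^ p * g w `^ p)%:E)%E.
  apply: eq_integral => w _ /=; rewrite ger0_norm//; congr EFin.
  rewrite /F2 powRM ?powR_ge0// ?mulr_ge0 ?invr_ge0// powRM ?invr_ge0//.
  by rewrite -powRrM mulVf ?gt_eqF// powRr1// mulrA.
apply: lee_wpmul2r.
  by apply: integral_ge0 => w _; rewrite lee_fin !mulr_ge0 ?powR_ge0.
have F1E : (\int[mu]_x `|(EFin \o F1) x| `^ q = \int[mu]_w (K (z, w) * h w `^ q)%:E)%E.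
  apply: eq_integral => w _ /=; rewrite ger0_norm//; congr EFin.
  by rewrite /F1 powRM ?powR_ge0// -powRrM mulVf ?gt_eqF// powRr1.
have -> : ('N[mu]_q%:E[EFin \o F1] `^ p = (\int[mu]_w (K (z, w) * h w `^ q)%:E) `^ (p / q))%E.
  rewrite -F1E -poweR_Lnorm ?gt_eqF// -poweRrM; congr poweR.
  by rewrite mulrC divfK ?gt_eqF.
apply: (@le_trans _ _ ((C1 * h z `^ q)%:E `^ (p / q))%E).
  apply: lee_poweR (S1 z); first by rewrite divr_ge0// ltW.
  by apply: integral_ge0 => w _; rewrite lee_fin mulr_ge0 ?powR_ge0.
rewrite poweR_EFin powRM ?powR_ge0// -powRrM.
by rewrite [q * _]mulrC divfK ?gt_eqF.
Qed.

(** Integrate the pointwise bound against m and exchange the integrals. *)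
Lemma schur_test (g : T -> R) : measurable_fun setT g -> (forall x, 0 <= g x) ->
  (\int[mu]_z ((m z)%:E * (\int[mu]_w (K (z, w) * g w)%:E) `^ p) <=
   (C1 `^ (p / q) * C2)%:E * \int[mu]_w (g w `^ p)%:E)%E.
Proof.
move=> mg g0.
pose G (x : T * T) := (m x.1 * h x.1 `^ p * (K x * (h x.2)^-1 `^ p * g x.2 `^ p))%:E.
have mG : measurable_fun setT G.
  apply/measurable_EFinP; apply: measurable_funM.
    by apply: measurable_funM; [exact: (measurableT_comp mm measurable_fst)|
      exact: (measurableT_comp (mpow p mh) measurable_fst)].
  apply: measurable_funM.
    apply: measurable_funM => //.
    exact: (measurableT_comp (mpow p (measurable_inv mh)) measurable_snd).
  exact: (measurableT_comp (mpow p mg) measurable_snd).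
have G0 x : (0 <= G x)%E by rewrite lee_fin !mulr_ge0 ?powR_ge0.
have mL z : measurable_fun setT (fun w => (K (z, w) * (h w)^-1 `^ p * g w `^ p)%:E).
  apply/measurable_EFinP; apply: measurable_funM; last exact: mpow.
  by apply: measurable_funM => //; apply: mpow; exact: measurable_inv.
have mJ : measurable_fun setT (fun z => \int[mu]_w (K (z, w) * g w)%:E)%E.
  apply: (@measurable_fun_fubini_tonelli_F _ _ _ _ _ mu (fun x => (K x * g x.2)%:E)).
    apply/measurable_EFinP; apply: measurable_funM => //.
    exact: (measurableT_comp mg measurable_snd).
  by move=> x; rewrite lee_fin mulr_ge0.
apply: (@le_trans _ _ ((C1 `^ (p / q))%:E * \int[mu]_z \int[mu]_w G (z, w))%E).
  rewrite -ge0_integralZl//; first last.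
  - by rewrite lee_fin powR_ge0.
  - by move=> z _; exact: integral_ge0.
  - exact: (@measurable_fun_fubini_tonelli_F _ _ _ _ _ mu G).
  apply: ge0_le_integral => //.
  - by move=> z _; rewrite mule_ge0 ?lee_fin// poweR_ge0.
  - apply: emeasurable_funM; first exact/measurable_EFinP.
    exact: (measurableT_comp (measurable_poweR p) mJ).
  - apply: measurable_funeM.
    exact: (@measurable_fun_fubini_tonelli_F _ _ _ _ _ mu G).
  move=> z _.
  apply: (@le_trans _ _ ((m z)%:E * ((C1 `^ (p / q) * h z `^ p)%:E *
     \int[mu]_w (K (z, w) * (h w)^-1 `^ p * g w `^ p)%:E))%E).
    by apply: lee_wpmul2l; rewrite ?lee_fin//; exact: schur_pointwise.
  rewrite /G/=; under [in leRHS]eq_integral do rewrite EFinM.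
  rewrite ge0_integralZl//=; first last.
  - by rewrite lee_fin mulr_ge0 ?powR_ge0.
  - by move=> w _; rewrite lee_fin !mulr_ge0 ?powR_ge0 ?invr_ge0.
  rewrite !muleA -!EFinM le_eqVlt; apply/orP; left; apply/eqP; congr (_%:E * _)%E.
  by rewrite mulrA mulrAC mulrC mulrA; ring.
rewrite EFinM -muleA; apply: lee_wpmul2l; first by rewrite lee_fin powR_ge0.
rewrite (@fubini_tonelli _ _ _ _ _ mu mu G)//.
rewrite -ge0_integralZl//; first last.
- by move=> w _; rewrite lee_fin powR_ge0.
- by apply/measurable_EFinP; exact: mpow.
apply: ge0_le_integral => //.
- by move=> w _; exact: integral_ge0.
- exact: (@measurable_fun_fubini_tonelli_G _ _ _ _ _ mu G).
- by apply: measurable_funeM; apply/measurable_EFinP; exact: mpow.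
move=> w _; rewrite /G/=.
have E z : m z * h z `^ p * (K (z, w) * (h w)^-1 `^ p * g w `^ p) =
    ((h w)^-1 `^ p * g w `^ p) * (m z * K (z, w) * h z `^ p) by ring.
under eq_integral do rewrite E EFinM.
rewrite ge0_integralZl//; first last.
- by rewrite lee_fin mulr_ge0 ?powR_ge0.
- by move=> z _; rewrite lee_fin !mulr_ge0 ?powR_ge0.
- by apply/measurable_EFinP; apply: measurable_funM; [exact: measurable_funM|exact: mpow].
apply: (@le_trans _ _ (((h w)^-1 `^ p * g w `^ p)%:E * (C2 * h w `^ p)%:E)%E).
  by apply: lee_wpmul2l (S2 w); rewrite lee_fin mulr_ge0 ?powR_ge0.
rewrite -!EFinM lee_fin.
rewrite [leLHS](_ : _ = C2 * g w `^ p * ((h w)^-1 `^ p * h w `^ p)); last by ring.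
rewrite ler_piMr ?mulr_ge0 ?powR_ge0//.
rewrite -powRM ?invr_ge0//; have [->|hw] := eqVneq (h w) 0.
  by rewrite mulr0 powR0 ?gt_eqF.
by rewrite mulVf// powR1.
Qed.

End schur_test.

Section volume.
Variable R : realType.

(** The same measure as the Lebesgue measure of C^2, declared sigma-finite so
    that Fubini applies to products of two copies of it. *)
Definition vol : set (mC2 R) -> \bar R := (@area R \x @area R)%E.

HB.instance Definition _ := Measure.on vol.

Lemma vol_sigma_finite : sigma_finite setT vol.
Proof.
have /sigma_finiteP[F [FT ndF mF]] := @area_sigma_finite R.
exists (fun n => F n `*` F n).
  apply/seteqP; split => // -[x y] _ /=.
  have [i _ Fx] : (\bigcup_i F i) x by rewrite -FT.
  have [j _ Fy] : (\bigcup_i F i) y by rewrite -FT.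
  exists (maxn i j) => //; split => /=.
    by move/subsetPset : (ndF i (maxn i j) (leq_maxl i j)); apply.
  by move/subsetPset : (ndF j (maxn i j) (leq_maxr i j)); apply.
move=> i; have [mFi Fi] := mF i; split; first exact: measurableX.
rewrite /vol product_measure1E//.
by rewrite lte_mul_pinfty// ge0_fin_numE.
Qed.

HB.instance Definition _ :=
  Measure_isSigmaFinite.Build _ _ _ vol vol_sigma_finite.

Lemma volE (D : set (mC2 R)) (f : mC2 R -> \bar R) :
  (\int[vol]_(x in D) f x = \int[@dV R]_(x in D) f x)%E.
Proof. by []. Qed.

End volume.

Section hartogs_schur.
Variable R : realType.
Local Notation H := (@hartogs R).

Lemma integral_indicM d (T : measurableType d) (mu : {measure set T -> \bar R})
    (D : set T) (f : T -> R) :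
  (\int[mu]_(x in D) (f x)%:E = \int[mu]_x (\1_D x * f x)%:E)%E.
Proof.
rewrite integral_mkcond; apply: eq_integral => x _.
by rewrite epatch_indic /= -EFinM mulrC.
Qed.

Lemma cmeas_fibre : cmeas (fun z : mC2 R => fibre z).
Proof. by apply: cmeasM; [exact: cmeas_z1|apply: cmeasV; exact: cmeas_z2]. Qed.

Lemma measurable_schur_weight e : measurable_fun setT (fun z : mC2 R => schur_weight e z).
Proof.
apply: measurable_funM; apply: (measurableT_comp (@measurable_powR R (- e)));
  apply: measurable_funB => //; apply: cmeas_normsq; [exact: cmeas_fibre|exact: cmeas_z2].
Qed.

Lemma measurable_abs_kernel : measurable_fun setT (fun x : mC2 R * mC2 R => abs_kernel x.1 x.2).
Proof.
apply: measurable_funM; apply: measurable_inv; apply: cmeas_normsq; apply: cmeasB;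
  try exact: cmeas_cst; apply: cmeasM.
- exact: (cmeas_comp measurable_fst cmeas_fibre).
- by apply: cmeasJ; exact: (cmeas_comp measurable_snd cmeas_fibre).
- exact: (cmeas_comp measurable_fst (@cmeas_z2 R)).
- by apply: cmeasJ; exact: (cmeas_comp measurable_snd (@cmeas_z2 R)).
Qed.

Lemma powR_schur_weight e c (z : C2 R) : hartogs z -> schur_weight e z `^ c = schur_weight (e * c) z.
Proof.
move=> /hartogs_u[_ h1 _ h2].
by rewrite /schur_weight powRM ?powR_ge0// -!powRrM !mulNr.
Qed.

(** With the weight to the power 1/(pq), the Schur integrals are Forelli-Rudin
    integrals with parameters g = -1 and g = p/2 - 1; the second one is below
    1 because p < 4. *)
Lemma hartogs_schur (p : R) : 1 < p -> p < 4 ->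
  exists2 C, 0 <= C & forall g : mC2 R -> R,
    measurable_fun setT g -> (forall w, 0 <= g w) ->
    (\int[@dV R]_(z in H) ((normsq (z2 z) `^ (- 2^-1))%:E *
        \int[@dV R]_(w in H) (abs_kernel z w * g w)%:E) `^ p
      <= C%:E * \int[@dV R]_(w in H) (g w `^ p)%:E)%E.
Proof.
move=> p1 p4.
have p0 : 0 < p by lra.
pose q := p / (p - 1).
have p10 : 0 < p - 1 by lra.
have q0 : 0 < q by rewrite divr_gt0.
have q1 : 1 < q by rewrite ltr_pdivlMr//; lra.
have pq : p^-1 + q^-1 = 1 by rewrite /q; field; rewrite !gt_eqF.
have ip0 : 0 < p^-1 by rewrite invr_gt0.
have ip1 : p^-1 < 1 by rewrite invf_lt1.
have iq0 : 0 < q^-1 by rewrite invr_gt0.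
have iq1 : q^-1 < 1 by rewrite invf_lt1.
have [C1 C10 h1] := @forelli_rudin_hartogs R (-1) p^-1 ltac:(lra) ip0 ip1.
have [C2 C20 h2] := @forelli_rudin_hartogs R (p / 2 - 1) q^-1 ltac:(lra) iq0 iq1.
exists (C1 `^ (p / q) * C2); first by rewrite mulr_ge0 ?powR_ge0.
move=> g mg g0.
pose mu : {sigma_finite_measure set (mC2 R) -> \bar R} := @vol R.
(* The exponent that makes the two Schur integrals have the weights 1/p and 1/q. *)
pose e := (p * q)^-1.
have eq : e * q = p^-1 by rewrite /e; field; rewrite !gt_eqF.
have ep : e * p = q^-1 by rewrite /e; field; rewrite !gt_eqF.
pose K (x : mC2 R * mC2 R) : R := \1_H x.1 * (\1_H x.2 * abs_kernel x.1 x.2).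
pose h (z : mC2 R) : R := schur_weight e z.
pose m (z : mC2 R) : R := normsq (z2 z) `^ (- 2^-1) `^ p.
have mH : measurable (H : set (mC2 R)) by exact: measurable_hartogs.
have m1H : measurable_fun setT (\1_H : mC2 R -> R) by exact: measurable_indic.
have mK : measurable_fun setT K.
  apply: measurable_funM; first exact: (measurableT_comp m1H measurable_fst).
  apply: measurable_funM; first exact: (measurableT_comp m1H measurable_snd).
  exact: measurable_abs_kernel.
have K0 x : 0 <= K x by rewrite /K mulr_ge0// mulr_ge0// abs_kernel_ge0.
have mm : measurable_fun setT m.
  apply: (measurableT_comp (@measurable_powR R p)).
  apply: (measurableT_comp (@measurable_powR R (- 2^-1))).
  by apply: cmeas_normsq; exact: cmeas_z2.
have m0 x : 0 <= m x by exact: powR_ge0.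
have Kh z w : K (z, w) != 0 -> 0 < h w.
  rewrite /K/= !indicE; have [wH _|wH] := boolP (w \in H); last by rewrite mul0r mulr0 eqxx.
  by apply: schur_weight_gt0; move: wH; rewrite inE.
have S1 z : (\int[mu]_w (K (z, w) * h w `^ q)%:E <= (C1 * h z `^ q)%:E)%E.
  have [zH|zH] := boolP (z \in H); last first.
    rewrite integral0_eq; first by rewrite lee_fin mulr_ge0 ?powR_ge0.
    by move=> w _; rewrite /K/= indicE (negbTE zH) !mul0r.
  have zH' : H z by move: zH; rewrite inE.
  rewrite powR_schur_weight// eq; apply: le_trans (h1 z zH').
  rewrite (integral_indicM (@dV R) H) le_eqVlt; apply/orP; left; apply/eqP.
  apply: eq_integral => w _; congr EFin.
  rewrite /K/= indicE zH mul1r indicE; have [wH|wH] := boolP (w \in H); last by rewrite !mul0r.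
  have wH' : H w by move: wH; rewrite inE.
  rewrite !mul1r powR_schur_weight// eq abs_kernelC opprK subrr powRr0 mul1r; exact: mulrC.
have S2 w : (\int[mu]_z (m z * K (z, w) * h z `^ p)%:E <= (C2 * h w `^ p)%:E)%E.
  have [wH|wH] := boolP (w \in H); last first.
    rewrite integral0_eq; first by rewrite lee_fin mulr_ge0 ?powR_ge0.
    by move=> z _; rewrite /K/= (@indicE _ R H w) (negbTE wH) mul0r !mulr0 mul0r.
  have wH' : H w by move: wH; rewrite inE.
  rewrite powR_schur_weight// ep; apply: le_trans (h2 w wH').
  rewrite (integral_indicM (@dV R) H) le_eqVlt; apply/orP; left; apply/eqP.
  apply: eq_integral => z _; congr EFin.
  rewrite /K/= (@indicE _ R H w) wH mul1r indicE; have [zH|zH] := boolP (z \in H); last by rewrite !mul0r mulr0 mul0r.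
  have zH' : H z by move: zH; rewrite inE.
  rewrite !mul1r powR_schur_weight// ep /m -powRrM.
  have -> : - 2^-1 * p = - (p / 2 - 1) - 1 by ring.
  ring.
have := @schur_test _ _ _ mu p q K h m C1 C2 p0 q0 pq mK K0
   (measurable_schur_weight e) (schur_weight_ge0 e) mm m0 Kh C10 C20 S1 S2 (fun w => \1_H w * g w).
have idem (w : mC2 R) : \1_H w * \1_H w = \1_H w :> R.
  by rewrite indicE; case: (w \in H); rewrite /= ?mulr1 ?mulr0.
have mg' : measurable_fun setT (fun w : mC2 R => \1_H w * g w).
  exact: measurable_funM.
have g'0 w : 0 <= \1_H w * g w by rewrite mulr_ge0.
move=> /(_ mg' g'0) S.
rewrite [X in (_ <= _ * X)%E](_ : _ = \int[mu]_w ((\1_H w * g w) `^ p)%:E)%E; last first.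
  rewrite (integral_indicM (@dV R) H); apply: eq_integral => w _; congr EFin.
  rewrite powRM// indicE; case: (w \in H); rewrite /= ?powR1//.
  by rewrite powR0 ?gt_eqF.
apply: le_trans S; rewrite integral_mkcond le_eqVlt; apply/orP; left; apply/eqP.
apply: eq_integral => z _; rewrite patchE.
have [zH|zH] := boolP (z \in H); last first.
  rewrite (_ : (\int[mu]_w _)%E = 0%E) ?poweR0r ?gt_eqF ?mule0//.
  by apply: integral0_eq => w _; rewrite /K/= indicE (negbTE zH) !mul0r.
rewrite poweRM ?lee_fin ?powR_ge0//; last first.
  by apply: integral_ge0 => w _; rewrite lee_fin mulr_ge0// abs_kernel_ge0.
rewrite poweR_EFin; congr (_ * _ `^ p)%E.
rewrite (integral_indicM (@dV R) H); apply: eq_integral => w _; congr EFin.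
by rewrite /K/= (@indicE _ R H z) zH mul1r -{1}(idem w); ring.
Qed.

End hartogs_schur.

(** * Smooth functions built from expressions *)

Section flat_function.
Variable R : realType.

(** The functions x^-k exp(-1/x), extended by 0: the smallest family
    containing the classical flat function and closed under differentiation up
    to linear combinations. *)
Definition flat (k : nat) (x : R) : R :=
  if 0 < x then (x^-1) ^+ k * expR (- x^-1) else 0.

Lemma flat_ge0 k x : 0 <= flat k x.
Proof.
rewrite /flat; case: ifPn => // x0; rewrite mulr_ge0 ?expR_ge0// exprn_ge0//.
by rewrite invr_ge0 ltW.
Qed.

Lemma flat_le0 k x : x <= 0 -> flat k x = 0.
Proof. by rewrite /flat ltNge => ->. Qed.

Lemma flat_gt0E k x : 0 < x -> flat k x = (x^-1) ^+ k * expR (- x^-1).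
Proof. by rewrite /flat => ->. Qed.

Lemma flat0_le1 x : flat 0 x <= 1.
Proof.
rewrite /flat; case: ifPn => // x0; rewrite expr0 mul1r expR_le1 oppr_le0.
by rewrite invr_ge0 ltW.
Qed.

(** Comparison of exp(1/x) with one term of its series; this gives the
    derivative 0 at the origin. *)
Lemma flat_le k x : 0 <= x -> flat k x <= k.+1`!%:R * x.
Proof.
rewrite le_eqVlt => /orP[/eqP <-|x0]; first by rewrite flat_le0// mulr0.
rewrite flat_gt0E// expRN ler_pdivrMr ?expR_gt0//.
have := @expR_ge1Dxn R x^-1 k; rewrite invr_ge0 (ltW x0) => /(_ isT) h.
have h' : (x^-1) ^+ k.+1 / k.+1`!%:R <= expR x^-1 by apply: le_trans h; rewrite lerDr.
apply: (@le_trans _ _ (k.+1`!%:R * x * ((x^-1) ^+ k.+1 / k.+1`!%:R))); last first.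
  by apply: ler_wpM2l => //; rewrite mulr_ge0// ltW.
rewrite le_eqVlt; apply/orP; left; apply/eqP; rewrite exprS; field.
by rewrite (gt_eqF x0) andbT pnatr_eq0 -lt0n fact_gt0.
Qed.

Lemma is_derive_flat k (x : R) :
  is_derive x 1 (flat k) (- k%:R * flat k.+1 x + flat k.+2 x).
Proof.
have [x0|x0|->] := ltgtP x 0.
- rewrite !flat_le0 ?ltW// mulr0 addr0.
  have H : is_derive x 1 (cst 0 : R -> R) (0 : R) by exact: is_derive_cst.
  apply: near_eq_is_derive H.
  near=> y; rewrite flat_le0//; apply: ltW; near: y; exact: lt_nbhsl.
- rewrite !flat_gt0E//.
  have xn0 : x != 0 by rewrite gt_eqF.
  have dV : is_derive x 1 (fun y : R => y^-1) (- (x ^- 2)).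
    have := @is_deriveV R id x 1 1 xn0 (is_derive_id _ _).
    by rewrite /GRing.scale/= mulr1.
  have dX := @is_deriveX _ _ (fun y : R => y^-1) k x 1 _ dV.
  have dN := @is_deriveN _ _ _ (fun y : R => y^-1) x 1 _ dV.
  have dE := @is_derive1_comp R expR _ x _ _ (is_derive_expR _) dN.
  have dM := is_deriveM dX dE.
  apply: (@is_derive_eq _ _ _ (flat k) x 1 _ _ (near_eq_is_derive _ dM)).
    near=> y; have y0 : 0 < y by near: y; exact: lt_nbhsr.
    by rewrite flat_gt0E// !fctE.
  rewrite /GRing.scale/= !fctE/=.
  case: k {dX dM} => [|k]; first by rewrite !expr0; field.
  by rewrite !exprS/=; field.
- rewrite !flat_le0// mulr0 addr0.
  have H : (fun h : R => h^-1 *: ((flat k \o shift 0) (h *: 1) - flat k 0)) @ 0^' --> (0 : R).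
    apply/cvgrPdist_le => e e0; near=> h.
    rewrite sub0r normrN /= addr0 (flat_le0 _ (lexx 0)) subr0 /GRing.scale/= mulr1.
    have [h0|h0] := leP h 0; first by rewrite flat_le0// mulr0 normr0 ltW.
    have E : h^-1 * flat k h = flat k.+1 h by rewrite !flat_gt0E// exprS mulrA.
    rewrite E ger0_norm ?flat_ge0//.
    apply: (le_trans (flat_le _ (ltW h0))).
    rewrite -ler_pdivlMl ?ltr0n ?fact_gt0//; apply/ltW/(le_lt_trans (ler_norm h)).
    near: h; apply: dnbhs0_lt; rewrite mulr_gt0// invr_gt0 ltr0n fact_gt0//.
  split; first by apply/cvg_ex; exists 0.
  exact/cvg_lim.
Unshelve. all: by end_near.
Qed.

Lemma continuous_flat k : continuous (flat k).
Proof.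
move=> x; apply: differentiable_continuous; apply/derivable1_diffP.
exact: (@ex_derive _ _ _ _ _ _ _ (is_derive_flat k x)).
Qed.

End flat_function.

Section smooth_class.
Variable R : realType.
Implicit Types (U : set (C2 R)) (f g : C2 R -> R) (z v : C2 R).

(** Directional derivatives are derivatives of functions of one variable, so
    that one-variable rules can be used. *)
Lemma is_derive_along (f : C2 R -> R) z v d :
  is_derive (0 : R) 1 (fun h : R => f (h *: v + z)) d <-> is_derive z v f d.
Proof.
have E : (fun h : R => h^-1 *: (((fun h : R => f (h *: v + z)) \o shift 0) (h *: 1) - f (0 *: v + z))) =
    (fun h : R => h^-1 *: ((f \o shift z) (h *: v) - f z)).
  by apply/funext => h /=; rewrite addr0 scale0r add0r [h *: 1]mulr1.
by split => -[h1 h2]; split; move: h1 h2; rewrite /derivable /derive E.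
Qed.

Lemma is_derive_chain (F : R -> R) (f : C2 R -> R) z v a b :
  is_derive (f z) 1 F a -> is_derive z v f b -> is_derive z v (F \o f) (a * b).
Proof.
move=> dF /is_derive_along df; apply/is_derive_along.
have dF' : is_derive ((fun h : R => f (h *: v + z)) 0) 1 F a by rewrite scale0r add0r.
exact: (is_derive1_comp dF' df).
Qed.

Definition crd (j : 'I_4) (z : C2 R) : R :=
  match val j with 0 => z.1.1 | 1 => z.1.2 | 2 => z.2.1 | _ => z.2.2 end.

Lemma crdD j z v : crd j (z + v) = crd j z + crd j v.
Proof. by rewrite /crd; case: (val j) => [|[|[|]]]. Qed.

Lemma crdZ j (a : R) v : crd j (a *: v) = a * crd j v.
Proof. by rewrite /crd; case: (val j) => [|[|[|]]]. Qed.

Lemma is_derive_crd j z v : is_derive z v (crd j) (crd j v).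
Proof.
apply/is_derive_along.
have -> : (fun h : R => crd j (h *: v + z)) = ((crd j v \*: (@id R)) + cst (crd j z)).
  by apply/funext => h; rewrite crdD crdZ !fctE /GRing.scale/= mulrC.
have h1 : is_derive (0 : R) (1 : R) (@id R) 1 by exact: is_derive_id.
have h2 : is_derive (0 : R) (1 : R) (cst (crd j z) : R -> R) 0 by exact: is_derive_cst.
apply: (is_derive_eq (is_deriveD (is_deriveZ (crd j v) h1) h2)).
by rewrite addr0 [_ *: _]mulr1.
Qed.

Lemma continuous_crd j : continuous (crd j).
Proof.
move=> z; rewrite /crd; case: (val j) => [|[|[|_]]].
- apply: (@continuous_comp _ _ _ fst fst); [exact: cvg_fst|exact: cvg_fst].
- apply: (@continuous_comp _ _ _ fst snd); [exact: cvg_fst|exact: cvg_snd].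
- apply: (@continuous_comp _ _ _ snd fst); [exact: cvg_snd|exact: cvg_fst].
- apply: (@continuous_comp _ _ _ snd snd); [exact: cvg_snd|exact: cvg_snd].
Qed.

(** Explicit expressions that are smooth on U. The class is stable under
    partial derivatives, whence smoothness, and the constructor for the flat
    function gives functions of compact support. *)
Inductive elem U : (C2 R -> R) -> Prop :=
| elem_cst c : elem U (fun=> c)
| elem_crd j : elem U (crd j)
| elem_add f g : elem U f -> elem U g -> elem U (fun z => f z + g z)
| elem_mul f g : elem U f -> elem U g -> elem U (fun z => f z * g z)
| elem_inv f : (forall z, U z -> f z != 0) -> elem U f -> elem U (fun z => (f z)^-1)
| elem_flat k f : elem U f -> elem U (fun z => flat k (f z)).

Lemma elem_opp U f : elem U f -> elem U (fun z => - f z).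
Proof.
by move=> hf; under eq_fun do rewrite -mulN1r; apply: elem_mul => //; exact: elem_cst.
Qed.

Lemma elem_sub U f g : elem U f -> elem U g -> elem U (fun z => f z - g z).
Proof. by move=> hf hg; apply: elem_add => //; exact: elem_opp. Qed.

Lemma elem_sub_set U V f : V `<=` U -> elem U f -> elem V f.
Proof.
move=> VU; elim=> *; [exact: elem_cst|exact: elem_crd|exact: elem_add|exact: elem_mul|
  apply: elem_inv => //|exact: elem_flat].
by move=> z /VU; auto.
Qed.

Lemma elem_continuous U f : elem U f -> forall z, U z -> {for z, continuous f}.
Proof.
elim=> {f} => [c|j|f g _ hf _ hg|f g _ hf _ hg|f f0 _ hf|k f _ hf] z Uz.
- exact: cvg_cst.
- exact: continuous_crd.
- by apply: cvgD; [exact: hf|exact: hg].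
- by apply: cvgM; [exact: hf|exact: hg].
- by apply: cvgV; [exact: f0|exact: hf].
- by apply: continuous_comp; [exact: hf|exact: continuous_flat].
Qed.

Lemma elem_derive U f : elem U f -> forall v, exists2 g, elem U g &
  forall z, U z -> is_derive z v f (g z).
Proof.
elim=> {f} => [c|j|f g sf hf sg hg|f g sf hf sg hg|f f0 sf hf|k f sf hf] v.
- by exists (fun=> 0); [exact: elem_cst|move=> z _; exact: is_derive_cst].
- by exists (fun=> crd j v); [exact: elem_cst|move=> z _; exact: is_derive_crd].
- have [f' sf' hf'] := hf v; have [g' sg' hg'] := hg v.
  exists (fun z => f' z + g' z); first exact: elem_add.
  by move=> z Uz; apply: is_deriveD; [exact: hf'|exact: hg'].
- have [f' sf' hf'] := hf v; have [g' sg' hg'] := hg v.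
  exists (fun z => f z * g' z + g z * f' z).
    by apply: elem_add; apply: elem_mul.
  by move=> z Uz; apply: is_deriveM; [exact: hf'|exact: hg'].
- have [f' sf' hf'] := hf v.
  exists (fun z => - ((f z)^-1 * (f z)^-1) * f' z).
    by apply: elem_mul => //; apply: elem_opp; apply: elem_mul; exact: elem_inv.
  move=> z Uz; apply: is_derive_chain; last exact: hf'.
  have := @is_deriveV R id (f z) 1 1 (f0 z Uz) (is_derive_id _ _).
  by rewrite /GRing.scale/= mulr1 expr2 invfM.
- have [f' sf' hf'] := hf v.
  exists (fun z => (- k%:R * flat k.+1 (f z) + flat k.+2 (f z)) * f' z).
    apply: elem_mul => //; apply: elem_add; last exact: elem_flat.
    by apply: elem_mul; [exact: elem_cst|exact: elem_flat].
  move=> z Uz; apply: is_derive_chain; last exact: hf'.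
  exact: is_derive_flat.
Qed.

(** Partial derivatives are local, and U is open. *)
Lemma elem_partials U f g : open U -> elem U g -> (forall z, U z -> f z = g z) ->
  forall s, exists2 h, elem U h & forall z, U z -> foldr (@partial R) f s z = h z.
Proof.
move=> oU sg fg; elim=> [|j s [h sh hE]]; first by exists g.
have [h' sh' hE'] := elem_derive sh (dir R j).
exists h' => // z Uz /=; rewrite /partial.
transitivity ('D_(dir R j) h z).
  by apply: near_eq_derive; near=> y; apply: hE; near: y; exact: open_nbhs_nbhs.
exact: (@derive_val _ _ _ _ _ _ _ (hE' z Uz)).
Unshelve. all: by end_near.
Qed.

(** Smoothness is local: it suffices to have an expression near each point,
    possibly a different one for each open set of a cover. *)
Lemma smooth_glue f (P : set (C2 R) -> Prop) :
  (forall U, P U -> open U /\ exists2 g, elem U g & forall z, U z -> f z = g z) ->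
  (forall z, exists2 U, P U & U z) -> smooth f.
Proof.
move=> hP cov s.
have loc z : exists U, [/\ open U, U z & exists2 h, elem U h &
    forall y, U y -> foldr (@partial R) f s y = h y].
  have [U PU Uz] := cov z; have [oU [g sg fg]] := hP U PU.
  by exists U; split => //; exact: elem_partials sg fg s.
split => [z|j z].
  have [U [oU Uz [h sh hE]]] := loc z.
  have c : h y @[y --> z] --> h z := elem_continuous sh Uz.
  rewrite -(hE z Uz) in c; apply: cvg_trans c.
  have nU : nbhs z U by exact: open_nbhs_nbhs.
  by apply: near_eq_cvg; apply: filterS nU => y /hE/esym.
have [U [oU Uz [h sh hE]]] := loc z.
have [h' _ hE'] := elem_derive sh (dir R j).
apply: near_eq_derivable (@ex_derive _ _ _ _ _ _ _ (hE' z Uz)).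
have nU : nbhs z U by exact: open_nbhs_nbhs.
by apply: filterS nU => y /hE/esym.
Qed.

(** F need only be defined on Om: outside the support of
    the cutoff the product is 0
    near each point. *)
Lemma elem_test_function (Om K : set (C2 R)) F cutoff : open Om -> compact K -> K `<=` Om ->
  elem Om F -> elem setT cutoff -> (forall z, ~ K z -> cutoff z = 0) ->
  test_function Om (fun z => F z * cutoff z).
Proof.
move=> oO cK KO sF sc c0; split; last first.
  by exists K; split => // z /c0 ->; rewrite mulr0.
pose P (U : set (C2 R)) := U = Om \/ U = ~` K.
apply: (@smooth_glue _ P).
- move=> U [->|->].
    split => //; exists (fun z => F z * cutoff z) => //.
    by apply: elem_mul => //; exact: elem_sub_set sc.
  split; first by rewrite openC; apply: compact_closed => //; exact: norm_hausdorff.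
  by exists (fun=> 0); [exact: elem_cst|move=> z /c0 ->; rewrite mulr0].
- move=> z; have [Kz|Kz] := pselect (K z).
    by exists Om; [left|exact: KO].
  by exists (~` K); [right|].
Qed.

End smooth_class.

Section smooth_tools.
Variable R : realType.
Implicit Types (U : set (C2 R)) (z v w : C2 R) (F G : C2 R -> R[i]).
Local Notation Re := (@complex.Re R).
Local Notation Im := (@complex.Im R).

Definition o0 : 'I_4 := @Ordinal 4 0 isT.
Definition o1 : 'I_4 := @Ordinal 4 1 isT.
Definition o2 : 'I_4 := @Ordinal 4 2 isT.
Definition o3 : 'I_4 := @Ordinal 4 3 isT.

Lemma ord4P (P : 'I_4 -> Prop) : P o0 -> P o1 -> P o2 -> P o3 -> forall j, P j.
Proof.
move=> h0 h1 h2 h3 [[|[|[|[|//]]]] lj].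
- by rewrite (_ : Ordinal lj = o0)//; exact/val_inj.
- by rewrite (_ : Ordinal lj = o1)//; exact/val_inj.
- by rewrite (_ : Ordinal lj = o2)//; exact/val_inj.
- by rewrite (_ : Ordinal lj = o3)//; exact/val_inj.
Qed.

Lemma ReD (x y : R[i]) : Re (x + y) = Re x + Re y. Proof. by case: x; case: y. Qed.
Lemma ImD (x y : R[i]) : Im (x + y) = Im x + Im y. Proof. by case: x; case: y. Qed.
Lemma ReN (x : R[i]) : Re (- x) = - Re x. Proof. by case: x. Qed.
Lemma ImN (x : R[i]) : Im (- x) = - Im x. Proof. by case: x. Qed.

Definition elemC U F := elem U (fun z => Re (F z)) /\ elem U (fun z => Im (F z)).

Lemma elemC_cst U c : elemC U (fun=> c).
Proof. by split; exact: elem_cst. Qed.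

Lemma elemC_z1 U : elemC U (@z1 R).
Proof. by split; [exact: (elem_crd U o0)|exact: (elem_crd U o1)]. Qed.

Lemma elemC_z2 U : elemC U (@z2 R).
Proof. by split; [exact: (elem_crd U o2)|exact: (elem_crd U o3)]. Qed.

Lemma elemC_add U F G : elemC U F -> elemC U G -> elemC U (fun z => F z + G z).
Proof.
move=> [f1 f2] [g1 g2]; split.
  under eq_fun do rewrite raddfD. exact: elem_add.
under eq_fun do rewrite raddfD. exact: elem_add.
Qed.

Lemma elemC_mul U F G : elemC U F -> elemC U G -> elemC U (fun z => F z * G z).
Proof.
move=> [f1 f2] [g1 g2]; split.
  under eq_fun do rewrite ReM. by apply: elem_sub; exact: elem_mul.
under eq_fun do rewrite ImM. by apply: elem_add; exact: elem_mul.
Qed.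

Lemma elemC_sub U F G : elemC U F -> elemC U G -> elemC U (fun z => F z - G z).
Proof.
move=> hF hG; apply: elemC_add => //.
under eq_fun do rewrite -mulN1r; apply: elemC_mul => //; exact: elemC_cst.
Qed.

Lemma elemC_conj U F : elemC U F -> elemC U (fun z => (F z)^*)%C.
Proof.
move=> [f1 f2]; split; first by under eq_fun do rewrite ReJ.
by under eq_fun do rewrite ImJ; exact: elem_opp.
Qed.

Lemma elemC_exp U F n : elemC U F -> elemC U (fun z => F z ^+ n).
Proof.
move=> hF; elim: n => [|n IH]; first exact: elemC_cst.
by under eq_fun do rewrite exprS; exact: elemC_mul.
Qed.

Lemma elem_normsq U F : elemC U F -> elem U (fun z => normsq (F z)).
Proof. by move=> [f1 f2]; apply: elem_add; exact: elem_mul. Qed.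

Lemma elemC_inv U F : (forall z, U z -> F z != 0) -> elemC U F -> elemC U (fun z => (F z)^-1).
Proof.
move=> F0 hF; have [f1 f2] := hF.
have sn : elem U (fun z => (normsq (F z))^-1).
  by apply: elem_inv; [move=> z Uz; rewrite normsq_eq0 F0|exact: elem_normsq].
split; first by under eq_fun do rewrite ReV; exact: elem_mul.
by under eq_fun do rewrite ImV; apply: elem_opp; exact: elem_mul.
Qed.

Definition is_deriveC v F z (d : R[i]) :=
  is_derive z v (fun y => Re (F y)) (Re d) /\ is_derive z v (fun y => Im (F y)) (Im d).

Lemma is_deriveC_eq v F z d d' : is_deriveC v F z d -> d = d' -> is_deriveC v F z d'.
Proof. by move=> h <-. Qed.

Lemma is_deriveC_cst v c z : is_deriveC v (fun=> c) z 0.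
Proof. by split; exact: is_derive_cst. Qed.

Lemma is_deriveC_z1 v z : is_deriveC v (@z1 R) z (z1 v).
Proof. by split; [exact: (is_derive_crd o0)|exact: (is_derive_crd o1)]. Qed.

Lemma is_deriveC_z2 v z : is_deriveC v (@z2 R) z (z2 v).
Proof. by split; [exact: (is_derive_crd o2)|exact: (is_derive_crd o3)]. Qed.

Lemma is_deriveC_add v F G z a b : is_deriveC v F z a -> is_deriveC v G z b -> is_deriveC v (fun y => F y + G y) z (a + b).
Proof.
move=> [f1 f2] [g1 g2]; split; rewrite raddfD.
  under eq_fun do rewrite raddfD. exact: is_deriveD.
under eq_fun do rewrite raddfD. exact: is_deriveD.
Qed.

Lemma is_deriveC_opp v F z a : is_deriveC v F z a -> is_deriveC v (fun y => - F y) z (- a).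
Proof.
move=> [f1 f2]; split; rewrite raddfN.
  under eq_fun do rewrite raddfN. exact: is_deriveN.
under eq_fun do rewrite raddfN. exact: is_deriveN.
Qed.

Lemma is_deriveC_mul v F G z a b : is_deriveC v F z a -> is_deriveC v G z b ->
  is_deriveC v (fun y => F y * G y) z (F z * b + G z * a).
Proof.
move=> [f1 f2] [g1 g2]; split.
  under eq_fun do rewrite ReM.
  apply: (is_derive_eq (is_deriveB (is_deriveM f1 g1) (is_deriveM f2 g2))).
  by rewrite ReD !ReM /GRing.scale/=; ring.
under eq_fun do rewrite ImM.
apply: (is_derive_eq (is_deriveD (is_deriveM f1 g2) (is_deriveM f2 g1))).
by rewrite ImD !ImM /GRing.scale/=; ring.
Qed.

Lemma is_deriveC_conj v F z a : is_deriveC v F z a -> is_deriveC v (fun y => (F y)^*)%C z (a^*)%C.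
Proof.
move=> [f1 f2]; split; rewrite ?ReJ ?ImJ.
  by under eq_fun do rewrite ReJ.
by under eq_fun do rewrite ImJ; exact: is_deriveN.
Qed.

Lemma is_derive_inv (f : C2 R -> R) z v a : f z != 0 -> is_derive z v f a ->
  is_derive z v (fun y => (f y)^-1) (- (f z) ^- 2 * a).
Proof.
move=> f0 df; apply: is_derive_chain df.
have := @is_deriveV R id (f z) 1 1 f0 (is_derive_id _ _).
by rewrite /GRing.scale/= mulr1.
Qed.

Lemma is_deriveC_inv v F z a : F z != 0 -> is_deriveC v F z a ->
  is_deriveC v (fun y => (F y)^-1) z (- (F z) ^- 2 * a).
Proof.
move=> F0 [f1 f2].
have n0 : normsq (F z) != 0 by rewrite normsq_eq0.
have dn : is_derive z v (fun y => normsq (F y)) (2 * (Re (F z) * Re a + Im (F z) * Im a)).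
  apply: (is_derive_eq (is_deriveD (is_deriveM f1 f1) (is_deriveM f2 f2))).
  by rewrite /GRing.scale/=; ring.
have di := is_derive_inv n0 dn.
have E2 (x : R[i]) : Re (x ^- 2) = (Re x ^+ 2 - Im x ^+ 2) * normsq x ^- 2 /\
    Im (x ^- 2) = - (2 * Re x * Im x * normsq x ^- 2).
  rewrite ReV ImV normsqX expr2 ReM ImM; split; first by ring.
  by congr (- (_ * _)); ring.
have [E2r E2i] := E2 (F z).
split.
  under eq_fun do rewrite ReV.
  apply: (is_derive_eq (is_deriveM f1 di)).
  rewrite ReM ReN ImN E2r E2i /GRing.scale/=.
  move: n0; rewrite /normsq; set f := Re (F z); set g := Im (F z) => n0.
  by field.
under eq_fun do rewrite ImV.
apply: (is_derive_eq (is_deriveN (is_deriveM f2 di))).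
rewrite ImM ReN ImN E2r E2i /GRing.scale/=.
move: n0; rewrite /normsq; set f := Re (F z); set g := Im (F z) => n0.
by field.
Qed.

Lemma is_deriveC_exp v F z a n : is_deriveC v F z a -> is_deriveC v (fun y => F y ^+ n) z (n%:R * F z ^+ n.-1 * a).
Proof.
move=> hF; elim: n => [|n IH].
  by apply: is_deriveC_eq (is_deriveC_cst v 1 z) _; rewrite mulr0n !mul0r.
under eq_fun do rewrite exprS.
apply: is_deriveC_eq (is_deriveC_mul hF IH) _ => /=.
case: n {IH} => [|n]; first by rewrite !expr0 !mul0r mulr0; ring.
by rewrite /= [F z ^+ n.+1]exprS -!natr1; ring.
Qed.

Lemma compact_cbox (a b : 'I_4 -> R) : compact [set z | forall j, a j <= crd j z <= b j].
Proof.
rewrite (_ : [set z | _] = (`[a o0, b o0] `*` `[a o1, b o1]) `*` (`[a o2, b o2] `*` `[a o3, b o3])).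
  by apply: compact_setX; apply: compact_setX; exact: segment_compact.
apply/seteqP; split => -[[x y] [s t]] /=; rewrite !in_itv/=.
  by move=> h; split; split; [exact: (h o0)|exact: (h o1)|exact: (h o2)|exact: (h o3)].
by move=> [[h0 h1] [h2 h3]]; apply: ord4P.
Qed.

(** Cutoffs are obtained by applying the flat function to a large multiple of
    a defining function. *)
Lemma flat_cvg (x : R) : flat 0 (n.+1%:R * x - 1) @[n --> \oo] --> (if 0 < x then 1 else 0 : R).
Proof.
have [x0|x0] := leP x 0.
  apply: cvg_near_cst; apply: nearW => n; rewrite flat_le0//.
  have : n.+1%:R * x <= 0 by rewrite mulr_ge0_le0.
  lra.
have h : (n.+1%:R * x - 1)^-1 @[n --> \oo] --> (0 : R).
  apply/cvgrPdist_le => e e0; near=> n.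
  rewrite sub0r normrN.
  have l : e^-1 + 1 <= n.+1%:R * x.
    rewrite -ler_pdivrMr//; apply: (@le_trans _ _ n%:R); last by rewrite ler_nat.
    by near: n; exact: nbhs_infty_ger.
  have ei : 0 < e^-1 by rewrite invr_gt0.
  have l2 : e^-1 <= n.+1%:R * x - 1 by lra.
  rewrite ger0_norm; last by rewrite invr_ge0; lra.
  by rewrite -[leRHS]invrK lef_pV2 ?posrE//; lra.
have h2 : expR (- (n.+1%:R * x - 1)^-1) @[n --> \oo] --> (1 : R).
  rewrite -[X in _ --> X](@expR0 R) -oppr0.
  by apply: continuous_cvg; [exact: continuous_expR|exact: cvgN].
apply: cvg_trans h2; apply: near_eq_cvg; near=> n.
rewrite flat_gt0E ?expr0 ?mul1r//.
have : x^-1 + 1 <= n.+1%:R.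
  apply: (@le_trans _ _ n%:R); last by rewrite ler_nat.
  by near: n; exact: nbhs_infty_ger.
move=> /(ler_wpM2r (ltW x0)); rewrite mulrDl mulVf ?gt_eqF// mul1r; lra.
Unshelve. all: by end_near.
Qed.

End smooth_tools.

(** * Borel sets of C^2 *)

Section continuous_measurability.
Variable R : realType.

Lemma measurable_ball1 (x e : R) : measurable (ball x e : set (measurableTypeR R)).
Proof. by rewrite ball_itv; exact: measurable_itv. Qed.

Lemma measurable_ballC2 (c : C2 R) e : measurable (ball c e : set (mC2 R)).
Proof.
case: c => -[x y] [s t].
rewrite (_ : ball _ _ = (ball x e `*` ball y e) `*` (ball s e `*` ball t e))//.
by apply: measurableX; apply: measurableX; exact: measurable_ball1.
Qed.

Definition ratC2 (q : (rat * rat) * (rat * rat)) : C2 R :=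
  ((ratr q.1.1, ratr q.1.2), (ratr q.2.1, ratr q.2.2)).

Lemma rat_approx (x e : R) : 0 < e -> exists q : rat, ball (ratr q : R) e x.
Proof.
move=> e0; have [q] := @rat_in_itvoo R (x - e) (x + e) ltac:(lra).
rewrite in_itv/= => /andP[h1 h2]; exists q.
by rewrite /ball/= ltr_norml; apply/andP; split; lra.
Qed.

Lemma ratC2_approx (z : C2 R) e : 0 < e -> exists q, ball (ratC2 q) e z.
Proof.
case: z => -[x y] [s t] e0.
have [a ha] := rat_approx x e0; have [b hb] := rat_approx y e0.
have [c hc] := rat_approx s e0; have [d hd] := rat_approx t e0.
by exists ((a, b), (c, d)).
Qed.

(** Rational balls form a countable basis. *)
Lemma open_measurableC2 (U : set (C2 R)) : open U -> measurable (U : set (mC2 R)).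
Proof.
move=> oU.
pose I := (((rat * rat) * (rat * rat)) * nat)%type.
pose B (i : I) := ball (ratC2 i.1) (i.2.+1%:R^-1 : R).
rewrite (_ : U = \bigcup_(i in [set i : I | B i `<=` U]) B i).
  rewrite bigcup_mkcond; apply: countable_bigcupT_measurable; first exact: countableP.
  by move=> i; case: ifP => _; [exact: measurable_ballC2|exact: measurable0].
apply/seteqP; split => [z Uz|z [i BU]]; last exact: BU.
have : nbhs z U by exact: open_nbhs_nbhs.
move=> /nbhs_ballP [e /= e0 eU].
have [n hn] : exists n, (n.+1%:R^-1 : R) < e / 2.
  exists (Num.truncn (e / 2)^-1).
  rewrite -[ltRHS]invrK ltf_pV2 ?posrE//; first exact: truncnS_gt.
  by rewrite invr_gt0 divr_gt0.
have n0 : (0 : R) < n.+1%:R^-1 by rewrite invr_gt0.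
have [q hq] := ratC2_approx z n0.
exists (q, n) => //= y By; apply: eU.
rewrite [e]splitr; apply: (@ball_triangle _ _ (ratC2 q)).
  by apply: (le_ball (ltW hn)); exact: ball_sym.
exact: (le_ball (ltW hn)).
Qed.

Lemma continuous_measurableC2 (f : C2 R -> R) : continuous f ->
  measurable_fun (setT : set (mC2 R)) f.
Proof.
move=> cf; apply: (measurability _ (RGenOInfty.measurableE R)) => _ [_ [a ->] <-].
rewrite setTI; apply: open_measurableC2.
by apply: open_comp; [move=> z _; exact: cf|exact: interval_open].
Qed.

Lemma compact_measurableC2 (K : set (C2 R)) : compact K -> measurable (K : set (mC2 R)).
Proof.
move=> cK; rewrite -[K]setCK; apply: measurableC; apply: open_measurableC2.
by rewrite openC; apply: compact_closed => //; exact: norm_hausdorff.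
Qed.

Lemma crd_bounded (K : set (C2 R)) : compact K ->
  exists2 M : R, 0 < M & forall z, K z -> forall j, - M <= crd j z <= M.
Proof.
move=> cK.
have [M [_ hM]] := compact_bounded cK.
exists (`|M| + 1); first by rewrite ltr_wpDl.
move=> z Kz j; rewrite -ler_norml.
have h : `|z| <= `|M| + 1 by apply: (hM (`|M| + 1)) => //; rewrite (le_lt_trans (ler_norm M))// ltrDl.
apply: le_trans h; rewrite /crd.
have h1 : `|z.1| <= `|z| by rewrite [`|z|]prod_normE le_max lexx.
have h2 : `|z.2| <= `|z| by rewrite [`|z|]prod_normE le_max lexx orbT.
case: (val j) => [|[|[|_]]].
- by apply: le_trans h1; rewrite [`|z.1|]prod_normE le_max lexx.
- by apply: le_trans h1; rewrite [`|z.1|]prod_normE le_max lexx orbT.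
- by apply: le_trans h2; rewrite [`|z.2|]prod_normE le_max lexx.
- by apply: le_trans h2; rewrite [`|z.2|]prod_normE le_max lexx orbT.
Qed.

Lemma dV_cbox_lty (a b : 'I_4 -> R) :
  (@dV R [set z : C2 R | forall j, (a j <= crd j z <= b j)%R] < +oo)%E.
Proof.
rewrite (_ : [set z | _] = (`[a o0, b o0] `*` `[a o1, b o1]) `*` (`[a o2, b o2] `*` `[a o3, b o3])); last first.
  apply/seteqP; split => -[[x y] [s t]] /=; rewrite !in_itv/=.
    by move=> h; split; split; [exact: (h o0)|exact: (h o1)|exact: (h o2)|exact: (h o3)].
  by move=> [[h0 h1] [h2 h3]]; apply: ord4P.
have mI (c d : R) : measurable (`[c, d]%classic : set (measurableTypeR R)) by exact: measurable_itv.
have fI (c d : R) : (@lebesgue_measure R `[c, d] < +oo)%E.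
  by rewrite lebesgue_measure_itv/=; case: ifP => // _; rewrite -EFinD ltry.
have fA (A B : set (measurableTypeR R)) : measurable A -> measurable B ->
   (@lebesgue_measure R A < +oo)%E -> (@lebesgue_measure R B < +oo)%E -> (@area R (A `*` B) < +oo)%E.
  move=> mA mB A1 B1; rewrite /area product_measure1E//.
  by rewrite lte_mul_pinfty// ge0_fin_numE.
set X := (X in dV X); change (@vol R X < +oo)%E.
rewrite /vol product_measure1E//; try exact: measurableX.
by rewrite lte_mul_pinfty ?fA// ge0_fin_numE ?fA.
Qed.

Lemma dV_compact_lty (K : set (C2 R)) : compact K -> (@dV R K < +oo)%E.
Proof.
move=> cK; have [M M0 hM] := crd_bounded cK.
apply: le_lt_trans (dV_cbox_lty (fun=> - M) (fun=> M)).
apply: le_measure; rewrite ?inE.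
- exact: compact_measurableC2.
- by apply: compact_measurableC2; exact: compact_cbox.
- by move=> z Kz; exact: hM.
Qed.

Lemma hartogs_open : open (@hartogs R).
Proof.
have c1 : continuous (fun z : C2 R => normsq (z2 z) - normsq (z1 z)).
  move=> z; apply: (@elem_continuous R setT (fun z : C2 R => normsq (z2 z) - normsq (z1 z))) => //.
  by apply: elem_sub; apply: elem_normsq; [exact: elemC_z2|exact: elemC_z1].
have c2 : continuous (fun z : C2 R => 1 - normsq (z2 z)).
  move=> z; apply: (@elem_continuous R setT (fun z : C2 R => 1 - normsq (z2 z))) => //.
  by apply: elem_sub; [exact: elem_cst|apply: elem_normsq; exact: elemC_z2].
rewrite (_ : hartogs = (fun z : C2 R => normsq (z2 z) - normsq (z1 z)) @^-1` `]0, +oo[ `&`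
    (fun z : C2 R => 1 - normsq (z2 z)) @^-1` `]0, +oo[).
  by apply: openI; apply: open_comp; try exact: interval_open; move=> z _; [exact: c1|exact: c2].
by apply/seteqP; split => z; rewrite hartogsE/= !in_itv/= !andbT !subr_gt0.
Qed.

End continuous_measurability.

Section open_boxes.
Variable R : realType.

Definition obox (a b : 'I_4 -> R) : set (C2 R) := [set z | forall j, a j < crd j z < b j].
Definition cbox (a b : 'I_4 -> R) : set (C2 R) := [set z | forall j, a j <= crd j z <= b j].

Lemma measurable_crd j : measurable_fun (setT : set (mC2 R)) (crd j).
Proof. by apply: continuous_measurableC2; exact: continuous_crd. Qed.

Lemma measurable_cbox a b : measurable (cbox a b : set (mC2 R)).
Proof. by apply: compact_measurableC2; exact: compact_cbox. Qed.

Lemma open_obox a b : open (obox a b).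
Proof.
have oj j : open [set z : C2 R | a j < crd j z < b j].
  rewrite (_ : [set z | _] = crd j @^-1` `]a j, b j[).
    by apply: open_comp; [move=> z _; exact: continuous_crd|exact: interval_open].
  by apply/seteqP; split => z /=; rewrite in_itv.
rewrite (_ : obox a b = [set z | a o0 < crd o0 z < b o0] `&` [set z | a o1 < crd o1 z < b o1] `&`
  ([set z | a o2 < crd o2 z < b o2] `&` [set z | a o3 < crd o3 z < b o3])).
  by apply: openI; apply: openI; exact: oj.
apply/seteqP; split => z /=.
  by move=> h; split; split; exact: h.
by move=> [[h0 h1] [h2 h3]]; apply: ord4P.
Qed.

Lemma measurable_obox a b : measurable (obox a b : set (mC2 R)).
Proof. by apply: open_measurableC2; exact: open_obox. Qed.

Lemma oboxI a b a' b' : obox a b `&` obox a' b' =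
  obox (fun j => Num.max (a j) (a' j)) (fun j => Num.min (b j) (b' j)).
Proof.
apply/seteqP; split => z.
  move=> [h h'] j; rewrite gt_max lt_min.
  by have /andP[-> ->] := h j; have /andP[-> ->] := h' j.
move=> h; split => j; have := h j; rewrite gt_max lt_min => /andP[/andP[h1 h2] /andP[h3 h4]];
  by rewrite ?h1 ?h2 ?h3 ?h4.
Qed.

Definition oboxes : set (set (mC2 R)) := [set A | exists a b, A = obox a b].

(** The coordinates are measurable for the sigma-algebra generated by boxes,
    hence so is the identity map. *)
Lemma measurable_oboxes : (@measurable _ (mC2 R)) = <<s oboxes >>.
Proof.
apply/seteqP; split; last first.
  apply: smallest_sub; first exact: sigma_algebra_measurable.
  by move=> _ [a [b ->]]; exact: measurable_obox.
pose T' := g_sigma_algebraType oboxes.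
have mcrd j : measurable_fun (setT : set T') (crd j : T' -> measurableTypeR R).
  apply: (measurability _ (RGenOInfty.measurableE R)) => _ [_ [c ->] <-].
  rewrite setTI.
  pose B n := obox (fun i => if i == j then c else - n%:R) (fun=> n%:R) : set (C2 R).
  rewrite (_ : _ @^-1` _ = \bigcup_n (B n : set T')).
    by apply: bigcupT_measurable => n; apply: sub_sigma_algebra; eexists; eexists.
  apply/seteqP; split => z /=; rewrite in_itv/= andbT.
    move=> cz; have [M _ hM] := crd_bounded (@compact_set1 _ z).
    exists (Num.truncn M).+1 => // i.
    have := truncnS_gt M => h; have /andP[h1 h2] := hM z erefl i.
    case: eqP => [->|_]; apply/andP; split; rewrite ?cz//; try lra.
    by have /andP[_ h3] := hM z erefl j; lra.
  by move=> [n _ Bz]; have := Bz j; rewrite eqxx => /andP[].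
have mid : measurable_fun (setT : set T') ((fun z => ((crd o0 z, crd o1 z), (crd o2 z, crd o3 z))) : T' -> mC2 R).
  by apply: measurable_fun_pair; apply: measurable_fun_pair; exact: mcrd.
move=> A mA; have := mid measurableT A mA.
by rewrite setTI; congr (_ : Prop); congr (<<s _ >> _); apply/seteqP; split => -[[x y] [s t]].
Qed.

End open_boxes.

(** * The fundamental lemma of the calculus of variations *)

Section fundamental_lemma.
Variable R : realType.
Local Notation H := (@hartogs R).

(** Smooth approximation from below of the indicator of an open box. *)
Definition bump (a b : 'I_4 -> R) (n : nat) (z : C2 R) : R :=
  \prod_(j < 4) (flat 0 (n.+1%:R * (crd j z - a j) - 1) * flat 0 (n.+1%:R * (b j - crd j z) - 1)).

Lemma elem_bump U a b n : elem U (bump a b n).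
Proof.
have h j : elem U (fun z => flat 0 (n.+1%:R * (crd j z - a j) - 1) * flat 0 (n.+1%:R * (b j - crd j z) - 1)).
  by apply: elem_mul; apply: elem_flat; (apply: elem_sub; last exact: elem_cst);
    (apply: elem_mul; first exact: elem_cst); apply: elem_sub; try exact: elem_cst; exact: elem_crd.
rewrite /bump; elim: (index_enum _) => [|j s IH].
  by under eq_fun do rewrite big_nil; exact: elem_cst.
by under eq_fun do rewrite big_cons; exact: elem_mul.
Qed.

Lemma bump_ge0 a b n z : 0 <= bump a b n z.
Proof. by apply: prodr_ge0 => j _; rewrite mulr_ge0 ?flat_ge0. Qed.

Lemma bump_le1 a b n z : bump a b n z <= 1.
Proof.
apply: prodr_ile1 => j _; rewrite mulr_ge0 ?flat_ge0//=.
by rewrite mulr_ile1 ?flat_ge0 ?flat0_le1.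
Qed.

Lemma bump_out a b n z : ~ obox a b z -> bump a b n z = 0.
Proof.
move=> /existsNP[j /negP]; rewrite negb_and -!leNgt => h.
rewrite /bump (bigD1 j)//=.
suff -> : flat 0 (n.+1%:R * (crd j z - a j) - 1) * flat 0 (n.+1%:R * (b j - crd j z) - 1) = 0.
  by rewrite mul0r.
have n0 : 0 < n.+1%:R :> R by [].
case/orP: h => h.
  have x0 : crd j z - a j <= 0 by rewrite subr_le0.
  by rewrite flat_le0 ?mul0r//; have := mulr_ge0_le0 (ltW n0) x0; lra.
have x0 : b j - crd j z <= 0 by rewrite subr_le0.
by rewrite [X in _ * X]flat_le0 ?mulr0//; have := mulr_ge0_le0 (ltW n0) x0; lra.
Qed.

Lemma bump_cvg a b z : bump a b n z @[n --> \oo] --> (\1_(obox a b) z : R).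
Proof.
have [hz|hz] := pselect (obox a b z); last first.
  rewrite indicE memNset//=; apply: cvg_near_cst; apply: nearW => n; exact: bump_out.
rewrite indicE mem_set//=.
rewrite (_ : true%:R = \prod_(j < 4) (1 : R)); last by rewrite big1.
rewrite /bump.
have h j : flat 0 (n.+1%:R * (crd j z - a j) - 1) * flat 0 (n.+1%:R * (b j - crd j z) - 1)
     @[n --> \oo] --> (1 : R).
  have /andP[h1 h2] := hz j.
  rewrite -[X in _ --> X]mulr1; apply: cvgM.
    by have := @flat_cvg R (crd j z - a j); rewrite subr_gt0 h1.
  by have := @flat_cvg R (b j - crd j z); rewrite subr_gt0 h2.
elim: (index_enum _) => [|j s IH].
  by under eq_fun do rewrite big_nil; rewrite big_nil; exact: cvg_cst.
by under eq_fun do rewrite big_cons; rewrite big_cons; apply: cvgM.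
Qed.

Lemma integral_supp d (T : measurableType d) (mu : {measure set T -> \bar R})
    (D E : set T) (f : T -> \bar R) : E `<=` D -> (forall z, D z -> ~ E z -> f z = 0%E) ->
  (\int[mu]_(z in D) f z = \int[mu]_(z in E) f z)%E.
Proof.
move=> ED f0; rewrite integral_mkcond [RHS]integral_mkcond; apply: eq_integral => z _.
rewrite !patchE; have [zE|zE] := boolP (z \in E).
  by rewrite ifT// inE; apply: ED; move: zE; rewrite inE.
case: ifPn => // zD; apply: f0; first by move: zD; rewrite inE.
by move=> /mem_set; rewrite (negbTE zE).
Qed.

Lemma ballC2P (z y : C2 R) e : ball z e y <-> forall j, `|crd j z - crd j y| < e.
Proof.
case: z => -[x1 y1] [x2 y2]; case: y => -[u1 v1] [u2 v2]; split.
  by move=> [[h0 h1] [h2 h3]]; apply: ord4P.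
by move=> h; split; split; [exact: (h o0)|exact: (h o1)|exact: (h o2)|exact: (h o3)].
Qed.

Lemma lt_norm_half (e r y q z : R) : r < e / 2 -> q - r <= y <= q + r ->
  `|z - q| < r -> `|z - y| < e.
Proof.
move=> re /andP[y1 y2]; rewrite !ltr_norml => /andP[z1 z2].
have e2 : e / 2 + e / 2 = e by rewrite -splitr.
by move: e2 re; set h := e / 2 => e2 re; apply/andP; split; lra.
Qed.

Section vanishing.
Variable h : C2 R -> R.
Hypothesis mh : measurable_fun (setT : set (mC2 R)) h.
Hypothesis locint : forall K : set (C2 R), compact K -> K `<=` H ->
  (@dV R).-integrable (K : set (mC2 R)) (EFin \o h).
Hypothesis test0 : forall phi, test_function H phi ->
  (\int[@dV R]_(z in H) (h z * phi z)%:E = 0)%E.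

Let obox_sub_cbox a b : obox a b `<=` (cbox a b : set (C2 R)).
Proof. by move=> z hz j; have /andP[h1 h2] := hz j; rewrite !ltW. Qed.

(** Dominated convergence along the bumps. *)
Lemma obox_integral0 a b : cbox a b `<=` H ->
  (\int[@dV R]_(z in obox a b) (h z)%:E = 0)%E.
Proof.
move=> bH.
have oc := @obox_sub_cbox a b.
have cK : compact (cbox a b) by exact: compact_cbox.
have mcb : measurable (cbox a b : set (mC2 R)) by exact: measurable_cbox.
have tn n : (\int[@dV R]_(z in cbox a b) (h z * bump a b n z)%:E = 0)%E.
  have tb : test_function H (fun z => 1 * bump a b n z).
    apply: (@elem_test_function R H (cbox a b) (fun=> 1) (bump a b n) (@hartogs_open R) cK bH); [exact: elem_cst|exact: elem_bump|].
    by move=> z zK; apply: bump_out => /oc.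
  rewrite -(test0 tb) (integral_supp (@dV R) bH); last first.
    by move=> z _ zK; rewrite bump_out ?mulr0// => /oc.
  by apply: eq_integral => z _; rewrite mul1r.
have mb n : measurable_fun (setT : set (mC2 R)) (bump a b n).
  by apply: continuous_measurableC2 => z; apply: (elem_continuous (elem_bump setT a b n)).
have m1 n : measurable_fun (cbox a b : set (mC2 R)) (fun z => (h z * bump a b n z)%:E).
  by apply: measurable_funTS; apply/measurable_EFinP; exact: measurable_funM.
have m2 : measurable_fun (cbox a b : set (mC2 R)) (fun z => (h z * \1_(obox a b) z)%:E).
  apply: measurable_funTS; apply/measurable_EFinP; apply: measurable_funM => //.
  by apply: measurable_indic; exact: measurable_obox.
have ih : (@dV R).-integrable (cbox a b : set (mC2 R)) (fun z => `|(h z)%:E|)%E.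
  by apply: integrable_abse; exact: locint.
have cv : forall x : mC2 R, cbox a b x ->
    (h x * bump a b n x)%:E @[n --> \oo] --> (h x * \1_(obox a b) x)%:E.
  move=> z _; apply: cvg_EFin; first by apply: nearW.
  by apply: cvgM; [exact: cvg_cst|exact: bump_cvg].
have bd : forall (x : mC2 R) n, cbox a b x -> (`|(h x * bump a b n x)%:E| <= `|(h x)%:E|)%E.
  move=> z n _; rewrite /= lee_fin normrM ler_piMr//.
  by rewrite ger0_norm ?bump_ge0// bump_le1.
have [_ _] := @dominated_convergence _ _ _ (@dV R) (cbox a b) mcb
  (fun n z => (h z * bump a b n z)%:E) (fun z => (h z * \1_(obox a b) z)%:E)
  (fun z => `|(h z)%:E|)%E m1 m2 (aeW (@dV R) cv) ih (aeW (@dV R) bd).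
have -> : [sequence (\int[@dV R]_(x in cbox a b) (h x * bump a b n x)%:E)%E]_n = (fun=> 0%E).
  by apply/funext => n /=; exact: tn.
move=> c0.
have <- : (\int[@dV R]_(z in cbox a b) (h z * \1_(obox a b) z)%:E = \int[@dV R]_(z in obox a b) (h z)%:E)%E.
  rewrite (integral_supp (@dV R) oc); last first.
    by move=> z _ zo; rewrite indicE memNset// mulr0.
  by apply: eq_integral => z zo; rewrite indicE zo mulr1.
have := cvg_lim _ c0 => <-//.
by rewrite lim_cst.
Qed.

(** Boxes form a pi-system that generates the Borel sets, so the integral
    vanishes on every Borel subset of the box. *)
Lemma vanish_obox a b : cbox a b `<=` H ->
  ae_eq (@dV R) (obox a b : set (mC2 R)) (EFin \o h) (cst 0%E).
Proof.
move=> bH; set O := obox a b.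
have mO : measurable (O : set (mC2 R)) by exact: measurable_obox.
have iO : (@dV R).-integrable (O : set (mC2 R)) (EFin \o h).
  apply: (@integrableS _ (mC2 R) R (@dV R) (cbox a b)) => //.
  - exact: measurable_cbox.
  - exact: obox_sub_cbox.
  - by apply: locint => //; exact: compact_cbox.
have O0 : (\int[@dV R]_(z in O) (h z)%:E = 0)%E by exact: obox_integral0.
have all0 A : measurable (A : set (mC2 R)) -> (\int[@dV R]_(z in A `&` O) (h z)%:E = 0)%E.
  rewrite measurable_oboxes; move: A; apply: dynkin_induction.
  - exact: measurable_oboxes.
  - by move=> _ _ [a1 [b1 ->]] [a2 [b2 ->]]; rewrite oboxI; eexists; eexists.
  - by rewrite setTI.
  - move=> _ [a1 [b1 ->]]; rewrite oboxI; apply: obox_integral0 => z hz; apply: bH => j.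
    have := hz j; rewrite ge_max le_min => /andP[/andP[_ ->] /andP[_ ->]]//.
  - move=> S mS S0.
    have mSO : measurable (S `&` O : set (mC2 R)) by exact: measurableI.
    have mCO : measurable (~` S `&` O : set (mC2 R)) by apply: measurableI => //; exact: measurableC.
    have : (\int[@dV R]_(z in (S `&` O) `|` (~` S `&` O)) (h z)%:E = 0)%E.
      by rewrite -setIUl setUv setTI.
    rewrite integral_setU//.
    + by rewrite S0 add0e.
    + by apply: measurable_funTS; exact/measurable_EFinP.
    + by apply/disj_setPS => z [[Sz _] [nSz _]].
  - move=> F mF tF F0; rewrite setI_bigcupl integral_bigcup.
    + by apply: eseries0 => i _ _; exact: F0.
    + apply/trivIsetP => i j _ _ ij; move/trivIsetP : tF => /(_ i j I I ij) h0.
      by rewrite setIACA h0 set0I.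
    + by move=> k; apply: measurableI.
    + apply: (@integrableS _ (mC2 R) R (@dV R) O) => //.
        by apply: bigcup_measurable => k _; exact: measurableI.
      by move=> z [k _ []].
apply: integral_ae_eq => //.
move=> E EO mE; rewrite integral0 -(all0 E mE).
by congr (integral _ _ _); rewrite (setIidl EO).
Qed.

(** H is covered by countably many rational boxes whose closures lie in H. *)
Lemma vanish_hartogs : ae_eq (@dV R) (H : set (mC2 R)) (EFin \o h) (cst 0%E).
Proof.
pose I := (((rat * rat) * (rat * rat)) * nat)%type.
pose lo (i : I) j := crd j (ratC2 R i.1) - (i.2.+1%:R^-1 : R).
pose hi (i : I) j := crd j (ratC2 R i.1) + (i.2.+1%:R^-1 : R).
have ae n : \forall z \ae @dV R, forall i, unpickle n = Some i -> cbox (lo i) (hi i) `<=` H ->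
    obox (lo i) (hi i) z -> h z = 0.
  case: (unpickle n) => [i|]; last by apply: aeW.
  have [iH|iH] := pselect (cbox (lo i) (hi i) `<=` H); last first.
    by apply: aeW => z i' [<-].
  have := vanish_obox iH; apply: filterS => z hz i' [<-] _ oz.
  by have /= := hz oz => -[].
have := ae_foralln ae; apply: filterS => z hz Hz /=; congr EFin.
have : nbhs z H by apply: open_nbhs_nbhs; split => //; exact: hartogs_open.
move=> /nbhs_ballP [e /= e0 eH].
have [n hn] : exists n, (n.+1%:R^-1 : R) < e / 2.
  exists (Num.truncn (e / 2)^-1).
  rewrite -[ltRHS]invrK ltf_pV2 ?posrE//; first exact: truncnS_gt.
  by rewrite invr_gt0 divr_gt0.
have n0 : (0 : R) < n.+1%:R^-1 by rewrite invr_gt0.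
have [q /ballC2P hq] := ratC2_approx z n0.
apply: (hz (pickle ((q, n) : I)) (q, n)).
- by rewrite pickleK.
- move=> y hy; apply: eH; apply/ballC2P => j.
  by apply: lt_norm_half hn (hy j) _; rewrite distrC; exact: hq.
- move=> j; rewrite /lo /hi/=.
  have := hq j; rewrite ltr_norml; move: (crd j _) (crd j z) (_^-1) => a b r /andP[q1 q2].
  by apply/andP; split; lra.
Qed.

End vanishing.
End fundamental_lemma.

(** * Integration by parts *)

Section divergence.
Variable R : realType.
Implicit Types (z v w : C2 R) (G g : C2 R -> R).

Lemma crd_inj z w : (forall j, crd j z = crd j w) -> z = w.
Proof.
case: z w => [[a b] [c e]] [[a' b'] [c' e']] h.
by congr ((_, _), (_, _)); [exact: (h o0)|exact: (h o1)|exact: (h o2)|exact: (h o3)].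
Qed.

(** Only almost all sections are integrable, so the vanishing of the inner
    integral is required for integrable sections only. *)
Lemma integral_prod0l d d' (X : measurableType d) (Y : measurableType d')
  (m1 : {sigma_finite_measure set X -> \bar R}) (m2 : {sigma_finite_measure set Y -> \bar R})
  (f : X * Y -> \bar R) : (m1 \x m2)%E.-integrable setT f ->
  (forall x, m2.-integrable setT (fun y => f (x, y)) -> (\int[m2]_y f (x, y) = 0)%E) ->
  (\int[(m1 \x m2)%E]_z f z = 0)%E.
Proof.
move=> fi h; rewrite -integral12_prod_meas1// -[RHS](@integral0 _ _ _ m1 setT).
apply: ae_eq_integral => //; first exact: (measurable_fubini_F fi).
by have := ae_integrable1 fi; apply: filterS => x hx _; exact: h.
Qed.

Lemma integral_prod0r d d' (X : measurableType d) (Y : measurableType d')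
  (m1 : {sigma_finite_measure set X -> \bar R}) (m2 : {sigma_finite_measure set Y -> \bar R})
  (f : X * Y -> \bar R) : (m1 \x m2)%E.-integrable setT f ->
  (forall y, m1.-integrable setT (fun x => f (x, y)) -> (\int[m1]_x f (x, y) = 0)%E) ->
  (\int[(m1 \x m2)%E]_z f z = 0)%E.
Proof.
move=> fi h; rewrite -integral21_prod_meas1// -[RHS](@integral0 _ _ _ m2 setT).
apply: ae_eq_integral => //; first exact: (measurable_fubini_G fi).
by have := ae_integrable2 fi; apply: filterS => x hx _; exact: h.
Qed.

Lemma integral_derive_line0 (F f : R -> R) (M : R) : 0 < M ->
  (forall t : R, is_derive t 1 F (f t)) -> continuous f ->
  (forall t, ~ (- M <= t <= M) -> F t = 0 /\ f t = 0) ->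
  (\int[@lebesgue_measure R]_t (f t)%:E = 0)%E.
Proof.
move=> M0 dF cf out.
rewrite (integral_supp (@lebesgue_measure R) (E := `[- (M + 1), M + 1]%classic))//; last first.
  by move=> t _; rewrite /= in_itv/= => ht; rewrite (out t _).2// => /andP[h1 h2]; apply: ht; apply/andP; split; lra.
have cF : continuous F.
  by move=> t; apply: differentiable_continuous; apply/derivable1_diffP; exact: (@ex_derive _ _ _ _ _ _ _ (dF t)).
rewrite (@continuous_FTC2 _ f F)//.
- by rewrite (out (M + 1) _).1 ?(out (- (M + 1)) _).1 ?subee// => /andP[]; lra.
- lra.
- exact: continuous_subspaceT.
- split.
  + by move=> t _; exact: (@ex_derive _ _ _ _ _ _ _ (dF t)).
  + by apply: cvg_at_right_filter; exact: cF.
  + by apply: cvg_at_left_filter; exact: cF.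
- by move=> t _; rewrite derive1E; exact: (@derive_val _ _ _ _ _ _ _ (dF t)).
Qed.

Lemma is_derive_line G z v (t d : R) : is_derive (t *: v + z) v G d ->
  is_derive t (1 : R) (fun t : R => G (t *: v + z)) d.
Proof.
have E : (fun h : R => h^-1 *: (((fun t : R => G (t *: v + z)) \o shift t) (h *: (1 : R)) - G (t *: v + z))) =
    (fun h : R => h^-1 *: ((G \o shift (t *: v + z)) (h *: v) - G (t *: v + z))).
  by apply/funext => h /=; rewrite [h *: 1]mulr1 scalerDl addrA.
by move=> [h1 h2]; split; move: h1 h2; rewrite /derivable /derive E.
Qed.

Lemma integral_line0 G g v z (M : R) : 0 < M ->
  (forall z, is_derive z v G (g z)) -> continuous g ->
  (forall t, ~ (- M <= t <= M) -> G (t *: v + z) = 0 /\ g (t *: v + z) = 0) ->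
  (\int[@lebesgue_measure R]_t (g (t *: v + z))%:E = 0)%E.
Proof.
move=> M0 dG cg out.
apply: (@integral_derive_line0 (fun t => G (t *: v + z)) (fun t => g (t *: v + z)) M) => //.
- by move=> t; apply: is_derive_line.
- move=> t; apply: (@continuous_comp _ _ _ (fun t : R => t *: v + z) g); last exact: cg.
  by apply: cvgD; [apply: cvgZr_tmp; exact: cvg_id|exact: cvg_cst].
Qed.

(** The derivative is integrated first along its own direction, where the
    fundamental theorem of calculus gives 0. *)
Lemma integral_partial0 (j : 'I_4) G g (M : R) : 0 < M ->
  (forall z, is_derive z (dir R j) G (g z)) -> continuous g ->
  (forall z, ~ (- M <= crd j z <= M) -> G z = 0 /\ g z = 0) ->
  (@dV R).-integrable (setT : set (mC2 R)) (EFin \o g) ->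
  (\int[@dV R]_z (g z)%:E = 0)%E.
Proof.
move=> M0 dG cg out ig.
have line z : crd j z = 0 -> (\int[@lebesgue_measure R]_t (g (t *: dir R j + z))%:E = 0)%E.
  move=> z0; apply: (@integral_line0 G _ _ _ M) => // t ht; apply: out.
  have -> // : crd j (t *: dir R j + z) = t.
  rewrite crdD crdZ z0 addr0.
  suff -> : crd j (dir R j) = 1 by rewrite mulr1.
  by move: j {dG z0}; apply: ord4P.
move: j dG out line; apply: ord4P => dG out line.
- rewrite -[LHS]/(\int[(@area R \x @area R)%E]_z (g z)%:E)%E.
  apply: integral_prod0r => // y iy; apply: integral_prod0r => // b _.
  rewrite -[RHS](line ((0, b), y))//; apply: eq_integral => t _; congr (g _)%:E.
  by apply: crd_inj; apply: ord4P; rewrite crdD crdZ /crd /dir /=; ring.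
- rewrite -[LHS]/(\int[(@area R \x @area R)%E]_z (g z)%:E)%E.
  apply: integral_prod0r => // y iy; apply: integral_prod0l => // b _.
  rewrite -[RHS](line ((b, 0), y))//; apply: eq_integral => t _; congr (g _)%:E.
  by apply: crd_inj; apply: ord4P; rewrite crdD crdZ /crd /dir /=; ring.
- rewrite -[LHS]/(\int[(@area R \x @area R)%E]_z (g z)%:E)%E.
  apply: integral_prod0l => // y iy; apply: integral_prod0r => // b _.
  rewrite -[RHS](line (y, (0, b)))//; apply: eq_integral => t _; congr (g _)%:E.
  by apply: crd_inj; apply: ord4P; rewrite crdD crdZ /crd /dir /=; ring.
- rewrite -[LHS]/(\int[(@area R \x @area R)%E]_z (g z)%:E)%E.
  apply: integral_prod0l => // y iy; apply: integral_prod0l => // b _.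
  rewrite -[RHS](line (y, (b, 0)))//; apply: eq_integral => t _; congr (g _)%:E.
  by apply: crd_inj; apply: ord4P; rewrite crdD crdZ /crd /dir /=; ring.
Qed.

End divergence.

Section integration_by_parts.
Variable R : realType.
Implicit Types (Om K : set (C2 R)) (F phi : C2 R -> R).

(** The product is 0 in a neighbourhood of each point outside K. *)
Lemma continuous_mul_supp Om K F phi : compact K -> K `<=` Om ->
  (forall z, Om z -> {for z, continuous F}) -> continuous phi ->
  (forall z, ~ K z -> phi z = 0) -> continuous (fun z => F z * phi z).
Proof.
move=> cK KO cF cphi out z; have [Kz|Kz] := pselect (K z).
  by apply: cvgM; [exact: (cF _ (KO _ Kz))|exact: cphi].
rewrite /continuous_at (out z Kz) mulr0.
have oK : open (~` K) by rewrite openC; apply: compact_closed => //; exact: norm_hausdorff.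
have nK : nbhs z (~` K) by exact: open_nbhs_nbhs.
have c0 : (fun=> 0 : R) y @[y --> z] --> (0 : R) by exact: cvg_cst.
apply: cvg_trans c0; apply: near_eq_cvg.
by apply: filterS nK => y /out ->; rewrite mulr0.
Qed.

Lemma compact_supp_integrable K F (D : set (mC2 R)) : compact K -> continuous F ->
  (forall z, ~ K z -> F z = 0) -> measurable D ->
  (@dV R).-integrable D (EFin \o F).
Proof.
move=> cK cF out mD; apply: (@integrableS _ (mC2 R) R (@dV R) setT) => //.
have mK : measurable (K : set (mC2 R)) by exact: compact_measurableC2.
have mF : measurable_fun (setT : set (mC2 R)) F by exact: continuous_measurableC2.
have [M [_ hM]] : bounded_set (F @` K).
  by apply: compact_bounded; apply: continuous_compact => //; exact: continuous_subspaceT.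
apply/integrableP; split; first exact/measurable_EFinP.
rewrite (integral_supp (@dV R) (E := K))//; last first.
  by move=> z _ Kz /=; rewrite out// normr0.
apply: (@le_lt_trans _ _ (\int[@dV R]_(z in K) (`|M| + 1)%:E)%E).
  apply: ge0_le_integral => //.
  - by apply: measurable_funTS; apply: measurableT_comp => //; exact/measurable_EFinP.
  - move=> z Kz; rewrite lee_fin; apply: (hM (`|M| + 1)).
      by rewrite (le_lt_trans (ler_norm M))// ltrDl.
    by exists z.
rewrite integral_cst//; apply: lte_mul_pinfty => //.
exact: dV_compact_lty.
Qed.

Lemma test_function_partial_out Om phi : test_function Om phi ->
  exists K, [/\ compact K, K `<=` Om, forall z, ~ K z -> phi z = 0 &
    forall j z, ~ K z -> partial j phi z = 0].
Proof.
move=> [_ [K [cK KO out]]]; exists K; split => // j z Kz.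
have nK : nbhs z (~` K).
  by apply: open_nbhs_nbhs; split => //; rewrite openC; apply: compact_closed => //; exact: norm_hausdorff.
rewrite /partial (near_eq_derive _ (_ : \forall y \near z, phi y = cst 0 y)) ?derive_cst//.
by apply: filterS nK => y /out.
Qed.

(** The derivative of F phi has integral 0; it is continuous with compact
    support although F is defined on Om only. *)
Lemma integral_by_parts (j : 'I_4) Om F F' phi : open Om -> elem Om F ->
  (forall z, Om z -> is_derive z (dir R j) F (F' z)) -> test_function Om phi ->
  [/\ (@dV R).-integrable (Om : set (mC2 R)) (fun z => (F z * partial j phi z)%:E),
      (@dV R).-integrable (Om : set (mC2 R)) (fun z => (F' z * phi z)%:E) &
      (\int[@dV R]_(z in Om) (F z * partial j phi z)%:E +
       \int[@dV R]_(z in Om) (F' z * phi z)%:E = 0)%E].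
Proof.
move=> oO sF dF tphi; have [K [cK KO out outp]] := test_function_partial_out tphi.
have [sphi _] := tphi.
have cphi : continuous phi := (sphi [::]).1.
have cpj : continuous (partial j phi) := (sphi [:: j]).1.
have cF z : Om z -> {for z, continuous F} := elem_continuous sF (z := z).
have cF' z : Om z -> {for z, continuous F'}.
  move=> Oz; have [g sg gE] := elem_derive sF (dir R j).
  have E y : Om y -> g y = F' y.
    by move=> Oy; rewrite -(@derive_val _ _ _ _ _ _ _ (gE y Oy)) (@derive_val _ _ _ _ _ _ _ (dF y Oy)).
  have c : g y @[y --> z] --> g z := elem_continuous sg Oz.
  rewrite (E z Oz) in c; apply: cvg_trans c; apply: near_eq_cvg.
  have nO : nbhs z Om by exact: open_nbhs_nbhs.
  by apply: filterS nO => y /E.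
have c1 := continuous_mul_supp cK KO cF cpj (outp j).
have c2 := continuous_mul_supp cK KO cF' cphi out.
have mOm : measurable (Om : set (mC2 R)) by exact: open_measurableC2.
have z1 z : ~ K z -> F z * partial j phi z = 0 by move=> /outp ->; rewrite mulr0.
have z2 z : ~ K z -> F' z * phi z = 0 by move=> /out ->; rewrite mulr0.
have i1 D (mD : measurable (D : set (mC2 R))) := compact_supp_integrable cK c1 z1 mD.
have i2 D (mD : measurable (D : set (mC2 R))) := compact_supp_integrable cK c2 z2 mD.
split; [exact: i1|exact: i2|].
rewrite -integralD//; [|exact: i1|exact: i2].
rewrite -(integral_supp (@dV R) (D := setT))//; last first.
  by move=> z _ Oz; rewrite z1 ?z2 ?adde0//; move=> /KO.
have [M M0 hM] := crd_bounded cK.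
under eq_integral do rewrite -EFinD.
apply: (@integral_partial0 R j (fun z => F z * phi z) _ M M0).
- move=> z; have [Kz|Kz] := pselect (K z).
    have dphi : is_derive z (dir R j) phi (partial j phi z).
      by apply: DeriveDef => //; exact: ((sphi [::]).2 j z).
    apply: (is_derive_eq (is_deriveM (dF _ (KO _ Kz)) dphi)).
    by rewrite /GRing.scale/= [phi z * _]mulrC.
  have nK : nbhs z (~` K).
    by apply: open_nbhs_nbhs; split => //; rewrite openC; apply: compact_closed => //; exact: norm_hausdorff.
  rewrite z1// z2// addr0.
  have d0 : is_derive z (dir R j) (cst 0 : C2 R -> R) 0 by exact: is_derive_cst.
  apply: DeriveDef.
    apply: near_eq_derivable (@ex_derive _ _ _ _ _ _ _ d0).
    by apply: filterS nK => y /out ->; rewrite mulr0.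
  rewrite (near_eq_derive _ (_ : \forall y \near z, F y * phi y = cst 0 y)) ?derive_cst//.
  by apply: filterS nK => y /out ->; rewrite mulr0.
- by move=> z; apply: cvgD; [exact: c1|exact: c2].
- move=> z hz; have Kz : ~ K z by move=> /hM /(_ j).
  by rewrite out// mulr0 outp// !mulr0 addr0.
- by apply: (integrableD _ (i1 setT _) (i2 setT _)) => //.
Qed.

End integration_by_parts.

(** * Norms of the monomials *)

Section monomial_norms.
Variable R : realType.
Local Notation H := (@hartogs R).
Local Notation leb := (@lebesgue_measure R).
Local Notation mP := (measurableTypeR R * measurableTypeR R)%type.

Lemma integral_exp01 (b0 b1 : bool) n :
  (\int[leb]_(x in [set` Interval (BSide b0 0%R) (BSide b1 1%R)]) (x ^+ n)%:E = (n.+1%:R^-1)%:E)%E.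
Proof.
have mX : measurable_fun (`]0%R, 1%R[ : set (measurableTypeR R)) (fun x : R => (x ^+ n)%:E).
  by apply: measurable_funTS; apply/measurable_EFinP; apply: measurable_funX; exact: measurable_id.
rewrite integral_itv_bndoo// -(@integral_itv_bndoo _ _ _ _ true false)//.
pose F : R -> R := fun x => n.+1%:R^-1 * x ^+ n.+1.
have dF (x : R) : is_derive x 1 F (x ^+ n).
  have h : is_derive x (1 : R) (fun x : R => x ^+ n.+1) (n.+1%:R *: x ^+ n).
    have := @is_deriveX R R id n.+1 x 1 1 (is_derive_id _ _).
    by rewrite exprfctE /GRing.scale/= mulr1.
  apply: (is_derive_eq (is_deriveZ (n.+1%:R^-1 : R) h)).
  by rewrite scalerA mulVf ?scale1r// pnatr_eq0.
have cF : continuous F.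
  by move=> x; apply: differentiable_continuous; apply/derivable1_diffP; exact: (@ex_derive _ _ _ _ _ _ _ (dF x)).
rewrite (@continuous_FTC2 R _ F)//.
- by rewrite /F expr1n mulr1 expr0n mulr0 sube0.
- by apply: continuous_subspaceT => x; exact: exprn_continuous.
- split.
  + by move=> x _; exact: (@ex_derive _ _ _ _ _ _ _ (dF x)).
  + by apply: cvg_at_right_filter; exact: cF.
  + by apply: cvg_at_left_filter; exact: cF.
- by move=> x _; rewrite derive1E; exact: (@derive_val _ _ _ _ _ _ _ (dF x)).
Qed.

(** Polar integration; the flag b tells whether the centre of the disc belongs
    to the domain of integration. *)
Lemma disk_moment (b : bool) n :
  (\int[@area R]_z (\1_([set` Interval (BSide b 0%R) (BLeft 1%R)] : set R) (normsq (toC z)) * normsq (toC z) ^+ n)%:E =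
   (disk_area R / n.+1%:R)%:E)%E.
Proof.
set I := [set` _].
have mI : measurable (I : set (measurableTypeR R)) by exact: measurable_itv.
have mF : measurable_fun setT (fun t : measurableTypeR R => (\1_I t * t ^+ n)%:E).
  apply/measurable_EFinP; apply: measurable_funM; first exact: measurable_indic.
  by apply: measurable_funX; exact: measurable_id.
have F0 (t : measurableTypeR R) : (0 <= (\1_I t * t ^+ n)%:E)%E.
  rewrite lee_fin indicE; have [|_] := boolP (t \in I); last by rewrite mul0r.
  rewrite /I inE/= mul1r in_itv/= => /andP[t0 _]; apply: exprn_ge0.
  by move: t0; case: (b) => //= /ltW.
rewrite (radial_integral mF F0) (integral_supp leb (E := I))//.
- rewrite [X in (_ * X)%E](_ : _ = (n.+1%:R^-1)%:E) ?EFinM//.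
  rewrite -(@integral_exp01 b true); apply: eq_integral => x xI.
  by rewrite indicE xI mul1r.
- by move=> x; rewrite /I/= !in_itv/= andbT => /andP[]; case: (b) => //= /ltW.
- by move=> x _ xI; rewrite indicE memNset// mul0r.
Qed.

Lemma bounded_exponentsP (a : int * int) : bounded_exponents a ->
  exists m n : nat, a = (m%:Z, n%:Z - m%:Z).
Proof.
case: a => a1 a2 /= [/= h1 h2].
case: a1 h1 h2 => // m _; case E : (m%:Z + a2) => [n|//] _.
by exists m, n; rewrite -E addrC addKr.
Qed.

Lemma monomialE (m n : nat) (z : C2 R) : z2 z != 0 ->
  monomial (m%:Z, n%:Z - m%:Z) z = fibre z ^+ m * z2 z ^+ n.
Proof.
move=> z0; rewrite /monomial/= expfzDr// -exprnN -!exprnP /fibre expr_div_n.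
by rewrite -!mulrA; congr (_ * _); rewrite mulrC.
Qed.

(** On H, |z^a|^2 = |u|^(2m) |z2|^(2n), and the Jacobian shifts the second
    exponent by one. The factor in z2 excludes 0, where u has no meaning. *)
Lemma L2_normsq_monomial (m n : nat) :
  L2_normsq H (monomial (m%:Z, n%:Z - m%:Z)) = disk_area R ^+ 2 / (m.+1%:R * n.+2%:R).
Proof.
rewrite /L2_normsq.
pose A (x : R[i]) := (\1_(`[0, 1[%classic : set R) (normsq x) * normsq x ^+ m)%:E.
pose B (x : R[i]) := (\1_(`]0, 1[%classic : set R) (normsq x) * normsq x ^+ n)%:E.
have mAB (I : interval R) k : measurable_fun setT (fun z : mP => (\1_([set` I] : set R) (normsq (toC z)) * normsq (toC z) ^+ k)%:E).
  apply/measurable_EFinP; apply: measurable_funM.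
    by apply: (measurableT_comp (measurable_indic (measurable_itv I))); exact: measurable_nsq.
  by apply: measurable_funX; exact: measurable_nsq.
have AB0 (I : interval R) k (x : R[i]) : (0 <= (\1_([set` I] : set R) (normsq x) * normsq x ^+ k)%:E)%E.
  by rewrite lee_fin mulr_ge0// exprn_ge0// normsq_ge0.
have E : (\int[@dV R]_(z in H) (modulus (monomial (m%:Z, n%:Z - m%:Z) z) ^+ 2)%:E =
    \int[@dV R]_z (A (z1 z / z2 z)%R * B (z2 z)))%E.
  rewrite [RHS](integral_supp (@dV R) (E := H))//; last first.
    move=> z _ Hz; rewrite /A /B -EFinM !indicE.
    case: (boolP (normsq (z2 z) \in _)) => [|_]; last by rewrite !mul0r mulr0.
    rewrite inE/= in_itv/= normsq_gt0 => /andP[z0 zv].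
    case: (boolP (normsq (z1 z / z2 z) \in _)) => [|_]; last by rewrite !mul0r.
    rewrite inE/= in_itv/= => /andP[_ zu]; exfalso; apply: Hz.
    exact: hartogs_of_u.
  apply: eq_integral => z; rewrite inE => /hartogs_u[z0 zu zp zv].
  rewrite monomialE// -normsq_normc normsqM !normsqX /A /B -EFinM !indicE !mem_set/=; last first.
  - by rewrite in_itv/= normsq_ge0.
  - by rewrite in_itv/= zp.
  by rewrite !mul1r.
rewrite /Rintegral E hartogs_product//.
- rewrite /A disk_moment.
  rewrite [X in (_ * X)%E](_ : _ = (disk_area R / n.+2%:R)%:E).
    by rewrite -EFinM/= invfM expr2; ring.
  rewrite -(disk_moment false n.+1); apply: eq_integral => z _.
  by rewrite /B -EFinM exprS; congr EFin; ring.
- exact: mAB.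
- exact: mAB.
- by move=> x; exact: AB0.
- by move=> x; exact: AB0.
- by rewrite /B normsq0 indicE memNset ?mul0r//= in_itv/= ltxx.
Qed.

End monomial_norms.

(** * Closed form of the sub-Bergman kernel *)

Section unordered_sums.
Variable R : realType.

Section exhaustion.
Variables (T : choiceType) (A : set T) (s : nat -> seq T).
Hypothesis us : forall N, uniq (s N).
Hypothesis ss : forall N, {subset s N <= s N.+1}.
Hypothesis As : forall x, A x <-> exists N, x \in s N.

Let ssle M N : (M <= N)%N -> {subset s M <= s N}.
Proof.
elim: N => [|N IH]; first by rewrite leqn0 => /eqP ->.
rewrite leq_eqVlt => /predU1P[->//|]; rewrite ltnS => /IH h x /h; exact: ss.
Qed.

Let fset_cover (X : set T) : finite_set X -> X `<=` A -> exists N, X `<=` [set` s N].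
Proof.
move=> /finite_seqP[r ->]; elim: r => [|x r IH] rA; first by exists 0%N.
have [N hN] : exists N, [set` r] `<=` [set` s N].
  by apply: IH => y yr; apply: rA; rewrite /= inE yr orbT.
have /As[M hM] : A x by apply: rA; rewrite /= inE eqxx.
exists (maxn M N) => y /=; rewrite inE => /predU1P[->|yr].
  by apply: ssle hM; exact: leq_maxl.
by apply: (ssle (leq_maxr M N)); exact: hN.
Qed.

(** Every finite subset of A is contained in some s N. *)
Lemma esum_exhaustion (v : T -> R) (M : R) : (forall x, 0 <= v x) ->
  (forall N, \sum_(i <- s N) v i <= M) ->
  exists2 l : R, (\sum_(i <- s N) v i @[N --> \oo] --> l) & (\esum_(i in A) (v i)%:E = l%:E)%E.
Proof.
move=> v0 vM; pose P N := \sum_(i <- s N) v i.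
have PE N : ((P N)%:E = \sum_(i \in [set` s N]) (v i)%:E)%E.
  by rewrite -fsbig_seq// sumEFin.
have ndP : nondecreasing_seq P.
  move=> m n mn; rewrite -lee_fin !PE; apply: lee_fsum_nneg_subset => //.
  - by move=> x; rewrite !inE/=; exact: ssle.
  - by move=> x _; rewrite lee_fin.
have cP : cvgn P.
  by apply: nondecreasing_is_cvgn => //; exists M => _ [N _ <-]; exact: vM.
exists (limn P) => //; apply/eqP; rewrite eq_le; apply/andP; split.
- apply: ge_ereal_sup => _ [X [fX XA] <-].
  have [N XN] := fset_cover fX XA.
  apply: (@le_trans _ _ (P N)%:E).
    rewrite PE; apply: lee_fsum_nneg_subset => //; first by move=> x; rewrite !inE; exact: XN.
    by move=> x _; rewrite lee_fin.
  by rewrite lee_fin; exact: nondecreasing_cvgn_le.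
- have cE : (P N)%:E @[N --> \oo] --> (limn P)%:E.
    by apply: cvg_EFin => //; apply: nearW.
  rewrite -(cvg_lim _ cE)//; apply: lime_le; first by apply/cvg_ex; eexists; exact: cE.
  apply: nearW => N; apply: ereal_sup_ubound; exists [set` s N]; last by rewrite PE.
  by split; [exact: finite_seq|move=> x xN; apply/As; exists N].
Qed.

(** The sums of the positive and negative parts are finite limits of their
    partial sums, so their difference is the limit of the partial sums. *)
Lemma rsum_exhaustion (v : T -> R) (M L : R) :
  (forall N, \sum_(i <- s N) `|v i| <= M) ->
  (\sum_(i <- s N) v i @[N --> \oo] --> L) -> rsum A v = L.
Proof.
move=> vM vL.
have le1 x : Num.max x 0 <= `|x| :> R by rewrite ge_max normr_ge0 ler_norm.
have bd (w : T -> R) : (forall x, w x <= `|v x|) -> forall N, \sum_(i <- s N) w i <= M.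
  by move=> h N; apply: le_trans (vM N); apply: ler_sum => i _; exact: h.
have [a pa ea] := @esum_exhaustion (fun x => Num.max (v x) 0) M (fun x => ltac:(by rewrite le_max lexx orbT)) (bd _ (fun x => le1 _)).
have [b pb eb] := @esum_exhaustion (fun x => Num.max (- v x) 0) M (fun x => ltac:(by rewrite le_max lexx orbT)) (bd _ (fun x => ltac:(by rewrite -normrN; exact: le1))).
have c : \sum_(i <- s N) v i @[N --> \oo] --> a - b.
  rewrite (_ : (fun N => _) = (fun N => \sum_(i <- s N) Num.max (v i) 0) \-
      (fun N => \sum_(i <- s N) Num.max (- v i) 0)); first exact: cvgB.
  apply/funext => N /=; rewrite -sumrB; apply: eq_bigr => i _.
  by have [h|h] := leP (v i) 0; have [k|k] := leP (- v i) 0; lra.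
rewrite /rsum ea eb /=; exact: (cvg_unique _ c vL).
Qed.

End exhaustion.

End unordered_sums.

Section kernel_sum.
Variable R : realType.
Local Notation H := (@hartogs R).
Local Notation Re := (@complex.Re R).
Local Notation Im := (@complex.Im R).
Local Notation nm := (@Normc.normc R).

Definition geom1 (A : comNzRingType) (N : nat) (x : A) : A := \sum_(m < N) m.+1%:R * x ^+ m.
Definition geom2 (A : comNzRingType) (N : nat) (x : A) : A := \sum_(n < N) n.+2%:R * x ^+ n.

(** Partial sums of the derivative of the geometric series. *)
Lemma geom1E (A : comNzRingType) N (x : A) :
  geom1 N x * (1 - x) ^+ 2 = 1 - N.+1%:R * x ^+ N + N%:R * x ^+ N.+1.
Proof.
elim: N => [|N IH]; first by rewrite /geom1 big_ord0; ring.
rewrite /geom1 big_ord_recr/= mulrDl [X in X + _]IH !exprS -![_.+2%:R]natr1 -![_.+1%:R]natr1.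
ring.
Qed.

Lemma geom2E (A : comNzRingType) N (x : A) :
  geom2 N x * (1 - x) ^+ 2 = 2 - x - N.+2%:R * x ^+ N + N.+1%:R * x ^+ N.+1.
Proof.
elim: N => [|N IH]; first by rewrite /geom2 big_ord0; ring.
rewrite /geom2 big_ord_recr/= mulrDl [X in X + _]IH !exprS -![_.+3%:R]natr1 -![_.+2%:R]natr1 -![_.+1%:R]natr1.
ring.
Qed.

Lemma geom1_le N (r : R) : 0 <= r -> r < 1 -> geom1 N r <= (1 - r) ^- 2.
Proof.
move=> r0 r1; rewrite -[leRHS]mul1r ler_pdivlMr; last by rewrite exprn_gt0// subr_gt0.
rewrite geom1E exprS mulrA.
have h : N%:R * r <= N.+1%:R by apply: le_trans (_ : N%:R * 1 <= _); rewrite ?ler_wpM2l ?(ltW r1)// mulr1 ler_nat.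
have := ler_wpM2r (exprn_ge0 N r0) h; lra.
Qed.

Lemma geom2_le N (r : R) : 0 <= r -> r < 1 -> geom2 N r <= 2 * (1 - r) ^- 2.
Proof.
move=> r0 r1; apply: le_trans (_ : 2 * geom1 N r <= _); last by rewrite ler_wpM2l// geom1_le.
rewrite /geom2 /geom1 mulr_sumr; apply: ler_sum => n _; rewrite mulrA ler_wpM2r ?exprn_ge0//.
by rewrite -natrM ler_nat mul2n -addnn addSn addnS !ltnS leq_addr.
Qed.

Lemma normc_opp x : nm (- x) = nm x.
Proof. by rewrite !normc_sqrt normsqN. Qed.

Lemma normc_nat n : nm n%:R = n%:R.
Proof.
by rewrite -[n%:R](rmorph_nat (@real_complex R)) normc_sqrt /normsq/= expr0n addr0 sqrtr_sqr ger0_norm.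
Qed.

(** The terms of a bounded series with nonnegative terms tend to 0. *)
Lemma geom_term_cvg (r : R) : 0 <= r -> r < 1 -> N.+1%:R * r ^+ N @[N --> \oo] --> (0 : R).
Proof.
move=> r0 r1; apply: (@cvg_series_cvg_0 _ _ (fun N => N.+1%:R * r ^+ N)).
apply: nondecreasing_is_cvgn.
  by apply: nondecreasing_series => n _ _; rewrite mulr_ge0// exprn_ge0.
exists ((1 - r) ^- 2) => _ [N _ <-]; rewrite /series/= big_mkord; exact: geom1_le.
Qed.

Definition ccvg (u : nat -> R[i]) (l : R[i]) :=
  (Re (u n) @[n --> \oo] --> Re l) /\ (Im (u n) @[n --> \oo] --> Im l).

Lemma ccvgM u v a b : ccvg u a -> ccvg v b -> ccvg (fun n => u n * v n) (a * b).
Proof.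
move=> [u1 u2] [v1 v2]; split.
  under eq_fun do rewrite ReM.
  by rewrite ReM; apply: cvgB; apply: cvgM.
under eq_fun do rewrite ImM.
by rewrite ImM; apply: cvgD; apply: cvgM.
Qed.

Lemma ccvg_cst c : ccvg (fun=> c) c.
Proof. by split; exact: cvg_cst. Qed.

Lemma ccvg_le u l (e : nat -> R) : (forall n, nm (u n - l) <= e n) ->
  (e n @[n --> \oo] --> (0 : R)) -> ccvg u l.
Proof.
move=> h he.
have aux (v : nat -> R) a : (forall n, `|v n - a| <= e n) -> v n @[n --> \oo] --> a.
  move=> hv; apply/subr_cvg0; apply/norm_cvg0P.
  apply: (@squeeze_cvgr _ _ _ _ (fun=> 0) e) => //; last exact: cvg_cst.
  by apply: nearW => n; rewrite normr_ge0 hv.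
split; apply: aux => n; apply: le_trans (h n).
  by apply: le_trans (normc_Re _); rewrite ReD ReN.
by apply: le_trans (normc_Im _); rewrite ImD ImN.
Qed.

Lemma geom_ccvg (g : nat -> R[i] -> R[i]) (p : R[i] -> R[i]) (x : R[i]) : nm x < 1 ->
  (forall N, g N x * (1 - x) ^+ 2 - p x = - N.+2%:R * x ^+ N + N.+1%:R * x ^+ N.+1 \/
             g N x * (1 - x) ^+ 2 - p x = - N.+1%:R * x ^+ N + N%:R * x ^+ N.+1) ->
  ccvg (fun N => g N x) (p x * (1 - x) ^- 2).
Proof.
move=> x1 hg.
have x0 : 1 - x != 0.
  apply/eqP => h; move: x1; rewrite (_ : x = 1) ?Normc.normc1 ?ltxx//.
  by apply/eqP; rewrite eq_sym -subr_eq0 h.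
apply: (@ccvg_le _ _ (fun N => nm ((1 - x) ^- 2) * (3 * (N.+1%:R * nm x ^+ N)))).
  move=> N; have -> : g N x - p x * (1 - x) ^- 2 = (1 - x) ^- 2 * (g N x * (1 - x) ^+ 2 - p x).
    by rewrite mulrBr mulrCA mulVf ?mulr1 1?[_ * p x]mulrC// expf_neq0.
  rewrite Normc.normcM ler_wpM2l ?normc_ge0//.
  have q0 := exprn_ge0 N (normc_ge0 x).
  have q1 : nm x ^+ N.+1 <= nm x ^+ N by rewrite exprS ler_piMl// ltW.
  have b (a c : nat) : nm (- a%:R * x ^+ N + c%:R * x ^+ N.+1) <= (a + c)%:R * nm x ^+ N.
    apply: le_trans (le_normcD _ _) _; rewrite !Normc.normcM normc_opp !normc_nat !normcXn natrD mulrDl.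
    by rewrite lerD2l ler_wpM2l.
  rewrite mulrA; case: (hg N) => ->; apply: le_trans (b _ _) _; rewrite ler_wpM2r// natrD -![_.+2%:R]natr1 -![_.+1%:R]natr1;
    have := ler0n R N; lra.
rewrite -[X in _ --> X](mulr0 (nm ((1 - x) ^- 2))); apply: cvgM; first exact: cvg_cst.
rewrite -[X in _ --> X](mulr0 3); apply: cvgM; first exact: cvg_cst.
by apply: geom_term_cvg => //; exact: normc_ge0.
Qed.

Lemma geom1_ccvg (x : R[i]) : nm x < 1 -> ccvg (fun N => geom1 N x) ((1 - x) ^- 2).
Proof.
move=> x1; rewrite -[_ ^- 2]mul1r.
apply: (@geom_ccvg (fun N => geom1 N) (fun=> 1)) => // N; right.
by rewrite geom1E; ring.
Qed.

Lemma geom2_ccvg (x : R[i]) : nm x < 1 -> ccvg (fun N => geom2 N x) ((2 - x) * (1 - x) ^- 2).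
Proof.
move=> x1; apply: (@geom_ccvg (fun N => geom2 N) (fun x => 2 - x)) => // N; left.
by rewrite geom2E; ring.
Qed.

Lemma geom1_normc N (x : R[i]) : \sum_(m < N) nm (m.+1%:R * x ^+ m) = geom1 N (nm x).
Proof. by apply: eq_bigr => m _; rewrite Normc.normcM normc_nat normcXn. Qed.

Lemma geom2_normc N (x : R[i]) : \sum_(m < N) nm (m.+2%:R * x ^+ m) = geom2 N (nm x).
Proof. by apply: eq_bigr => m _; rewrite Normc.normcM normc_nat normcXn. Qed.

(** The closed form of the sub-Bergman kernel. *)
Definition bergman (z w : C2 R) : R[i] := (disk_area R ^- 2)%:C *
  ((1 - sarg z w) ^- 2 * ((2 - targ z w) * (1 - targ z w) ^- 2)).

Let exps (N : nat) : seq (int * int) := [seq (m%:Z, n%:Z - m%:Z) | m <- iota 0 N, n <- iota 0 N].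

Lemma exps_uniq N : uniq (exps N).
Proof.
apply: allpairs_uniq; rewrite ?iota_uniq//.
by move=> [m n] [m' n'] /= _ _ [-> /addIr [->]].
Qed.

Lemma exps_sub N : {subset exps N <= exps N.+1}.
Proof.
move=> _ /allpairsP[[m n] /= [hm hn ->]]; apply/allpairsP; exists (m, n).
by move: hm hn; rewrite !mem_iota !add0n /= => /ltnW hm /ltnW hn; split.
Qed.

Lemma exps_exhaust (x : int * int) : bounded_exponents x <-> exists N, x \in exps N.
Proof.
split => [/bounded_exponentsP[m [n ->]]|[N /allpairsP[[m n] /= [_ _ ->]]]].
  exists (maxn m n).+1; apply/allpairsP; exists (m, n).
  by rewrite !mem_iota !add0n /= !ltnS leq_maxl leq_maxr.
by split => //=; rewrite addrC subrK.
Qed.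

Lemma normc_sarg_lt1 (z w : C2 R) : H z -> H w -> nm (sarg z w) < 1 /\ nm (targ z w) < 1.
Proof.
have aux (x : R[i]) : normsq x < 1 -> nm x < 1.
  rewrite normsq_normc => h; rewrite ltNge; apply/negP => /(exprn_ege1 2); lra.
move=> /hartogs_u[_ zu zp zv] /hartogs_u[_ wu wp wv].
by split; apply: aux; rewrite normsqM normsqJ mulr_ilt1 ?normsq_ge0.
Qed.

(** The family is the product of two power series with absolutely convergent
    sums, exhausted by the squares m, n < N. *)
Lemma sub_bergman_kernelE (z w : C2 R) : H z -> H w -> sub_bergman_kernel z w = bergman z w.
Proof.
move=> Hz Hw; have [z0 _ _ _] := hartogs_u Hz; have [w0 _ _ _] := hartogs_u Hw.
have [s1 t1] := normc_sarg_lt1 Hz Hw.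
pose u a := monomial a z * (monomial a w)^*%C / (L2_normsq H (monomial a))%:C.
pose c : R[i] := (disk_area R ^- 2)%:C.
have uE (m n : nat) : u (m%:Z, n%:Z - m%:Z) = c * (m.+1%:R * sarg z w ^+ m * (n.+2%:R * targ z w ^+ n)).
  rewrite /u !monomialE// L2_normsq_monomial /sarg /targ /c.
  move: (fibre z) (z2 z) (fibre w) (z2 w) => a b a' b'.
  rewrite rmorphM !rmorphXn /= !exprMn.
  have -> : ((disk_area R ^+ 2 / (m.+1%:R * n.+2%:R))%:C : R[i])^-1 = (disk_area R ^- 2)%:C * (m.+1%:R * n.+2%:R).
    by rewrite -fmorphV invfM invrK rmorphM /= rmorphM !rmorph_nat.
  ring.
have sumE N : \sum_(a <- exps N) u a = c * (geom1 N (sarg z w) * geom2 N (targ z w)).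
  rewrite /exps big_allpairs_dep /geom1 /geom2 mulr_suml mulr_sumr -(big_mkord xpredT (fun m => c * (m.+1%:R * sarg z w ^+ m * \sum_(n < N) n.+2%:R * targ z w ^+ n))) /index_iota subn0.
  apply: eq_bigr => m _; rewrite !mulr_sumr -(big_mkord xpredT (fun n => c * (m.+1%:R * sarg z w ^+ m * (n.+2%:R * targ z w ^+ n)))) /index_iota subn0.
  by apply: eq_bigr => n _; rewrite uE.
have sumM N : \sum_(a <- exps N) nm (u a) = nm c * (geom1 N (nm (sarg z w)) * geom2 N (nm (targ z w))).
  rewrite -geom1_normc -geom2_normc.
  rewrite /exps big_allpairs_dep mulr_suml mulr_sumr -(big_mkord xpredT (fun m => nm c * (nm (m.+1%:R * sarg z w ^+ m) * \sum_(n < N) nm (n.+2%:R * targ z w ^+ n)))) /index_iota subn0.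
  apply: eq_bigr => m _; rewrite !mulr_sumr -(big_mkord xpredT (fun n => nm c * (nm (m.+1%:R * sarg z w ^+ m) * nm (n.+2%:R * targ z w ^+ n)))) /index_iota subn0.
  by apply: eq_bigr => n _; rewrite uE !Normc.normcM.
have [l1 l2] := ccvgM (ccvg_cst c) (ccvgM (geom1_ccvg s1) (geom2_ccvg t1)).
pose M := nm c * ((1 - nm (sarg z w)) ^- 2 * (2 * (1 - nm (targ z w)) ^- 2)).
have sumle N : \sum_(a <- exps N) nm (u a) <= M.
  rewrite sumM ler_wpM2l ?normc_ge0// ler_pM//.
  - by apply: sumr_ge0 => m _; rewrite mulr_ge0// exprn_ge0// normc_ge0.
  - by apply: sumr_ge0 => m _; rewrite mulr_ge0// exprn_ge0// normc_ge0.
  - by apply: geom1_le => //; exact: normc_ge0.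
  - by apply: geom2_le => //; exact: normc_ge0.
rewrite /sub_bergman_kernel /csum -/u /bergman -/c.
apply/eqP; rewrite eq_complex; apply/andP; split; apply/eqP => /=.
- apply: (rsum_exhaustion exps_uniq exps_sub exps_exhaust (M := M)).
    by move=> N; apply: le_trans (sumle N); apply: ler_sum => a _; exact: normc_Re.
  by under eq_fun do rewrite -raddf_sum sumE.
- apply: (rsum_exhaustion exps_uniq exps_sub exps_exhaust (M := M)).
    by move=> N; apply: le_trans (sumle N); apply: ler_sum => a _; exact: normc_Im.
  by under eq_fun do rewrite -raddf_sum sumE.
Qed.

End kernel_sum.

(** * Derivatives of the kernel and their rotational primitives *)

Section kernels.
Variable R : realType.
Local Notation H := (@hartogs R).
Local Notation nm := (@Normc.normc R).
Implicit Types (z w v : C2 R).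

Lemma is_deriveC_sub v F G z (a b : R[i]) : is_deriveC v F z a -> is_deriveC v G z b -> is_deriveC v (fun y => F y - G y) z (a - b).
Proof. by move=> hF hG; apply: is_deriveC_add => //; exact: is_deriveC_opp. Qed.

Lemma is_deriveC_expV v F z (a : R[i]) n : F z != 0 -> is_deriveC v F z a ->
  is_deriveC v (fun y => F y ^- n.+1) z (- n.+1%:R * F z ^- n.+2 * a).
Proof.
move=> F0 hF; apply: is_deriveC_eq (is_deriveC_inv (expf_neq0 n.+1 F0) (is_deriveC_exp n.+1 hF)) _.
rewrite /= !mulrA; congr (_ * _); rewrite !mulNr; congr (- _).
rewrite -[X in X * _]mulr1; move: (n.+1%:R : R[i]) => c; rewrite !exprS; field.
by rewrite F0 expf_neq0.
Qed.

Definition inv_area2 : R[i] := (disk_area R ^- 2)%:C.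
Definition geom2_lim (t : R[i]) : R[i] := (2 - t) * (1 - t) ^- 2.
Definition bergman_d1 z w : R[i] := inv_area2 * (2 * (1 - sarg z w) ^- 3 * ((fibre w)^*%C / z2 z) * geom2_lim (targ z w)).
Definition bergman_d2 z w : R[i] := inv_area2 * (- 2 * (1 - sarg z w) ^- 3 * (sarg z w / z2 z) * geom2_lim (targ z w) +
  (1 - sarg z w) ^- 2 * ((3 - targ z w) * (1 - targ z w) ^- 3) * (z2 w)^*%C).
(** The kernel K depends on z1 and w1 through z1 conj w1, so z1 dK/dz1 = conj
    w1 dK/d(conj w1), and K/z1 would be a primitive of the z1-derivative along
    the rotations of w1. Subtracting from K its value at z1 = 0 removes the
    pole and leaves a primitive. *)
Definition primitive1 z w : R[i] := inv_area2 * ((fibre w)^*%C * (2 - sarg z w) * (1 - sarg z w) ^- 2 * (z2 z)^-1 * geom2_lim (targ z w)).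
(** The kernel depends on z2 and w2 through z2 conj w2, so its z2-derivative
    is conj w2 times the conj w2-derivative of this quotient. *)
Definition primitive2 z w : R[i] := bergman z w / z2 z.

Lemma neq0_sub1 (x : R[i]) : nm x < 1 -> 1 - x != 0.
Proof.
by move=> h; apply/eqP => /subr0_eq x1; move: h; rewrite -x1 Normc.normc1 ltxx.
Qed.

Lemma is_deriveC_geom2_lim v F z (a : R[i]) : nm (F z) < 1 -> is_deriveC v F z a ->
  is_deriveC v (fun y => geom2_lim (F y)) z ((3 - F z) * (1 - F z) ^- 3 * a).
Proof.
move=> F1 hF; have F0 := neq0_sub1 F1.
have d := is_deriveC_expV (F := fun y => 1 - F y) 1 F0 (is_deriveC_sub (is_deriveC_cst v 1 z) hF).
by apply: is_deriveC_eq (is_deriveC_mul (is_deriveC_sub (is_deriveC_cst v 2 z) hF) d) _; field.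
Qed.

Lemma bergman_is_deriveC v z w : H z -> H w ->
  is_deriveC v (fun z => bergman z w) z (bergman_d1 z w * z1 v + bergman_d2 z w * z2 v).
Proof.
move=> Hz Hw; have [s1 t1] := normc_sarg_lt1 Hz Hw; have [z0 _ _ _] := hartogs_u Hz.
have s0 := neq0_sub1 s1; have t0 := neq0_sub1 t1.
have ds : is_deriveC v (fun z => sarg z w) z ((z1 v / z2 z - z1 z / (z2 z) ^+ 2 * z2 v) * (fibre w)^*%C).
  apply: is_deriveC_eq (is_deriveC_mul (is_deriveC_mul (is_deriveC_z1 v z) (is_deriveC_inv z0 (is_deriveC_z2 v z))) (is_deriveC_cst v (fibre w)^*%C z)) _.
  rewrite mulr0 add0r /=; set a := (fibre w)^*%C; field; exact: z0.
have dt : is_deriveC v (fun z => targ z w) z (z2 v * (z2 w)^*%C).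
  by apply: is_deriveC_eq (is_deriveC_mul (is_deriveC_z2 v z) (is_deriveC_cst v (z2 w)^*%C z)) _; rewrite mulr0 add0r mulrC.
have d1 := is_deriveC_expV (F := fun z => 1 - sarg z w) 1 s0 (is_deriveC_sub (is_deriveC_cst v 1 z) ds).
have d2 := is_deriveC_geom2_lim (F := fun z => targ z w) t1 dt.
apply: is_deriveC_eq (is_deriveC_mul (is_deriveC_cst v inv_area2 z) (is_deriveC_mul d1 d2)) _.
rewrite /bergman_d1 /bergman_d2 mulr0 addr0.
have sE : sarg z w = z1 z / z2 z * (fibre w)^*%C by [].
move: s0 t0 z0; move: (geom2_lim _) (1 - sarg z w) (1 - targ z w) (3 - targ z w).
rewrite sE; move: (fibre w)^*%C (z2 w)^*%C inv_area2 (z1 z) (z2 z) (z1 v) (z2 v).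
by move=> a b c Z1 Z2 V1 V2 k S T T3 s0 t0 z0; field; rewrite s0 t0 z0.
Qed.

(** The kernel is antiholomorphic in w1; the number e is its derivative with
    respect to conj w1. *)
Lemma primitive1_is_deriveC z w : H z -> H w -> exists2 e,
  (forall v, z2 v = 0 -> is_deriveC v (fun w => primitive1 z w) w ((z1 v)^*%C * e)) & (z1 w)^*%C * e = bergman_d1 z w.
Proof.
move=> Hz Hw; have [s1 t1] := normc_sarg_lt1 Hz Hw; have [w0 _ _ _] := hartogs_u Hw.
have s0 := neq0_sub1 s1.
pose b := (z2 w)^*%C.
have b0 : b != 0 by rewrite conjc_eq0.
exists (inv_area2 * (2 * (1 - sarg z w) ^- 3 * b^-1 / z2 z * geom2_lim (targ z w))); last first.
  rewrite /bergman_d1 (_ : (fibre w)^*%C = (z1 w)^*%C / b); first ring.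
  by rewrite /fibre rmorphM fmorphV.
move=> v v0.
have d2 : is_deriveC v (@z2 R) w 0 by rewrite -[X in is_deriveC _ _ _ X]v0; exact: is_deriveC_z2.
have du : is_deriveC v (fun w => (fibre w)^*%C) w ((z1 v)^*%C / b).
  apply: is_deriveC_eq (is_deriveC_conj (is_deriveC_mul (is_deriveC_z1 v w) (is_deriveC_inv w0 d2))) _.
  by rewrite mulr0 mulr0 add0r rmorphM fmorphV /= mulrC.
have ds : is_deriveC v (fun w => sarg z w) w (fibre z * ((z1 v)^*%C / b)).
  by apply: is_deriveC_eq (is_deriveC_mul (is_deriveC_cst v (fibre z) w) du) _; rewrite mulr0 addr0.
have dt : is_deriveC v (fun w => targ z w) w 0.
  by apply: is_deriveC_eq (is_deriveC_mul (is_deriveC_cst v (z2 z) w) (is_deriveC_conj d2)) _; rewrite rmorph0 !mulr0 addr0.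
have d3 := is_deriveC_expV (F := fun w => 1 - sarg z w) 1 s0 (is_deriveC_sub (is_deriveC_cst v 1 w) ds).
have d4 := is_deriveC_geom2_lim (F := fun w => targ z w) t1 dt.
apply: is_deriveC_eq (is_deriveC_mul (is_deriveC_cst v inv_area2 w) (is_deriveC_mul (is_deriveC_mul (is_deriveC_mul (is_deriveC_mul du
  (is_deriveC_sub (is_deriveC_cst v 2 w) ds)) d3) (is_deriveC_cst v (z2 z)^-1 w)) d4)) _.
have [z0 _ _ _] := hartogs_u Hz.
have sE : sarg z w = fibre z * (fibre w)^*%C by [].
clear d2 du ds dt d3 d4.
have t0 := neq0_sub1 t1.
move: s0; rewrite sE; move: t0 b0 z0; move: (geom2_lim _) (3 - targ z w) (1 - targ z w) => k T3 T t0.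
move: (fibre w)^*%C (fibre z) b inv_area2 (z2 z) (z1 v)^*%C => a u b' c Z V b0 z0 s0.
by field; rewrite ?s0 ?b0 ?z0 ?t0.
Qed.

(** The number e is the derivative with respect to conj w2. *)
Lemma primitive2_is_deriveC z w : H z -> H w -> exists2 e,
  (forall v, z1 v = 0 -> is_deriveC v (fun w => primitive2 z w) w ((z2 v)^*%C * e)) & (z2 w)^*%C * e = bergman_d2 z w.
Proof.
move=> Hz Hw; have [s1 t1] := normc_sarg_lt1 Hz Hw; have [w0 _ _ _] := hartogs_u Hw.
have s0 := neq0_sub1 s1; have t0 := neq0_sub1 t1.
pose b := (z2 w)^*%C.
have b0 : b != 0 by rewrite conjc_eq0.
have [z0 _ _ _] := hartogs_u Hz.
exists (inv_area2 * (- 2 * (1 - sarg z w) ^- 3 * sarg z w / b / z2 z * geom2_lim (targ z w) +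
  (1 - sarg z w) ^- 2 * ((3 - targ z w) * (1 - targ z w) ^- 3))); last first.
  rewrite /bergman_d2 -/b; move: s0 t0 z0 b0; move: (geom2_lim _) (1 - sarg z w) (1 - targ z w) (3 - targ z w) (sarg z w) b inv_area2 (z2 z).
  by move=> k S T T3 s b' c Z s0 t0 z0 b0; field; rewrite s0 b0 z0 t0.
move=> v v0.
have d2 : is_deriveC v (@z1 R) w 0 by rewrite -[X in is_deriveC _ _ _ X]v0; exact: is_deriveC_z1.
have du : is_deriveC v (fun w => (fibre w)^*%C) w (- (fibre w)^*%C * ((z2 v)^*%C / b)).
  apply: is_deriveC_eq (is_deriveC_conj (is_deriveC_mul d2 (is_deriveC_inv w0 (is_deriveC_z2 v w)))) _.
  rewrite mulr0 addr0 /fibre /b; move: w0; clear; move: (z1 w) (z2 w) (z2 v) => a c V c0.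
  rewrite !rmorphM rmorphN !fmorphV rmorphXn /=.
  have : (c^*)%C != 0 by rewrite conjc_eq0.
  by move: (c^*)%C (a^*)%C (V^*)%C => c' a' V' h; field.
have ds : is_deriveC v (fun w => sarg z w) w (fibre z * (- (fibre w)^*%C * ((z2 v)^*%C / b))).
  by apply: is_deriveC_eq (is_deriveC_mul (is_deriveC_cst v (fibre z) w) du) _; rewrite mulr0 addr0.
have dt : is_deriveC v (fun w => targ z w) w (z2 z * (z2 v)^*%C).
  by apply: is_deriveC_eq (is_deriveC_mul (is_deriveC_cst v (z2 z) w) (is_deriveC_conj (is_deriveC_z2 v w))) _; rewrite mulr0 addr0.
have d3 := is_deriveC_expV (F := fun w => 1 - sarg z w) 1 s0 (is_deriveC_sub (is_deriveC_cst v 1 w) ds).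
have d4 := is_deriveC_geom2_lim (F := fun w => targ z w) t1 dt.
apply: is_deriveC_eq (is_deriveC_mul (is_deriveC_mul (is_deriveC_cst v inv_area2 w) (is_deriveC_mul d3 d4)) (is_deriveC_cst v (z2 z)^-1 w)) _.
have sE : sarg z w = fibre z * (fibre w)^*%C by [].
clear d2 du ds dt d3 d4.
move: s0 t0 z0 b0; move: (geom2_lim _) (1 - sarg z w) (1 - targ z w) (3 - targ z w).
rewrite sE; move: (fibre w)^*%C (fibre z) b inv_area2 (z2 z) (z2 v)^*%C.
move=> a u b' c Z V k S T T3 s0 t0 z0 b0.
by field; rewrite s0 b0 z0 t0.
Qed.

End kernels.

(** * Estimates of the kernels *)

Section kernel_bounds.
Variable R : realType.
Local Notation H := (@hartogs R).
Local Notation nm := (@Normc.normc R).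
Implicit Types (z w v : C2 R).

Section measurability.
Let mfst := @measurable_fst _ _ (mC2 R) (mC2 R).
Let msnd := @measurable_snd _ _ (mC2 R) (mC2 R).

Lemma cmeas_sarg : cmeas (fun x : mC2 R * mC2 R => sarg x.1 x.2).
Proof.
apply: cmeasM; first exact: (cmeas_comp mfst (cmeas_fibre R)).
by apply: cmeasJ; exact: (cmeas_comp msnd (cmeas_fibre R)).
Qed.

Lemma cmeas_targ : cmeas (fun x : mC2 R * mC2 R => targ x.1 x.2).
Proof.
apply: cmeasM; first exact: (cmeas_comp mfst (cmeas_z2 R)).
by apply: cmeasJ; exact: (cmeas_comp msnd (cmeas_z2 R)).
Qed.

Lemma cmeas_invpow d (T : measurableType d) (f : T -> R[i]) n : cmeas f -> cmeas (fun t => (1 - f t) ^- n).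
Proof. by move=> hf; apply: cmeasV; apply: cmeasX; apply: cmeasB => //; exact: cmeas_cst. Qed.

Lemma cmeas_geom2_lim : cmeas (fun x : mC2 R * mC2 R => geom2_lim (targ x.1 x.2)).
Proof.
apply: cmeasM; last by apply: cmeas_invpow; exact: cmeas_targ.
by apply: cmeasB; [exact: cmeas_cst|exact: cmeas_targ].
Qed.

Lemma cmeas_bergman : cmeas (fun x : mC2 R * mC2 R => bergman x.1 x.2).
Proof.
apply: cmeasM; first exact: cmeas_cst.
by apply: cmeasM; [apply: cmeas_invpow; exact: cmeas_sarg|exact: cmeas_geom2_lim].
Qed.

Lemma cmeas_bergman_d1 : cmeas (fun x : mC2 R * mC2 R => bergman_d1 x.1 x.2).
Proof.
apply: cmeasM; first exact: cmeas_cst.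
apply: cmeasM; last exact: cmeas_geom2_lim.
apply: cmeasM; first by apply: cmeasM; [exact: cmeas_cst|apply: cmeas_invpow; exact: cmeas_sarg].
apply: cmeasM; first by apply: cmeasJ; exact: (cmeas_comp msnd (cmeas_fibre R)).
by apply: cmeasV; exact: (cmeas_comp mfst (cmeas_z2 R)).
Qed.

Lemma cmeas_bergman_d2 : cmeas (fun x : mC2 R * mC2 R => bergman_d2 x.1 x.2).
Proof.
apply: cmeasM; first exact: cmeas_cst.
apply: cmeasD; apply: cmeasM.
- apply: cmeasM.
    by apply: cmeasM; [exact: cmeas_cst|apply: cmeas_invpow; exact: cmeas_sarg].
  by apply: cmeasM; [exact: cmeas_sarg|apply: cmeasV; exact: (cmeas_comp mfst (cmeas_z2 R))].
- exact: cmeas_geom2_lim.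
- apply: cmeasM; first by apply: cmeas_invpow; exact: cmeas_sarg.
  apply: cmeasM; last by apply: cmeas_invpow; exact: cmeas_targ.
  by apply: cmeasB; [exact: cmeas_cst|exact: cmeas_targ].
- by apply: cmeasJ; exact: (cmeas_comp msnd (cmeas_z2 R)).
Qed.

Lemma cmeas_primitive1 : cmeas (fun x : mC2 R * mC2 R => primitive1 x.1 x.2).
Proof.
apply: cmeasM; first exact: cmeas_cst.
apply: cmeasM; last exact: cmeas_geom2_lim.
apply: cmeasM; last by apply: cmeasV; exact: (cmeas_comp mfst (cmeas_z2 R)).
apply: cmeasM; last by apply: cmeas_invpow; exact: cmeas_sarg.
apply: cmeasM; first by apply: cmeasJ; exact: (cmeas_comp msnd (cmeas_fibre R)).
by apply: cmeasB; [exact: cmeas_cst|exact: cmeas_sarg].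
Qed.

Lemma cmeas_primitive2 : cmeas (fun x : mC2 R * mC2 R => primitive2 x.1 x.2).
Proof.
by apply: cmeasM; [exact: cmeas_bergman|apply: cmeasV; exact: (cmeas_comp mfst (cmeas_z2 R))].
Qed.

Lemma cmeas_section (k : C2 R -> C2 R -> R[i]) z :
  cmeas (fun x : mC2 R * mC2 R => k x.1 x.2) -> cmeas (fun w : mC2 R => k z w).
Proof.
move=> hk; apply: (cmeas_comp (g := fun w : mC2 R => (z : mC2 R, w)) _ hk).
by apply: measurable_fun_pair => //; exact: measurable_cst.
Qed.

End measurability.

Lemma elemC_fibre : elemC H (fun z => fibre z).
Proof.
by apply: elemC_mul; [exact: elemC_z1|apply: elemC_inv; [move=> z /hartogs_u[]|exact: elemC_z2]].
Qed.

Lemma elemC_invpow (F : C2 R -> R[i]) n : (forall z, H z -> nm (F z) < 1) -> elemC H F ->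
  elemC H (fun z => (1 - F z) ^- n).
Proof.
move=> F1 hF; apply: elemC_inv.
  by move=> z Hz; apply: expf_neq0; apply: neq0_sub1; exact: F1.
by apply: elemC_exp; apply: elemC_sub => //; exact: elemC_cst.
Qed.

Lemma elemC_geom2_lim (F : C2 R -> R[i]) : (forall z, H z -> nm (F z) < 1) -> elemC H F ->
  elemC H (fun z => geom2_lim (F z)).
Proof.
move=> F1 hF; apply: elemC_mul; last exact: elemC_invpow.
by apply: elemC_sub => //; exact: elemC_cst.
Qed.

Lemma elemC_bergman_l w : H w -> elemC H (fun z => bergman z w).
Proof.
move=> Hw; apply: elemC_mul; first exact: elemC_cst.
apply: elemC_mul; [apply: (@elemC_invpow (fun z => sarg z w))|apply: (@elemC_geom2_lim (fun z => targ z w))];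
  try (by move=> z Hz; have [] := normc_sarg_lt1 Hz Hw).
- by apply: elemC_mul; [exact: elemC_fibre|exact: elemC_cst].
- by apply: elemC_mul; [exact: elemC_z2|exact: elemC_cst].
Qed.

Let elemC_sarg_r z : elemC H (fun w => sarg z w).
Proof. by apply: elemC_mul; [exact: elemC_cst|apply: elemC_conj; exact: elemC_fibre]. Qed.

Let elemC_targ_r z : elemC H (fun w => targ z w).
Proof. by apply: elemC_mul; [exact: elemC_cst|apply: elemC_conj; exact: elemC_z2]. Qed.

Lemma elemC_primitive1 z : H z -> elemC H (fun w => primitive1 z w).
Proof.
move=> Hz; apply: elemC_mul; first exact: elemC_cst.
apply: elemC_mul; last by apply: (@elemC_geom2_lim (fun w => targ z w)) => // w Hw; have [] := normc_sarg_lt1 Hz Hw.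
apply: elemC_mul; last exact: elemC_cst.
apply: elemC_mul; last by apply: (@elemC_invpow (fun w => sarg z w)) => // w Hw; have [] := normc_sarg_lt1 Hz Hw.
apply: elemC_mul; first by apply: elemC_conj; exact: elemC_fibre.
by apply: elemC_sub => //; exact: elemC_cst.
Qed.

Lemma elemC_primitive2 z : H z -> elemC H (fun w => primitive2 z w).
Proof.
move=> Hz; apply: elemC_mul; last exact: elemC_cst.
apply: elemC_mul; first exact: elemC_cst.
apply: elemC_mul; first by apply: (@elemC_invpow (fun w => sarg z w)) => // w Hw; have [] := normc_sarg_lt1 Hz Hw.
by apply: (@elemC_geom2_lim (fun w => targ z w)) => // w Hw; have [] := normc_sarg_lt1 Hz Hw.
Qed.

(** A bound, locally uniform in z and uniform in w, for all the kernels. *)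
Definition kernel_bound z : R := disk_area R ^- 2 * (10 *
  ((2 / (1 - normsq (fibre z))) ^+ 3 * (2 / (1 - normsq (z2 z))) ^+ 3 * (normsq (z2 z))^-1)).

Lemma kernel_bound_bounded (K : set (C2 R)) : compact K -> K `<=` H -> exists2 M, 0 <= M & forall z, K z -> kernel_bound z <= M.
Proof.
move=> cK KH.
have sb : elem H kernel_bound.
  apply: elem_mul; first exact: elem_cst.
  apply: elem_mul; first exact: elem_cst.
  have sp (F : C2 R -> R[i]) : elemC H F -> (forall z, H z -> normsq (F z) < 1) ->
      elem H (fun z => (2 / (1 - normsq (F z))) ^+ 3).
    move=> hF F1; have s1 : elem H (fun z => 2 / (1 - normsq (F z))).
      apply: elem_mul; first exact: elem_cst.
      apply: elem_inv; first by move=> z Hz; rewrite subr_eq0 gt_eqF// F1.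
      by apply: elem_sub; [exact: elem_cst|exact: elem_normsq].
    by under eq_fun do rewrite exprS expr2; apply: elem_mul => //; exact: elem_mul.
  apply: elem_mul; first apply: elem_mul; try apply: sp.
  - exact: elemC_fibre.
  - by move=> z /hartogs_u[].
  - exact: elemC_z2.
  - by move=> z /hartogs_u[].
  - apply: elem_inv; first by move=> z /hartogs_u[z0]; rewrite normsq_eq0.
    by apply: elem_normsq; exact: elemC_z2.
have [M [_ hM]] : bounded_set (kernel_bound @` K).
  apply: compact_bounded; apply: continuous_compact => //.
  by apply: continuous_in_subspaceT => z; rewrite inE => /KH; exact: elem_continuous.
exists (`|M| + 1) => // z Kz; apply: le_trans (ler_norm _) _; apply: (hM (`|M| + 1)).
  by rewrite (le_lt_trans (ler_norm M))// ltrDl.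
by exists z.
Qed.

Lemma normcV (x : R[i]) : nm x^-1 = (nm x)^-1.
Proof. by rewrite !normc_sqrt normsqV sqrtrV// normsq_ge0. Qed.

Lemma normc_lt1 (x : R[i]) : normsq x < 1 -> nm x < 1.
Proof. by rewrite normsq_normc => h; rewrite ltNge; apply/negP => /(exprn_ege1 2); lra. Qed.

Let inv1_le (x y : R[i]) : normsq x < 1 -> nm y <= nm x -> (nm (1 - y))^-1 <= 2 / (1 - normsq x).
Proof.
move=> x1 yx; have x1' := normc_lt1 x1.
have h : (1 - normsq x) / 2 <= nm (1 - y).
  have := normc_sub1 y; have := normc_ge0 x; rewrite normsq_normc; nra.
have p : 0 < (1 - normsq x) / 2 by rewrite divr_gt0// subr_gt0.
by rewrite -[leRHS]invrK invfM invrK mulrC lef_pV2 ?posrE// (lt_le_trans p).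
Qed.

Section estimates.
Variables (z w : C2 R).
Hypotheses (Hz : H z) (Hw : H w).
Let a := (nm (1 - sarg z w))^-1.
Let b := (nm (1 - targ z w))^-1.
Let d := (nm (z2 z))^-1.

Let a0 : 0 <= a. Proof. by rewrite invr_ge0 normc_ge0. Qed.
Let b0 : 0 <= b. Proof. by rewrite invr_ge0 normc_ge0. Qed.
Let d1 : 1 <= d.
Proof.
have [z0 _ zp zv] := hartogs_u Hz; have h := normc_lt1 zv.
by rewrite invf_ge1 ?(ltW h)// lt_neqAle normc_ge0 andbT eq_sym normc_sqrt sqrtr_eq0 -ltNge.
Qed.

Let norms : [/\ nm (fibre w) <= 1, nm (z1 w) <= 1, nm (z2 w) <= 1, nm (sarg z w) <= 1 & nm (targ z w) <= 1].
Proof.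
have [s1 t1] := normc_sarg_lt1 Hz Hw; have [_ wu wp wv] := hartogs_u Hw.
rewrite !ltW// normc_lt1//; have /hartogsE[h1 h2] := Hw; exact: lt_trans h2.
Qed.

Let two_sub (x : R[i]) : nm x <= 1 -> nm (2 - x) <= 3 /\ nm (3 - x) <= 4.
Proof.
move=> x1; split; apply: le_trans (le_normcD _ _) _; rewrite normc_opp normc_nat; lra.
Qed.

Let kap0 : nm (inv_area2 R) = disk_area R ^- 2.
Proof. by rewrite /inv_area2 normc_sqrt /normsq/= expr0n addr0 sqrtr_sqr ger0_norm// invr_ge0 exprn_ge0// ltW// disk_area_gt0. Qed.

Let bergmanE : nm (bergman z w) = disk_area R ^- 2 * (a ^+ 2 * (nm (2 - targ z w) * b ^+ 2)).
Proof. by rewrite /bergman !Normc.normcM kap0 !normcV !normcXn !exprVn. Qed.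

Let primitive1E : nm (primitive1 z w) = disk_area R ^- 2 * (nm (fibre w) * nm (2 - sarg z w) * a ^+ 2 * d * (nm (2 - targ z w) * b ^+ 2)).
Proof. by rewrite /primitive1 /geom2_lim -(normcJ (fibre w)) !Normc.normcM kap0 !normcV !normcXn !exprVn. Qed.

Let primitive2E : nm (primitive2 z w) = disk_area R ^- 2 * (a ^+ 2 * (nm (2 - targ z w) * b ^+ 2)) * d.
Proof. by rewrite /primitive2 Normc.normcM bergmanE normcV. Qed.

Let abs_kernelE : normsq (z2 z) `^ (- 2^-1) * abs_kernel z w = d * (a ^+ 2 * b ^+ 2).
Proof.
rewrite /abs_kernel /a /b !exprVn -!normsq_normc; congr (_ * _).
by rewrite normsq_normc -powR_mulrn ?normc_ge0// -powRrM mulrN mulfV// powR_inv1 ?normc_ge0.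
Qed.

Let d0 : 0 <= d := le_trans ler01 d1.
Let k0 : 0 <= disk_area R ^- 2. Proof. by rewrite invr_ge0 exprn_ge0// ltW// disk_area_gt0. Qed.

(** The exponent -1/2 of |z2|^2 is the factor 1/|z2| of the kernel Q; it costs
    nothing since |z2| < 1. *)
Lemma bergman_le_abs_kernel : nm (bergman z w) <= 9 * disk_area R ^- 2 * (normsq (z2 z) `^ (- 2^-1) * abs_kernel z w).
Proof.
have [_ _ _ _ t1] := norms; have [t2 _] := two_sub t1.
rewrite abs_kernelE bergmanE.
apply: (@le_trans _ _ (disk_area R ^- 2 * (a ^+ 2 * (3 * b ^+ 2)))).
  have ge := @normc_ge0 R.
  do ![apply: ler_pM => //|apply: mulr_ge0 => //|exact: exprn_ge0].
have h := mulr_ge0 k0 (mulr_ge0 (exprn_ge0 2 a0) (exprn_ge0 2 b0)).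
have := ler_wpM2r h d1; move: h; move: (disk_area R ^- 2) (a ^+ 2) (b ^+ 2) => k x y; lra.
Qed.

(** The factor 1/|z2| comes from the primitive itself; multiplication by w1 is
    what the coefficients of the rotation field provide. *)
Lemma primitive1_le_abs_kernel : nm (primitive1 z w) * nm (z1 w) <= 9 * disk_area R ^- 2 * (normsq (z2 z) `^ (- 2^-1) * abs_kernel z w).
Proof.
have [u1 w1 _ s1 t1] := norms; have [t2 _] := two_sub t1; have [s2 _] := two_sub s1.
rewrite abs_kernelE primitive1E.
have -> : 9 * disk_area R ^- 2 * (d * (a ^+ 2 * b ^+ 2)) =
    disk_area R ^- 2 * (1 * 3 * a ^+ 2 * d * (3 * b ^+ 2)) * 1 by ring.
have ge := @normc_ge0 R.
do ![apply: ler_pM => //|apply: mulr_ge0 => //|exact: exprn_ge0].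
Qed.

Lemma primitive2_le_abs_kernel : nm (primitive2 z w) * nm (z2 w) <= 9 * disk_area R ^- 2 * (normsq (z2 z) `^ (- 2^-1) * abs_kernel z w).
Proof.
have [_ _ w1 _ t1] := norms; have [t2 _] := two_sub t1.
rewrite abs_kernelE primitive2E.
apply: (@le_trans _ _ (disk_area R ^- 2 * (a ^+ 2 * (3 * b ^+ 2)) * d * 1)).
  have ge := @normc_ge0 R.
  do ![apply: ler_pM => //|apply: mulr_ge0 => //|exact: exprn_ge0].
have := mulr_ge0 k0 (mulr_ge0 d0 (mulr_ge0 (exprn_ge0 2 a0) (exprn_ge0 2 b0))).
by move: (disk_area R ^- 2) (a ^+ 2) (b ^+ 2) => k x y; lra.
Qed.

Let A := 2 / (1 - normsq (fibre z)).
Let B := 2 / (1 - normsq (z2 z)).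
Let D := (normsq (z2 z))^-1.
Let aA : a <= A.
Proof.
have [_ zu _ _] := hartogs_u Hz; have [w1 _ _ _ _] := norms.
by apply: inv1_le => //; rewrite Normc.normcM normcJ ler_piMr// normc_ge0.
Qed.
Let bB : b <= B.
Proof.
have [_ _ _ zu] := hartogs_u Hz; have [_ _ w1 _ _] := norms.
by apply: inv1_le => //; rewrite Normc.normcM normcJ ler_piMr// normc_ge0.
Qed.
Let dD : d <= D.
Proof.
rewrite /D normsq_normc -exprVn -/d expr2 ler_peMl//.
Qed.
Let AB1 (x : R[i]) : normsq x < 1 -> 1 <= 2 / (1 - normsq x).
Proof.
by move=> x1; rewrite ler_pdivlMr ?subr_gt0//; have := normsq_ge0 x; lra.
Qed.
Let A1 : 1 <= A. Proof. by apply: AB1; have [] := hartogs_u Hz. Qed.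
Let B1 : 1 <= B. Proof. by apply: AB1; have [] := hartogs_u Hz. Qed.
Let pA n : (n <= 3)%N -> a ^+ n <= A ^+ 3.
Proof.
move=> n3; apply: (@le_trans _ _ (A ^+ n)); last exact: ler_weXn2l.
by apply: lerXn2r => //; rewrite nnegrE// (le_trans ler01).
Qed.
Let pB n : (n <= 3)%N -> b ^+ n <= B ^+ 3.
Proof.
move=> n3; apply: (@le_trans _ _ (B ^+ n)); last exact: ler_weXn2l.
by apply: lerXn2r => //; rewrite nnegrE// (le_trans ler01).
Qed.

Let D1 : 1 <= D := le_trans d1 dD.
Let P0 : 0 <= A ^+ 3 * B ^+ 3.
Proof. by rewrite mulr_ge0// exprn_ge0// (le_trans ler01). Qed.

Lemma bergman_le_kernel_bound : nm (bergman z w) <= kernel_bound z.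
Proof.
have [_ _ _ _ t1] := norms; have [t2 _] := two_sub t1.
rewrite bergmanE /kernel_bound -/A -/B -/D ler_wpM2l//.
apply: (@le_trans _ _ (A ^+ 3 * (3 * B ^+ 3))).
  have ge := @normc_ge0 R.
  do ![exact: pA|exact: pB|apply: ler_pM => //|apply: mulr_ge0 => //|exact: exprn_ge0].
have := ler_wpM2l P0 D1; move: P0.
by move: (A ^+ 3) (B ^+ 3) D => x y t; lra.
Qed.

Lemma primitive1_le_kernel_bound : nm (primitive1 z w) <= kernel_bound z.
Proof.
have [u1 _ _ s1 t1] := norms; have [t2 _] := two_sub t1; have [s2 _] := two_sub s1.
rewrite primitive1E /kernel_bound -/A -/B -/D ler_wpM2l//.
apply: (@le_trans _ _ (1 * 3 * A ^+ 3 * D * (3 * B ^+ 3))).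
  have ge := @normc_ge0 R.
  do ![exact: pA|exact: pB|apply: ler_pM => //|apply: mulr_ge0 => //|exact: exprn_ge0].
have := mulr_ge0 P0 (le_trans ler01 D1).
by move: (A ^+ 3) (B ^+ 3) D => x y t; lra.
Qed.

Lemma primitive2_le_kernel_bound : nm (primitive2 z w) <= kernel_bound z.
Proof.
have [_ _ _ _ t1] := norms; have [t2 _] := two_sub t1.
rewrite primitive2E -mulrA /kernel_bound -/A -/B -/D ler_wpM2l//.
apply: (@le_trans _ _ (A ^+ 3 * (3 * B ^+ 3) * D)).
  have ge := @normc_ge0 R.
  do ![exact: pA|exact: pB|apply: ler_pM => //|apply: mulr_ge0 => //|exact: exprn_ge0].
have := mulr_ge0 P0 (le_trans ler01 D1).
by move: (A ^+ 3) (B ^+ 3) D => x y t; lra.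
Qed.

Lemma bergman_d1_le_kernel_bound : nm (bergman_d1 z w) <= kernel_bound z.
Proof.
have [u1 _ _ _ t1] := norms; have [t2 _] := two_sub t1.
rewrite /bergman_d1 /geom2_lim !Normc.normcM kap0 !normcV !normcXn -!exprVn normcJ normc_nat -/a -/b -/d.
rewrite [_^-1 ^+ 2]exprVn /kernel_bound -/A -/B -/D ler_wpM2l//.
apply: (@le_trans _ _ (2 * A ^+ 3 * (1 * D) * (3 * B ^+ 3))).
  have ge := @normc_ge0 R.
  do ![exact: pA|exact: pB|apply: ler_pM => //|apply: mulr_ge0 => //|exact: exprn_ge0].
have := mulr_ge0 P0 (le_trans ler01 D1); move: P0.
by move: (A ^+ 3) (B ^+ 3) D => x y t; lra.
Qed.

Lemma bergman_d2_le_kernel_bound : nm (bergman_d2 z w) <= kernel_bound z.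
Proof.
have [_ _ w1 s1 t1] := norms; have [t2 t3] := two_sub t1.
rewrite /bergman_d2 /geom2_lim Normc.normcM kap0 /kernel_bound -/A -/B -/D ler_wpM2l//.
have aux (S T V W : R[i]) : nm (- 2 * (1 - S) ^- 3 * (S / W) * ((2 - T) * (1 - T) ^- 2) +
    (1 - S) ^- 2 * ((3 - T) * (1 - T) ^- 3) * V^*%C) <=
    2 * (nm (1 - S))^-1 ^+ 3 * (nm S * (nm W)^-1) * (nm (2 - T) * (nm (1 - T))^-1 ^+ 2) +
    (nm (1 - S))^-1 ^+ 2 * (nm (3 - T) * (nm (1 - T))^-1 ^+ 3) * nm V.
  apply: le_trans (le_normcD _ _) _.
  by rewrite !Normc.normcM !normcV !normcXn -!exprVn normcJ normc_opp normc_nat.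
apply: le_trans (aux _ _ _ _) _; rewrite -/a -/b -/d.
apply: (@le_trans _ _ (2 * A ^+ 3 * (1 * D) * (3 * B ^+ 3) + A ^+ 3 * (4 * B ^+ 3) * 1)).
  have ge := @normc_ge0 R.
  apply: lerD;
  do ![exact: pA|exact: pB|apply: ler_pM => //|apply: mulr_ge0 => //|exact: exprn_ge0].
have := ler_wpM2l P0 D1; move: P0.
by move: (A ^+ 3) (B ^+ 3) D => x y t; lra.
Qed.

End estimates.
End kernel_bounds.

(** * Integral operators and their weak derivatives *)

Section parametric_integrals.
Variable R : realType.
Local Notation H := (@hartogs R).
Implicit Types (z w : C2 R).

Lemma dV_hartogs_lty : (@dV R H < +oo)%E.
Proof.
apply: le_lt_trans (dV_cbox_lty (fun=> -1) (fun=> 1)).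
apply: le_measure; rewrite ?inE.
- exact: measurable_hartogs.
- by apply: compact_measurableC2; exact: compact_cbox.
move=> z /hartogsE[h1 h2] j; rewrite -ler_norml.
have n1 := normc_lt1 (lt_trans h1 h2); have n2 := normc_lt1 h2.
move: j; apply: ord4P.
- exact: le_trans (normc_Re (z1 z)) (ltW n1).
- exact: le_trans (normc_Im (z1 z)) (ltW n1).
- exact: le_trans (normc_Re (z2 z)) (ltW n2).
- exact: le_trans (normc_Im (z2 z)) (ltW n2).
Qed.

Variable g : C2 R -> R.
Hypothesis g0 : forall w, 0 <= g w.
Hypothesis mg : measurable_fun (setT : set (mC2 R)) g.
Hypothesis ig : (@dV R).-integrable (H : set (mC2 R)) (EFin \o g).

Let mH : measurable (H : set (mC2 R)) := @measurable_hartogs R.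

Definition restrictHH (h : C2 R -> C2 R -> R) (x : mC2 R * mC2 R) : \bar R :=
  (\1_H x.1 * (\1_H x.2 * h x.1 x.2))%:E.

Lemma vol_supp (F : mC2 R -> \bar R) : (forall z, ~ H z -> F z = 0%E) ->
  (\int[@vol R]_z F z = \int[@dV R]_(z in H) F z)%E.
Proof. by move=> F0; apply: (integral_supp (@vol R) (D := setT) (E := H)) => // z _; exact: F0. Qed.

Section fubini.
Variable h : C2 R -> C2 R -> R.
Hypothesis mh : measurable_fun setT (fun x : mC2 R * mC2 R => h x.1 x.2).
Variable M : R.
Hypothesis hM : forall z w, H z -> H w -> `|h z w| <= M * g w.

Let m1H : measurable_fun (setT : set (mC2 R)) (\1_H : mC2 R -> R).
Proof. exact: measurable_indic. Qed.

Lemma measurable_restrictHH : measurable_fun setT (restrictHH h).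
Proof.
apply/measurable_EFinP; apply: measurable_funM.
  exact: (measurableT_comp m1H (@measurable_fst _ _ (mC2 R) (mC2 R))).
apply: measurable_funM => //.
exact: (measurableT_comp m1H (@measurable_snd _ _ (mC2 R) (mC2 R))).
Qed.

Lemma measurable_section z : measurable_fun (setT : set (mC2 R)) (h z).
Proof.
apply: (measurableT_comp (g := fun w : mC2 R => (z : mC2 R, w)) mh).
by apply: measurable_fun_pair => //; exact: measurable_cst.
Qed.

Lemma integrable_section z : H z -> (@dV R).-integrable (H : set (mC2 R)) (EFin \o h z).
Proof.
move=> Hz; apply: (@le_integrable _ (mC2 R) R (@dV R) H mH _ (fun w => (M * g w)%:E)).
- by apply/measurable_EFinP; apply: measurable_funTS; exact: measurable_section.
- move=> w Hw /=; rewrite lee_fin; apply: le_trans (hM Hz Hw) _; exact: ler_norm.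
- by under eq_fun do rewrite EFinM; apply: (@integrableZl _ (mC2 R) R (@dV R)).
Qed.

(** The kernel is dominated by a function of w alone, and H has finite volume.
    *)
Lemma integrable_restrictHH : (@vol R \x @vol R)%E.-integrable setT (restrictHH h).
Proof.
apply/(@integrable12ltyP _ _ (mC2 R) (mC2 R) R (@vol R) (@vol R) _ measurable_restrictHH).
pose C := (\int[@dV R]_(w in H) (`|M| * g w)%:E)%E.
have Cfin : C \is a fin_num.
  apply: integrable_fin_num => //.
  by under eq_fun do rewrite EFinM; apply: (@integrableZl _ (mC2 R) R (@dV R)).
have C0 : (0 <= C)%E by apply: integral_ge0 => w Hw; rewrite lee_fin mulr_ge0.
have hM' z w : H z -> H w -> `|h z w| <= `|M| * g w.
  by move=> Hz Hw; apply: le_trans (hM Hz Hw) _; rewrite ler_wpM2r// ler_norm.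
apply: (@le_lt_trans _ _ (\int[@vol R]_z (\1_H z * fine C)%:E)%E).
  apply: ge0_le_integral => //.
  - by move=> z _; exact: integral_ge0.
  - apply: (@measurable_fun_fubini_tonelli_F _ _ (mC2 R) (mC2 R) R (@vol R) (fun x => `|restrictHH h x|)%E) => //.
    by apply: measurableT_comp => //; exact: measurable_restrictHH.
  - by apply/measurable_EFinP; apply: measurable_funM.
  - move=> z _; have [Hz|Hz] := pselect (H z).
      rewrite indicE mem_set// mul1r fineK// /C -volE.
      rewrite (integral_supp (@vol R) (E := H))//; last first.
        by move=> w _ Hw; rewrite /restrictHH /= [\1_H w]indicE memNset// mul0r mulr0 normr0.
      apply: ge0_le_integral => //.
      + apply: measurable_funTS; apply: measurableT_comp => //.
        apply: (measurableT_comp (g := fun w : mC2 R => (z : mC2 R, w)) measurable_restrictHH).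
        by apply: measurable_fun_pair => //; exact: measurable_cst.
      + by apply: measurable_funTS; apply/measurable_EFinP; exact: measurable_funM.
      + move=> w Hw; rewrite /restrictHH /= lee_fin !indicE !mem_set// !mul1r; exact: hM'.
    rewrite indicE memNset// mul0r integral0_eq// => w _.
    by rewrite /restrictHH /= [\1_H z]indicE memNset// mul0r normr0.
rewrite (integral_supp (@vol R) (E := H))//; last first.
  by move=> z _ Hz; rewrite indicE memNset// mul0r.
rewrite (_ : (\int[@vol R]_(z in H) _ = \int[@vol R]_(z in H) (fine C)%:E)%E); last first.
  by apply: eq_integral => z zH; rewrite indicE zH mul1r.
rewrite integral_cst//; apply: lte_mul_pinfty => //.
- by rewrite lee_fin fine_ge0.
- exact: dV_hartogs_lty.
Qed.

Let fubini_FE z : H z -> fubini_F (@vol R) (restrictHH h) z = (\int[@dV R]_(w in H) (h z w)%:E)%E.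
Proof.
move=> Hz; rewrite /fubini_F (integral_supp (@vol R) (E := H))//; last first.
  by move=> w _ Hw; rewrite /restrictHH /= [\1_H w]indicE memNset// mul0r mulr0.
by rewrite -volE; apply: eq_integral => w wH; rewrite /restrictHH /= !indicE wH mem_set// !mul1r.
Qed.

Lemma integrable_parametric :
  (@dV R).-integrable (H : set (mC2 R)) (fun z => (\int[@dV R]_(w in H) (h z w)%:E)%E).
Proof.
have := @integrable_fubini_F _ _ (mC2 R) (mC2 R) R (@vol R) (@vol R) _ integrable_restrictHH.
move=> /(@integrableS _ (mC2 R) R (@vol R) setT H) => /(_ measurableT mH (@subsetT _ _)).
apply: eq_integrable => // z; rewrite inE => Hz; exact: fubini_FE.
Qed.

Lemma fubini_hartogs :
  (\int[@dV R]_(z in H) \int[@dV R]_(w in H) (h z w)%:E =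
   \int[@dV R]_(w in H) \int[@dV R]_(z in H) (h z w)%:E)%E.
Proof.
transitivity (\int[@vol R]_x \int[@vol R]_y restrictHH h (x, y))%E.
  apply/esym; transitivity (\int[@dV R]_(x in H) \int[@vol R]_y restrictHH h (x, y))%E.
    apply: vol_supp => z Hz; apply: integral0_eq => w _.
    by rewrite /restrictHH /= [\1_H z]indicE memNset// mul0r.
  by apply: eq_integral => z; rewrite inE => Hz; exact: fubini_FE.
rewrite (@Fubini _ _ (mC2 R) (mC2 R) R (@vol R) (@vol R) _ integrable_restrictHH).
transitivity (\int[@dV R]_(w in H) \int[@vol R]_z restrictHH h (z, w))%E.
  apply: vol_supp => w Hw; apply: integral0_eq => z _.
  by rewrite /restrictHH /= [\1_H w]indicE memNset// mul0r mulr0.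
apply: eq_integral => w; rewrite inE => Hw.
transitivity (\int[@dV R]_(z in H) restrictHH h (z, w))%E.
  apply: vol_supp => z Hz.
  by rewrite /restrictHH /= [\1_H z]indicE memNset// mul0r.
by apply: eq_integral => z zH; rewrite /restrictHH /= !indicE zH mem_set// !mul1r.
Qed.

End fubini.
End parametric_integrals.

Section integral_operators.
Variable R : realType.
Local Notation H := (@hartogs R).
Implicit Types (z w : C2 R) (P Q : C2 R -> C2 R -> R).

Variables (g kernel_bound : C2 R -> R).
Hypothesis g0 : forall w, 0 <= g w.
Hypothesis mg : measurable_fun (setT : set (mC2 R)) g.
Hypothesis ig : (@dV R).-integrable (H : set (mC2 R)) (EFin \o g).
Hypothesis mbeta : measurable_fun (setT : set (mC2 R)) kernel_bound.
Hypothesis kernel_bound_bd : forall K : set (C2 R), compact K -> K `<=` H ->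
  exists2 M, 0 <= M & forall z, K z -> kernel_bound z <= M.

Let mH : measurable (H : set (mC2 R)) := @measurable_hartogs R.

Definition kernel_le P := measurable_fun setT (fun x : mC2 R * mC2 R => P x.1 x.2) /\
  forall z w, H z -> H w -> `|P z w| <= kernel_bound z * g w.

Definition pint P z : R := \int[@dV R]_(w in H) P z w.

Lemma pint_integrable P z : kernel_le P -> H z -> (@dV R).-integrable (H : set (mC2 R)) (EFin \o P z).
Proof.
move=> [mP hP] Hz; apply: (@le_integrable _ (mC2 R) R (@dV R) H mH _ (fun w => (kernel_bound z * g w)%:E)).
- by apply/measurable_EFinP; apply: measurable_funTS; exact: measurable_section.
- by move=> w Hw /=; rewrite lee_fin; apply: le_trans (hP _ _ Hz Hw) _; exact: ler_norm.
- by under eq_fun do rewrite EFinM; apply: (@integrableZl _ (mC2 R) R (@dV R)).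
Qed.

Lemma pintE P z : kernel_le P -> H z -> ((pint P z)%:E = \int[@dV R]_(w in H) (P z w)%:E)%E.
Proof. by move=> kP Hz; rewrite fineK//; apply: integrable_fin_num => //; exact: pint_integrable. Qed.

(** Dividing by 1 + |bound| makes the kernel integrable on H x H, so that
    Fubini gives measurability; the factor is then restored. *)
Lemma pint_measurable P : kernel_le P -> measurable_fun (H : set (mC2 R)) (pint P).
Proof.
move=> kP; have [mP hP] := kP.
(* The added 1 keeps the divisor positive where the bound vanishes. *)
pose c z := 1 + `|kernel_bound z|; pose h z w := (c z)^-1 * P z w.
have c0 z : 0 < c z by rewrite ltr_pwDl.
have mc : measurable_fun (setT : set (mC2 R)) c.
  by apply: measurable_funD => //; exact: measurableT_comp.
have mh : measurable_fun setT (fun x : mC2 R * mC2 R => h x.1 x.2).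
  apply: measurable_funM => //.
  by apply: measurable_inv; exact: (measurableT_comp mc (@measurable_fst _ _ (mC2 R) (mC2 R))).
have hM z w : H z -> H w -> `|h z w| <= 1 * g w.
  move=> Hz Hw; rewrite normrM gtr0_norm ?invr_gt0// mulrC ler_pdivrMr// mul1r mulrC.
  apply: le_trans (hP z w Hz Hw) _; rewrite ler_wpM2r//.
  by rewrite (le_trans (ler_norm _))// lerDr.
have iF := integrable_parametric g0 mg ig mh hM.
have mF := measurable_int _ iF.
apply: (@eq_measurable_fun _ _ (mC2 R) R H (fun z => c z * fine (\int[@dV R]_(w in H) (h z w)%:E)%E)).
  move=> z; rewrite inE => Hz; apply: EFin_inj; rewrite pintE// EFinM fineK; last first.
    by apply: integrable_fin_num => //; exact: (integrable_section ig mh hM).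
  rewrite -integralZl//; last exact: (integrable_section ig mh hM).
  by apply: eq_integral => w _; rewrite -EFinM /h mulVKf// gt_eqF.
apply: measurable_funM; first exact: measurable_funTS.
exact: (measurableT_comp (fine_measurable measurableT) mF).
Qed.

Definition mass : R := \int[@dV R]_(w in H) g w.

Lemma pint_le P z : kernel_le P -> H z -> `|pint P z| <= kernel_bound z * mass.
Proof.
move=> kP Hz; have [mP hP] := kP; have iP := pint_integrable kP Hz.
apply: le_trans (le_normr_Rintegral _ _) _ => //.
rewrite /mass -RintegralZl//; apply: le_Rintegral => //.
- exact: (@integrable_norm _ (mC2 R) R (@dV R)).
- exact: (@integrableZl _ (mC2 R) R (@dV R) H mH (kernel_bound z) (EFin \o g)).
- by move=> w Hw; exact: hP.
Qed.

Lemma mass_ge0 : 0 <= mass.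
Proof. by apply: Rintegral_ge0. Qed.

(** After multiplication by a test function everything is bounded by a
    multiple of g(w), so that the integrals can be exchanged; the inner
    integral vanishes. *)
Lemma pint_weak P Q (j : 'I_4) phi : kernel_le P -> kernel_le Q -> test_function H phi ->
  (forall w, H w -> (\int[@dV R]_(z in H) (P z w * partial j phi z + Q z w * phi z)%:E = 0)%E) ->
  [/\ (@dV R).-integrable (H : set (mC2 R)) (fun z => (pint P z * partial j phi z)%:E),
     (@dV R).-integrable (H : set (mC2 R)) (fun z => (pint Q z * phi z)%:E) &
     (\int[@dV R]_(z in H) (pint P z * partial j phi z)%:E +
      \int[@dV R]_(z in H) (pint Q z * phi z)%:E = 0)%E].
Proof.
move=> kP kQ tphi z0; have [K [cK KH out outp]] := test_function_partial_out tphi.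
have [sphi _] := tphi.
have [M M0 hM] := kernel_bound_bd cK KH.
have bd (psi : C2 R -> R) : continuous psi -> exists2 C, 0 <= C & forall z, K z -> `|psi z| <= C.
  move=> cpsi; have [C [_ hC]] : bounded_set (psi @` K).
    by apply: compact_bounded; apply: continuous_compact => //; exact: continuous_subspaceT.
  exists (`|C| + 1) => // z Kz; apply: (hC (`|C| + 1)).
    by rewrite (le_lt_trans (ler_norm C))// ltrDl.
  by exists z.
have mul (P' : C2 R -> C2 R -> R) (psi : C2 R -> R) : kernel_le P' -> continuous psi -> (forall z, ~ K z -> psi z = 0) ->
    measurable_fun setT (fun x : mC2 R * mC2 R => P' x.1 x.2 * psi x.1) /\
    exists C, forall z w, H z -> H w -> `|P' z w * psi z| <= C * g w.
  move=> [mP' hP'] cpsi o; split.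
    apply: measurable_funM => //.
    exact: (measurableT_comp (continuous_measurableC2 cpsi) (@measurable_fst _ _ (mC2 R) (mC2 R))).
  have [C C0 hC] := bd _ cpsi; exists (M * C) => z w Hz Hw.
  have [Kz|Kz] := pselect (K z); last first.
    by rewrite o// mulr0 normr0 mulr_ge0// mulr_ge0.
  rewrite normrM mulrAC; apply: ler_pM => //; last exact: hC.
  apply: le_trans (hP' _ _ Hz Hw) _; rewrite ler_wpM2r//; exact: hM.
have [m1 [D1 b1]] := mul _ _ kP (sphi [:: j]).1 (outp j).
have [m2 [D2 b2]] := mul _ _ kQ (sphi [::]).1 out.
pose h1 z w := P z w * partial j phi z; pose h2 z w := Q z w * phi z.
have i1 := integrable_parametric g0 mg ig (h := h1) m1 b1.
have i2 := integrable_parametric g0 mg ig (h := h2) m2 b2.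
have e (P' : C2 R -> C2 R -> R) (psi : C2 R -> R) z : kernel_le P' -> H z ->
    ((pint P' z * psi z)%:E = \int[@dV R]_(w in H) (P' z w * psi z)%:E)%E.
  move=> kP' Hz; rewrite EFinM pintE// -integralZr//.
  exact: pint_integrable.
have b12 z w : H z -> H w -> `|h1 z w + h2 z w| <= (D1 + D2) * g w.
  by move=> Hz Hw; rewrite mulrDl (le_trans (ler_normD _ _))// lerD ?b1 ?b2.
have F := fubini_hartogs g0 mg ig (h := fun z w => h1 z w + h2 z w) (measurable_funD m1 m2) b12.
split.
- by apply: eq_integrable i1 => // z; rewrite inE => Hz; rewrite e.
- by apply: eq_integrable i2 => // z; rewrite inE => Hz; rewrite e.
transitivity (\int[@dV R]_(w in H) \int[@dV R]_(z in H) (h1 z w + h2 z w)%:E)%E; last first.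
  by apply: integral0_eq => w Hw; exact: z0.
rewrite -F.
transitivity (\int[@dV R]_(z in H) (\int[@dV R]_(w in H) (h1 z w)%:E + \int[@dV R]_(w in H) (h2 z w)%:E))%E.
  rewrite integralD//; congr (_ + _)%E; apply: eq_integral => z; rewrite inE => Hz; exact: e.
apply: eq_integral => z; rewrite inE => Hz.
rewrite -integralD//.
- exact: (integrable_section ig (h := h1) m1 b1).
- exact: (integrable_section ig (h := h2) m2 b2).
Qed.

End integral_operators.

Section complex_operators.
Variable R : realType.
Local Notation H := (@hartogs R).
Local Notation nm := (@Normc.normc R).
Local Notation Re := (@complex.Re R).
Local Notation Im := (@complex.Im R).
Implicit Types (z w : C2 R) (k l : C2 R -> C2 R -> R[i]).

Lemma multi_partial1 (a : 'I_4 -> nat) (j : 'I_4) (phi : C2 R -> R) :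
  (forall i, a i = (i == j)) -> multi_partial a phi = partial j phi /\ mi_order a = 1%N.
Proof.
move=> aj; split; last by rewrite /mi_order (bigD1 j)//= aj eqxx big1// => i; rewrite aj => /negbTE ->.
rewrite /multi_partial (_ : enum 'I_4 = [:: o0; o1; o2; o3]); last first.
  by apply: (inj_map val_inj); rewrite val_enum_ord.
by move: j aj; apply: ord4P => aj; rewrite /= !aj.
Qed.

Lemma multi_partial0 (a : 'I_4 -> nat) (phi : C2 R -> R) :
  (forall i, a i = 0%N) -> multi_partial a phi = phi /\ mi_order a = 0%N.
Proof.
move=> a0; split; last by rewrite /mi_order big1.
by rewrite /multi_partial; elim: (enum _) => //= i s ->; rewrite a0.
Qed.

Variable f : C2 R -> R[i].
Hypothesis mf : cmeas (f : mC2 R -> R[i]).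
Hypothesis fi : (@dV R).-integrable (H : set (mC2 R)) (fun w => (nm (f w))%:E).

Let mH : measurable (H : set (mC2 R)) := @measurable_hartogs R.
Let g w := nm (f w).
Let g0 w : 0 <= g w. Proof. exact: normc_ge0. Qed.
Let mg : measurable_fun (setT : set (mC2 R)) g. Proof. exact: cmeas_normc. Qed.

Let mbeta : measurable_fun (setT : set (mC2 R)) (@kernel_bound R).
Proof.
apply: measurable_funM => //; apply: measurable_funM => //.
have m (F : mC2 R -> R[i]) : cmeas F -> measurable_fun setT (fun z => (2 / (1 - normsq (F z))) ^+ 3).
  move=> hF; apply: measurable_funX; apply: measurable_funM => //.
  by apply: measurable_inv; apply: measurable_funB => //; exact: cmeas_normsq.
apply: measurable_funM; first by apply: measurable_funM; apply: m; [exact: cmeas_fibre|exact: cmeas_z2].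
by apply: measurable_inv; apply: cmeas_normsq; exact: cmeas_z2.
Qed.

(** The condition under which the operator is defined on integrable functions
    and can be differentiated. *)
Definition bounded_kernel k := cmeas (fun x : mC2 R * mC2 R => k x.1 x.2) /\
  forall z w, H z -> H w -> nm (k z w) <= kernel_bound z.

Definition kernel_op k z : R[i] := cintegral H (fun w => k z w * f w).

Let cmeas_kf k : bounded_kernel k -> cmeas (fun x : mC2 R * mC2 R => k x.1 x.2 * f x.2).
Proof.
move=> [mk _]; apply: cmeasM => //.
exact: (cmeas_comp (@measurable_snd _ _ (mC2 R) (mC2 R)) mf).
Qed.

Let ker_Re k : bounded_kernel k -> kernel_le g (@kernel_bound R) (fun z w => Re (k z w * f w)).
Proof.
move=> ck; split; first by have [] := cmeas_kf ck.
move=> z w Hz Hw; apply: le_trans (normc_Re _) _; rewrite Normc.normcM ler_wpM2r ?normc_ge0//.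
exact: ck.2.
Qed.

Let ker_Im k : bounded_kernel k -> kernel_le g (@kernel_bound R) (fun z w => Im (k z w * f w)).
Proof.
move=> ck; split; first by have [] := cmeas_kf ck.
move=> z w Hz Hw; apply: le_trans (normc_Im _) _; rewrite Normc.normcM ler_wpM2r ?normc_ge0//.
exact: ck.2.
Qed.

Lemma kernel_op_cintegrable k z : bounded_kernel k -> H z -> cintegrable H (fun w => k z w * f w).
Proof.
by move=> ck Hz; split; [exact: (pint_integrable fi (ker_Re ck) Hz)|exact: (pint_integrable fi (ker_Im ck) Hz)].
Qed.

Lemma kernel_op_locint k : bounded_kernel k -> clocally_integrable H (kernel_op k).
Proof.
move=> ck; have kR := ker_Re ck; have kI := ker_Im ck.
have mT : cmeasurable H (kernel_op k).
  by split; [exact: (pint_measurable g0 mg fi mbeta kR)|exact: (pint_measurable g0 mg fi mbeta kI)].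
split => // K cK KH; have [M M0 hM] := kernel_bound_bounded cK KH.
have mK : measurable (K : set (mC2 R)) by exact: compact_measurableC2.
have G0 := mass_ge0 g0.
apply: (@le_lt_trans _ _ (\int[@dV R]_(z in K) (2 * (M * mass g))%:E)%E).
  apply: ge0_le_integral => //.
  - by move=> z _; rewrite lee_fin normc_ge0.
  - apply/measurable_EFinP; under eq_fun do rewrite normc_sqrt.
    apply: (measurableT_comp (continuous_measurable_fun (@sqrt_continuous R))).
    have [m1 m2] := mT.
    by apply: measurable_funD; apply: measurable_funX; apply: (@measurable_funS _ _ (mC2 R) R H).
  - move=> z Kz; rewrite lee_fin; apply: le_trans (normc_le_ReIm _) _.
    have Hz := KH _ Kz; have h1 := pint_le fi kR Hz; have h2 := pint_le fi kI Hz.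
    have h3 := ler_wpM2r G0 (hM z Kz).
    rewrite mulr2n mulrDl mul1r; apply: lerD; [exact: le_trans h1 h3|exact: le_trans h2 h3].
rewrite integral_cst//; apply: lte_mul_pinfty => //; last exact: dV_compact_lty.
by rewrite lee_fin mulr_ge0// mulr_ge0.
Qed.

(** Differentiation under the integral sign, in the weak sense: for fixed w
    the kernel is smooth in z and can be integrated by parts. *)
Lemma kernel_op_weak k l (j : 'I_4) (a : 'I_4 -> nat) : (forall i, a i = (i == j)) -> bounded_kernel k -> bounded_kernel l ->
  (forall w, H w -> elemC H (fun z => k z w)) ->
  (forall z w, H z -> H w -> is_deriveC (dir R j) (fun z => k z w) z (l z w)) ->
  is_weak_partial H a (kernel_op k) (kernel_op l).
Proof.
move=> aj ck cl sarg dk; split; [exact: kernel_op_locint|exact: kernel_op_locint|].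
move=> phi tphi; have [-> ->] := multi_partial1 phi aj.
have sF w : H w -> elemC H (fun z => k z w * f w).
  by move=> Hw; apply: elemC_mul; [exact: sarg|exact: elemC_cst].
have dF z w : H z -> H w -> is_deriveC (dir R j) (fun z => k z w * f w) z (l z w * f w).
  move=> Hz Hw; apply: is_deriveC_eq (is_deriveC_mul (dk z w Hz Hw) (is_deriveC_cst _ (f w) z)) _.
  by rewrite mulr0 add0r mulrC.
have ibp (F F' : C2 R -> R) : elem H F -> (forall z, H z -> is_derive z (dir R j) F (F' z)) ->
    (\int[@dV R]_(z in H) (F z * partial j phi z + F' z * phi z)%:E = 0)%E.
  move=> sF' dF'; have [i1 i2 i0] := integral_by_parts (@hartogs_open R) sF' dF' tphi.
  by rewrite -i0 -integralD.
have fin (P Q : C2 R -> C2 R -> R) : kernel_le g (@kernel_bound R) P -> kernel_le g (@kernel_bound R) Q ->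
    (forall w, H w -> elem H (fun z => P z w)) ->
    (forall z w, H z -> H w -> is_derive z (dir R j) (fun z => P z w) (Q z w)) ->
    (\int[@dV R]_(z in H) (pint P z * partial j phi z) = - \int[@dV R]_(z in H) (pint Q z * phi z))%R.
  move=> kP kQ sP dP.
  have [i1 i2 i0] := pint_weak g0 mg fi (@kernel_bound_bounded R) kP kQ tphi
    (fun w Hw => ibp _ _ (sP w Hw) (fun z Hz => dP z w Hz Hw)).
  have f1 : (\int[@dV R]_(z in H) (pint P z * partial j phi z)%:E)%E \is a fin_num by exact: integrable_fin_num.
  have f2 : (\int[@dV R]_(z in H) (pint Q z * phi z)%:E)%E \is a fin_num by exact: integrable_fin_num.
  apply/eqP; rewrite -addr_eq0; apply/eqP; apply: EFin_inj.
  by rewrite EFinD !fineK.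
rewrite expr1 mulN1r; apply/eqP; rewrite eq_complex; apply/andP; split; apply/eqP => /=.
- under eq_Rintegral do rewrite mulr0 subr0.
  under [in RHS]eq_Rintegral do rewrite mulr0 subr0.
  apply: fin; [exact: ker_Re|exact: ker_Re| |].
  + by move=> w Hw; have [] := sF w Hw.
  + by move=> z w Hz Hw; have [] := dF z w Hz Hw.
- under eq_Rintegral do rewrite mulr0 add0r.
  under [in RHS]eq_Rintegral do rewrite mulr0 add0r.
  apply: fin; [exact: ker_Im|exact: ker_Im| |].
  + by move=> w Hw; have [] := sF w Hw.
  + by move=> z w Hz Hw; have [] := dF z w Hz Hw.
Qed.

End complex_operators.

(** * Integration by parts along rotations *)

Section complex_integrals.
Variable R : realType.
Local Notation H := (@hartogs R).
Local Notation nm := (@Normc.normc R).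
Local Notation Re := (@complex.Re R).
Local Notation Im := (@complex.Im R).
Implicit Types (F G : C2 R -> R[i]).

Let mH : measurable (H : set (mC2 R)) := @measurable_hartogs R.

Lemma cintegrable_le F (G : C2 R -> R) : cmeas (F : mC2 R -> R[i]) ->
  (@dV R).-integrable (H : set (mC2 R)) (EFin \o G) ->
  (forall w, H w -> nm (F w) <= G w) -> cintegrable H F.
Proof.
move=> [m1 m2] iG FG.
split; apply: (@le_integrable _ (mC2 R) R (@dV R) H mH _ (EFin \o G)) => //;
  try (by apply/measurable_EFinP; exact: measurable_funTS);
  move=> w Hw; rewrite lee_fin (le_trans _ (ler_norm _))// (le_trans _ (FG w Hw))//.
- exact: normc_Re.
- exact: normc_Im.
Qed.

Lemma cintegrableD F G : cintegrable H F -> cintegrable H G -> cintegrable H (fun w => F w + G w).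
Proof.
move=> [f1 f2] [g1 g2]; split.
- under eq_fun do rewrite ReD EFinD; exact: (integrableD mH f1 g1).
- under eq_fun do rewrite ImD EFinD; exact: (integrableD mH f2 g2).
Qed.

Lemma cintegralD F G : cintegrable H F -> cintegrable H G ->
  cintegral H (fun w => F w + G w) = cintegral H F + cintegral H G.
Proof.
move=> [f1 f2] [g1 g2]; rewrite /cintegral.
under eq_Rintegral do rewrite ReD.
under [X in _ +i* X]eq_Rintegral do rewrite ImD.
by rewrite !RintegralD.
Qed.

Lemma cintegrableZ (c : R[i]) F : cintegrable H F -> cintegrable H (fun w => c * F w).
Proof.
move=> [f1 f2]; split.
- under eq_fun do rewrite ReM EFinB !EFinM.
  by apply: (integrableB mH); exact: integrableZl.
- under eq_fun do rewrite ImM EFinD !EFinM.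
  by apply: (integrableD mH); exact: integrableZl.
Qed.

Lemma cintegralZ (c : R[i]) F : cintegrable H F -> cintegral H (fun w => c * F w) = c * cintegral H F.
Proof.
move=> [f1 f2]; rewrite /cintegral.
have z r (h : C2 R -> R) : (@dV R).-integrable (H : set (mC2 R)) (EFin \o h) ->
    (@dV R).-integrable (H : set (mC2 R)) (EFin \o (fun w => r * h w)).
  by move=> ih; exact: (@integrableZl _ (mC2 R) R (@dV R) H mH r (EFin \o h)).
under eq_Rintegral do rewrite ReM.
under [X in _ +i* X]eq_Rintegral do rewrite ImM.
rewrite RintegralB ?RintegralD ?RintegralZl//; try exact: z.
by apply/eqP; rewrite eq_complex ReM ImM /= !eqxx.
Qed.

Lemma cintegral_le F : cmeas (F : mC2 R -> R[i]) ->
  (@dV R).-integrable (H : set (mC2 R)) (fun w => (nm (F w))%:E) ->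
  ((nm (cintegral H F))%:E <= 2%:E * \int[@dV R]_(w in H) (nm (F w))%:E)%E.
Proof.
move=> mF iF; have [f1 f2] : cintegrable H F by apply: cintegrable_le iF _.
have fN : (\int[@dV R]_(w in H) (nm (F w))%:E)%E \is a fin_num by exact: integrable_fin_num.
rewrite -(fineK fN) -EFinM lee_fin; apply: le_trans (normc_le_ReIm _) _ => /=.
rewrite mulr2n mulrDl mul1r; apply: lerD; (apply: le_trans (le_normr_Rintegral _ _) _ => //;
  apply: le_Rintegral => //; first exact: (@integrable_norm _ (mC2 R) R (@dV R))).
- by move=> w _; exact: normc_Re.
- by move=> w _; exact: normc_Im.
Qed.

Lemma eq_cintegral F G : (forall w, H w -> F w = G w) -> cintegral H F = cintegral H G.
Proof.
move=> FG; rewrite /cintegral; congr (_ +i* _); apply: eq_Rintegral => w; rewrite inE => Hw;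
  by rewrite FG.
Qed.

End complex_integrals.

Section exhausting_cutoff.
Variable R : realType.
Local Notation H := (@hartogs R).
Implicit Types (w v : C2 R).

(** Cutoffs depending on |w1| and |w2| only, hence annihilated by rotations. *)
Definition cutoff (n : nat) w : R :=
  flat 0 (n.+1%:R * (1 - normsq (z2 w)) - 1) * flat 0 (n.+1%:R * (normsq (z2 w) - normsq (z1 w)) - 1).

Let f1 (n : nat) w : R := n.+1%:R * (1 - normsq (z2 w)) - 1.
Let f2 (n : nat) w : R := n.+1%:R * (normsq (z2 w) - normsq (z1 w)) - 1.

Let elem_f1 n : elem setT (f1 n).
Proof.
apply: elem_sub; last exact: elem_cst.
apply: elem_mul; first exact: elem_cst.
by apply: elem_sub; [exact: elem_cst|apply: elem_normsq; exact: elemC_z2].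
Qed.

Let elem_f2 n : elem setT (f2 n).
Proof.
apply: elem_sub; last exact: elem_cst.
apply: elem_mul; first exact: elem_cst.
by apply: elem_sub; apply: elem_normsq; [exact: elemC_z2|exact: elemC_z1].
Qed.

Lemma elem_cutoff n : elem setT (cutoff n).
Proof. by apply: elem_mul; apply: elem_flat; [exact: elem_f1|exact: elem_f2]. Qed.

Lemma cutoff_ge0 n w : 0 <= cutoff n w.
Proof. by rewrite mulr_ge0// flat_ge0. Qed.

Lemma cutoff_le1 n w : cutoff n w <= 1.
Proof. by rewrite mulr_ile1// ?flat_ge0// flat0_le1. Qed.

Lemma cutoff_cvg w : H w -> cutoff n w @[n --> \oo] --> (1 : R).
Proof.
move=> /hartogsE[h1 h2]; rewrite -[X in _ --> X]mulr1; apply: cvgM.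
  by have := @flat_cvg R (1 - normsq (z2 w)); rewrite subr_gt0 h2.
by have := @flat_cvg R (normsq (z2 w) - normsq (z1 w)); rewrite subr_gt0 h1.
Qed.

(** The support lies where 1 - |w2|^2 and |w2|^2 - |w1|^2 are at least
    1/(n+1). *)
Lemma cutoff_support n : exists K : set (C2 R), [/\ compact K, K `<=` H & forall w, ~ K w -> cutoff n w = 0].
Proof.
have n0 : 0 < n.+1%:R :> R by [].
exists ([set w | 0 <= f1 n w] `&` [set w | 0 <= f2 n w]).
have sub : [set w | 0 <= f1 n w] `&` [set w | 0 <= f2 n w] `<=` H.
  move=> w [/= h1 h2]; apply/hartogsE; split; rewrite -subr_gt0.
    by rewrite -(pmulr_rgt0 _ n0); move: h2; rewrite /f2; lra.
  by rewrite -(pmulr_rgt0 _ n0); move: h1; rewrite /f1; lra.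
have cl (F : C2 R -> R) : elem setT F -> closed [set w | 0 <= F w].
  move=> sF; rewrite (_ : [set w | _] = F @^-1` [set x | 0 <= x]) //.
  by apply: closed_comp; [move=> w _; exact: (elem_continuous sF)|exact: closed_ge].
split => //.
- apply: (@subclosed_compact _ _ (cbox (fun=> -1) (fun=> 1))).
  + by apply: closedI; apply: cl; [exact: elem_f1|exact: elem_f2].
  + exact: compact_cbox.
  + move=> w /sub /hartogsE[h1 h2].
    have n1 := normc_lt1 (lt_trans h1 h2); have n2 := normc_lt1 h2.
    by apply: ord4P; rewrite -ler_norml;
      [exact: le_trans (normc_Re (z1 w)) (ltW n1)|exact: le_trans (normc_Im (z1 w)) (ltW n1)
      |exact: le_trans (normc_Re (z2 w)) (ltW n2)|exact: le_trans (normc_Im (z2 w)) (ltW n2)].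
- move=> w /not_andP[/negP|/negP]; rewrite -ltNge => h.
    by rewrite /cutoff flat_le0 ?mul0r// ltW.
  by rewrite /cutoff [X in _ * X]flat_le0 ?mulr0// ltW.
Qed.

Lemma is_derive_normsq v (F : C2 R -> R[i]) w d : is_deriveC v F w d ->
  is_derive w v (fun w => normsq (F w)) (2 * (complex.Re (F w) * complex.Re d + complex.Im (F w) * complex.Im d)).
Proof.
move=> [d1 d2]; rewrite /normsq.
under eq_fun do rewrite !expr2.
apply: (is_derive_eq (is_deriveD (is_deriveM d1 d1) (is_deriveM d2 d2))).
by rewrite /GRing.scale/=; ring.
Qed.

(** The derivative in each complex coordinate is radial. *)
Lemma cutoff_derive n w : exists a b : R, forall v, is_derive w v (cutoff n)
  (a * (crd o0 w * crd o0 v + crd o1 w * crd o1 v) + b * (crd o2 w * crd o2 v + crd o3 w * crd o3 v)).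
Proof.
pose F' (x : R) := - 0%:R * flat 1 x + flat 2 x.
exists (cutoff n w * 0 + flat 0 (f1 n w) * F' (f2 n w) * (- 2 * n.+1%:R)).
exists (flat 0 (f1 n w) * F' (f2 n w) * (2 * n.+1%:R) + flat 0 (f2 n w) * F' (f1 n w) * (- 2 * n.+1%:R)).
move=> v.
have e1 := is_derive_normsq (is_deriveC_z1 v w); have e2 := is_derive_normsq (is_deriveC_z2 v w).
have c (c : R) : is_derive w v (fun _ : C2 R => c) 0 by exact: is_derive_cst.
have g1 := is_deriveB (is_deriveM (c n.+1%:R) (is_deriveB (c 1) e2)) (c 1).
have g2 := is_deriveB (is_deriveM (c n.+1%:R) (is_deriveB e2 e1)) (c 1).
have h1 := is_derive_chain (is_derive_flat 0 (f1 n w)) g1.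
have h2 := is_derive_chain (is_derive_flat 0 (f2 n w)) g2.
apply: (is_derive_eq (is_deriveM h1 h2)).
rewrite /GRing.scale/= /F' /crd /=; ring.
Qed.

End exhausting_cutoff.

Section rotation.
Variable R : realType.
Local Notation H := (@hartogs R).
Local Notation nm := (@Normc.normc R).
Local Notation Re := (@complex.Re R).
Local Notation Im := (@complex.Im R).
Implicit Types (w v : C2 R) (f g : C2 R -> R[i]).

Let mH : measurable (H : set (mC2 R)) := @measurable_hartogs R.
Let I : R[i] := 0 +i* 1.

Definition cL1 f := cmeas (f : mC2 R -> R[i]) /\
  (@dV R).-integrable (H : set (mC2 R)) (fun w => (nm (f w))%:E).

Definition cpartial (j : 'I_4) f w : R[i] :=
  partial j (fun w => Re (f w)) w +i* partial j (fun w => Im (f w)) w.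

Definition ctest f := test_function H (fun w => Re (f w)) /\ test_function H (fun w => Im (f w)).

Lemma cpartial_is_deriveC j f w d : is_deriveC (dir R j) f w d -> cpartial j f w = d.
Proof.
by move=> [d1 d2]; rewrite /cpartial /partial (@derive_val _ _ _ _ _ _ _ d1) (@derive_val _ _ _ _ _ _ _ d2); case: d {d1 d2}.
Qed.

Lemma cintegrable_test f (K : set (C2 R)) (psi : C2 R -> R) : cL1 f -> compact K -> continuous psi ->
  (forall w, ~ K w -> psi w = 0) -> cintegrable H (fun w => f w * (psi w)%:C).
Proof.
move=> [mf fi] cK cpsi out.
have [C [_ hC]] : bounded_set (psi @` K).
  by apply: compact_bounded; apply: continuous_compact => //; exact: continuous_subspaceT.
have bd w : `|psi w| <= `|C| + 1.
  have [Kw|Kw] := pselect (K w); last by rewrite out// normr0.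
  apply: (hC (`|C| + 1)); last by exists w.
  by rewrite (le_lt_trans (ler_norm C))// ltrDl.
apply: (@cintegrable_le R _ (fun w => (`|C| + 1) * nm (f w))).
- by apply: cmeasM => //; apply: cmeas_real; exact: continuous_measurableC2.
- exact: (@integrableZl _ (mC2 R) R (@dV R) H mH _ (fun w => (nm (f w))%:E)).
- move=> w _; rewrite Normc.normcM mulrC ler_wpM2r ?normc_ge0//.
  by rewrite normc_sqrt /normsq/= expr0n addr0 sqrtr_sqr.
Qed.

(** Test functions are real; complex ones are handled by linearity. *)
Lemma weak_pairing f g a j Phi : is_weak_partial H a f g -> (forall i, a i = (i == j)) ->
  cL1 f -> cL1 g -> ctest Phi ->
  [/\ cintegrable H (fun w => f w * cpartial j Phi w),
      cintegrable H (fun w => g w * Phi w) &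
      cintegral H (fun w => f w * cpartial j Phi w) = - cintegral H (fun w => g w * Phi w)].
Proof.
move=> [_ _ wp] aj cf cg [t1 t2].
have part phi : test_function H phi ->
    [/\ cintegrable H (fun w => f w * (partial j phi w)%:C),
        cintegrable H (fun w => g w * (phi w)%:C) &
        cintegral H (fun w => f w * (partial j phi w)%:C) = - cintegral H (fun w => g w * (phi w)%:C)].
  move=> tphi; have [K [cK KH out outp]] := test_function_partial_out tphi.
  have [sphi _] := tphi; split.
  - exact: (cintegrable_test cf cK (sphi [:: j]).1 (outp j)).
  - exact: (cintegrable_test cg cK (sphi [::]).1 out).
  - by have := wp phi tphi; have [-> ->] := multi_partial1 phi aj; rewrite expr1 mulN1r.
have [a1 b1 c1] := part _ t1; have [a2 b2 c2] := part _ t2.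
have E (h : C2 R -> R[i]) (p q : C2 R -> R) w :
    h w * (p w +i* q w) = h w * (p w)%:C + I * (h w * (q w)%:C).
  by rewrite /I; case: (h w) => x y; apply/eqP; rewrite eq_complex /=; apply/andP; split; apply/eqP; ring.
have Ef : (fun w => f w * cpartial j Phi w) = (fun w => f w * (partial j (fun w => Re (Phi w)) w)%:C +
    I * (f w * (partial j (fun w => Im (Phi w)) w)%:C)).
  by apply/funext => w; rewrite /cpartial E.
have Eg : (fun w => g w * Phi w) = (fun w => g w * (Re (Phi w))%:C + I * (g w * (Im (Phi w))%:C)).
  by apply/funext => w; rewrite -(E g (fun w => Re (Phi w)) (fun w => Im (Phi w))) /=; case: (Phi w).
rewrite Ef Eg; split.
- by apply: cintegrableD => //; exact: cintegrableZ.
- by apply: cintegrableD => //; exact: cintegrableZ.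
- rewrite !cintegralD ?cintegralZ//; try exact: cintegrableZ.
  by rewrite c1 c2 mulrN opprD.
Qed.

Lemma cintegral_cutoff f : cL1 f ->
  ccvg (fun n => cintegral H (fun w => f w * (cutoff n w)%:C)) (cintegral H f).
Proof.
move=> [mf fi].
have dct (u : C2 R -> R) : measurable_fun (setT : set (mC2 R)) u ->
    (@dV R).-integrable (H : set (mC2 R)) (EFin \o u) ->
    (\int[@dV R]_(w in H) (u w * cutoff n w))%R @[n --> \oo] --> (\int[@dV R]_(w in H) u w)%R.
  move=> mu iu; apply: fine_cvg; rewrite fineK; last by apply: integrable_fin_num.
  have mc n : measurable_fun (setT : set (mC2 R)) (cutoff n).
    by apply: continuous_measurableC2 => z; apply: (elem_continuous (elem_cutoff R n)).
  have m1 n : measurable_fun (H : set (mC2 R)) (fun w => (u w * cutoff n w)%:E).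
    by apply: measurable_funTS; apply/measurable_EFinP; exact: measurable_funM.
  have m2 : measurable_fun (H : set (mC2 R)) (fun w => (u w)%:E).
    by apply: measurable_funTS; apply/measurable_EFinP.
  have cv : forall x : mC2 R, H x -> (u x * cutoff n x)%:E @[n --> \oo] --> (u x)%:E.
    move=> w Hw; apply: cvg_EFin; first by apply: nearW.
    by rewrite -[X in _ --> X]mulr1; apply: cvgM; [exact: cvg_cst|exact: cutoff_cvg].
  have bd : forall (x : mC2 R) n, H x -> (`|(u x * cutoff n x)%:E| <= `|(u x)%:E|)%E.
    move=> w n _; rewrite /= lee_fin normrM ler_piMr//.
    by rewrite ger0_norm ?cutoff_ge0// cutoff_le1.
  have [_ _] := @dominated_convergence _ _ _ (@dV R) H mH
    (fun n w => (u w * cutoff n w)%:E) (fun w => (u w)%:E) (fun w => `|(u w)%:E|)%E m1 m2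
    (aeW (@dV R) cv) (integrable_abse iu) (aeW (@dV R) bd).
  by [].
have [i1 i2] : cintegrable H f by apply: cintegrable_le fi _.
split => /=.
- under eq_fun do under eq_Rintegral do rewrite ReM /= mulr0 subr0.
  by apply: dct => //; exact: mf.1.
- under eq_fun do under eq_Rintegral do rewrite ImM /= mulr0 add0r.
  by apply: dct => //; exact: mf.2.
Qed.

Lemma ccvg_unique (u : nat -> R[i]) a b : ccvg u a -> ccvg u b -> a = b.
Proof.
move=> [a1 a2] [b1 b2]; apply/eqP; rewrite eq_complex; apply/andP; split; apply/eqP.
- exact: (cvg_unique _ a1 b1).
- exact: (cvg_unique _ a2 b2).
Qed.

(** The derivative along the rotation field of M times a rotation invariant
    cutoff c; cx and cy are the partial derivatives of the cutoff. *)
Lemma rotation_algebra (i M x y e c cx cy h : R[i]) : i * i = -1 -> x * cy = y * cx ->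
  i * ((x - i * y) * e * h) * c =
  -1 * (h * (M * (x * cy + c * 0) + x * c * (- i * e))) + h * (M * (y * cx + c * 0) + y * c * e).
Proof.
move=> i2 xy; apply/eqP; rewrite -subr_eq0.
rewrite (_ : _ - _ = - (i * i + 1) * (y * e * h * c) + h * M * (x * cy - y * cx)); last by ring.
by rewrite i2 xy addNr subrr oppr0 mul0r mulr0 addr0.
Qed.

(** Apply the weak derivatives of f to the test functions M x c and M y c,
    with c a rotation invariant cutoff, and subtract: the derivatives of c
    cancel. Dominated convergence removes the cutoff. *)
Lemma rotation_by_parts f gx gy (ax ay : 'I_4 -> nat) (jx jy : 'I_4) (M D : C2 R -> R[i]) (B : R) :
  (jx, jy) = (o0, o1) \/ (jx, jy) = (o2, o3) ->
  is_weak_partial H ax f gx -> (forall i, ax i = (i == jx)) ->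
  is_weak_partial H ay f gy -> (forall i, ay i = (i == jy)) ->
  cL1 f -> cL1 gx -> cL1 gy ->
  cmeas (M : mC2 R -> R[i]) -> cmeas (D : mC2 R -> R[i]) -> elemC H M ->
  (forall w, H w -> nm (M w) <= B) -> (forall w, H w -> nm (D w) <= B) ->
  (forall w, H w -> exists2 e, is_deriveC (dir R jx) M w e /\ is_deriveC (dir R jy) M w (I^*%C * e) &
     ((crd jx w)%:C - I * (crd jy w)%:C) * e = D w) ->
  I * cintegral H (fun w => D w * f w) =
  cintegral H (fun w => M w * ((crd jx w)%:C * gy w - (crd jy w)%:C * gx w)).
Proof.
move=> jxy wx axE wy ayE cf cgx cgy mM mD sM Mb Db hM.
have [mf fi] := cf; have [mgx gxi] := cgx; have [mgy gyi] := cgy.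
have crdM j : elemC H (fun w => (crd j w)%:C).
  by split => /=; [exact: elem_crd|exact: elem_cst].
have crd1 j w : H w -> nm (crd j w)%:C <= 1.
  move=> /hartogsE[h1 h2]; rewrite normc_sqrt /normsq/= expr0n addr0 sqrtr_sqr.
  have n1 := normc_lt1 (lt_trans h1 h2); have n2 := normc_lt1 h2.
  by move: j; apply: ord4P;
      [exact: le_trans (normc_Re (z1 w)) (ltW n1)|exact: le_trans (normc_Im (z1 w)) (ltW n1)
      |exact: le_trans (normc_Re (z2 w)) (ltW n2)|exact: le_trans (normc_Im (z2 w)) (ltW n2)].
have mcrd j : cmeas (fun w : mC2 R => (crd j w)%:C) by apply: cmeas_real; exact: measurable_crd.
have cP : cL1 (fun w => M w * ((crd jx w)%:C * gy w - (crd jy w)%:C * gx w)).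
  split; first by apply: cmeasM => //; apply: cmeasB; exact: cmeasM.
  apply: (@le_integrable _ (mC2 R) R (@dV R) H mH _ (fun w => (B * (nm (gy w) + nm (gx w)))%:E)).
  - apply/measurable_EFinP; apply: measurable_funTS; apply: cmeas_normc.
    by apply: cmeasM => //; apply: cmeasB; exact: cmeasM.
  - move=> w Hw; rewrite !abse_EFin lee_fin ger0_norm ?normc_ge0// (le_trans _ (ler_norm _))//.
    rewrite Normc.normcM; apply: ler_pM; rewrite ?normc_ge0//; first exact: Mb.
    apply: le_trans (le_normcD _ _) _; rewrite normc_opp !Normc.normcM.
    by apply: lerD; rewrite ler_piMl ?normc_ge0// crd1.
  - under eq_fun do rewrite EFinM EFinD.
    by apply: (@integrableZl _ (mC2 R) R (@dV R)) => //; exact: (integrableD mH gyi gxi).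
have cQ : cL1 (fun w => I * (D w * f w)).
  split; first by apply: cmeasM; [exact: cmeas_cst|exact: cmeasM].
  apply: (@le_integrable _ (mC2 R) R (@dV R) H mH _ (fun w => (B * nm (f w))%:E)).
  - apply/measurable_EFinP; apply: measurable_funTS; apply: cmeas_normc.
    by apply: cmeasM; [exact: cmeas_cst|exact: cmeasM].
  - move=> w Hw; rewrite !abse_EFin lee_fin ger0_norm ?normc_ge0// (le_trans _ (ler_norm _))//.
    have nI : nm I = 1 by rewrite normc_sqrt /normsq/= expr0n add0r expr1n sqrtr1.
    by rewrite !Normc.normcM nI mul1r ler_wpM2r ?normc_ge0// Db.
  - under eq_fun do rewrite EFinM.
    exact: (@integrableZl _ (mC2 R) R (@dV R)).
rewrite -cintegralZ; last first.
  have [m1 i1] := cQ.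
  apply: (@cintegrable_le R _ (fun w => B * nm (f w))); first exact: cmeasM.
    exact: (@integrableZl _ (mC2 R) R (@dV R) H mH B (fun w => (nm (f w))%:E)).
  by move=> w Hw; rewrite Normc.normcM ler_wpM2r ?normc_ge0// Db.
apply: (@ccvg_unique _ _ _ (cintegral_cutoff cQ)).
rewrite (_ : (fun n => _) = (fun n => cintegral H (fun w => M w * ((crd jx w)%:C * gy w - (crd jy w)%:C * gx w) * (cutoff n w)%:C))).
  exact: cintegral_cutoff.
apply/funext => n; have [K [cK KH out]] := @cutoff_support R n.
pose Phi j w := M w * ((crd j w)%:C * (cutoff n w)%:C).
have tPhi j : ctest (Phi j).
  have [s1 s2] : elemC H (fun w => M w * (crd j w)%:C) by exact: elemC_mul.
  split.
  - rewrite (_ : (fun w => _) = (fun w => Re (M w * (crd j w)%:C) * cutoff n w)).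
      exact: (elem_test_function (@hartogs_open R) cK KH s1 (elem_cutoff R n) out).
    by apply/funext => w; rewrite /Phi mulrA [LHS]ReM /= mulr0 subr0.
  - rewrite (_ : (fun w => _) = (fun w => Im (M w * (crd j w)%:C) * cutoff n w)).
      exact: (elem_test_function (@hartogs_open R) cK KH s2 (elem_cutoff R n) out).
    by apply/funext => w; rewrite /Phi mulrA [LHS]ImM /= mulr0 add0r.
have [x1 x2 x3] := weak_pairing wx axE cf cgx (tPhi jy).
have [y1 y2 y3] := weak_pairing wy ayE cf cgy (tPhi jx).
transitivity (- cintegral H (fun w => f w * cpartial jy (Phi jx) w) +
    cintegral H (fun w => f w * cpartial jx (Phi jy) w)); last first.
  rewrite x3 y3 opprK -[X in _ - X]mul1r -mulNr -cintegralZ// -cintegralD//; last exact: cintegrableZ.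
  by apply: eq_cintegral => w _; rewrite /Phi; ring.
rewrite -[X in - X + _]mul1r -mulNr -cintegralZ// -cintegralD//; last exact: cintegrableZ.
apply: eq_cintegral => w Hw.
have [e [dx dy] De] := hM w Hw.
have [a [b dchi]] := cutoff_derive n w.
pose cd j := a * (crd o0 w * crd o0 (dir R j) + crd o1 w * crd o1 (dir R j)) +
  b * (crd o2 w * crd o2 (dir R j) + crd o3 w * crd o3 (dir R j)).
have dc j : is_deriveC (dir R j) (fun w => (cutoff n w)%:C) w (cd j)%:C.
  by split => /=; [exact: dchi|exact: is_derive_cst].
have dcrd i j : crd i (dir R j) = 0 -> is_deriveC (dir R j) (fun w => (crd i w)%:C) w 0.
  move=> c0; split => /=; last exact: is_derive_cst.
  by rewrite -[X in is_derive _ _ _ X]c0; exact: is_derive_crd.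
have [c1 c2 rot] : [/\ crd jx (dir R jy) = 0, crd jy (dir R jx) = 0 &
    crd jx w * cd jy = crd jy w * cd jx].
  case: jxy => -[-> ->]; split=> //; rewrite /cd /dir /crd /=; ring.
rewrite (cpartial_is_deriveC (is_deriveC_mul dy (is_deriveC_mul (dcrd _ _ c1) (dc jy)))).
rewrite (cpartial_is_deriveC (is_deriveC_mul dx (is_deriveC_mul (dcrd _ _ c2) (dc jx)))).
rewrite -De.
have IE : I^*%C = - I by apply/eqP; rewrite eq_complex /= oppr0 !eqxx.
have I2 : I * I = -1.
  by apply/eqP; rewrite eq_complex /=; apply/andP; split; apply/eqP; ring.
rewrite IE; apply: rotation_algebra => //.
by rewrite -!rmorphM rot.
Qed.

End rotation.

(** * Weak derivatives as classes of functions *)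

Section sobolev_tools.
Variable R : realType.
Local Notation H := (@hartogs R).
Local Notation nm := (@Normc.normc R).
Local Notation Re := (@complex.Re R).
Local Notation Im := (@complex.Im R).
Implicit Types (f g : C2 R -> R[i]).

Let mH : measurable (H : set (mC2 R)) := @measurable_hartogs R.

(** Extension by 0, to work with functions that are measurable on the whole
    space. *)
Definition restrictH f w : R[i] := if w \in H then f w else 0.

Lemma restrictHE f w : H w -> restrictH f w = f w.
Proof. by move=> Hw; rewrite /restrictH mem_set. Qed.

Lemma cmeas_restrictH f : cmeasurable H f -> cmeas (restrictH f : mC2 R -> R[i]).
Proof.
move=> [m1 m2]; split.
- rewrite (_ : (fun w => _) = (fun w => Re (f w)) \_ H); last first.
    by apply/funext => w; rewrite patchE /restrictH; case: ifP.
  exact: (measurable_restrictT _ mH).1.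
- rewrite (_ : (fun w => _) = (fun w => Im (f w)) \_ H); last first.
    by apply/funext => w; rewrite patchE /restrictH; case: ifP.
  exact: (measurable_restrictT _ mH).1.
Qed.

Lemma cmeasurable_ext f f' : (forall w, H w -> f w = f' w) -> cmeasurable H f -> cmeasurable H f'.
Proof.
move=> E [m1 m2]; split.
- by apply: eq_measurable_fun m1 => w; rewrite inE => /E ->.
- by apply: eq_measurable_fun m2 => w; rewrite inE => /E ->.
Qed.

Lemma clocally_integrable_ext f f' : (forall w, H w -> f w = f' w) ->
  clocally_integrable H f -> clocally_integrable H f'.
Proof.
move=> E [m l]; split; first exact: cmeasurable_ext E m.
move=> K cK KH; have := l K cK KH; congr (_ < _)%E.
by apply: eq_integral => w; rewrite inE => /KH /E ->.
Qed.

Lemma is_weak_partial_ext a f g f' g' : (forall w, H w -> f w = f' w) ->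
  (forall w, H w -> g w = g' w) -> is_weak_partial H a f g -> is_weak_partial H a f' g'.
Proof.
move=> Ef Eg [lf lg wp]; split.
- exact: clocally_integrable_ext Ef lf.
- exact: clocally_integrable_ext Eg lg.
- move=> phi tphi.
  rewrite -(eq_cintegral (fun w Hw => congr1 (fun c => c * (multi_partial a phi w)%:C) (Ef w Hw))).
  rewrite -(eq_cintegral (fun w Hw => congr1 (fun c => c * (phi w)%:C) (Eg w Hw))).
  exact: wp.
Qed.

Lemma measurable_normcH f : cmeasurable H f -> measurable_fun (H : set (mC2 R)) (fun w => nm (f w)).
Proof.
move=> [m1 m2]; under eq_fun do rewrite normc_sqrt.
apply: (measurableT_comp (continuous_measurable_fun (@sqrt_continuous R))).
by apply: measurable_funD; apply: measurable_funX.
Qed.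

Lemma locally_integrable_parts f (P : C2 R -> R) : clocally_integrable H f ->
  measurable_fun (setT : set (mC2 R)) P -> (forall w, H w -> `|P w| <= nm (f w)) ->
  forall K : set (C2 R), compact K -> K `<=` H -> (@dV R).-integrable (K : set (mC2 R)) (EFin \o P).
Proof.
move=> [m l] mP Pf K cK KH; apply/integrableP; split.
  by apply: measurable_funTS; exact/measurable_EFinP.
apply: le_lt_trans (l K cK KH); apply: ge0_le_integral => //.
- exact: compact_measurableC2.
- by apply: measurable_funTS; apply: measurableT_comp => //; exact/measurable_EFinP.
- apply/measurable_EFinP; apply: measurable_funS KH _ => //; exact: measurable_normcH.
- by move=> w Kw; rewrite lee_fin Pf//; exact: KH.
Qed.

(** The difference of two weak derivatives is orthogonal to all test
    functions. *)
Lemma weak_partial_ae a f g g' : is_weak_partial H a f g -> is_weak_partial H a f g' ->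
  \forall w \ae @dV R, H w -> g w = g' w.
Proof.
move=> [_ lg wg] [_ lg' wg'].
have eqs phi : test_function H phi ->
    cintegral H (fun w => g w * (phi w)%:C) = cintegral H (fun w => g' w * (phi w)%:C).
  move=> tphi; apply: (@mulfI _ ((-1) ^+ mi_order a)); first by rewrite signr_eq0.
  by rewrite -(wg phi tphi) (wg' phi tphi).
have main (p : R[i] -> R) :
    (forall F : C2 R -> R[i], cmeas (F : mC2 R -> R[i]) -> measurable_fun (setT : set (mC2 R)) (fun w => p (F w))) ->
    (forall c, `|p c| <= nm c) ->
    (forall phi, test_function H phi ->
      (\int[@dV R]_(w in H) (p (g w) * phi w) = \int[@dV R]_(w in H) (p (g' w) * phi w))%R) ->
    \forall w \ae @dV R, H w -> p (g w) = p (g' w).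
  move=> mp pn peq.
  have m1 := mp _ (cmeas_restrictH lg.1); have m2 := mp _ (cmeas_restrictH lg'.1).
  have b f0 w : H w -> `|p (restrictH f0 w)| <= nm (f0 w) by move=> Hw; rewrite restrictHE.
  have l1 := locally_integrable_parts lg m1 (fun w => @b g w).
  have l2 := locally_integrable_parts lg' m2 (fun w => @b g' w).
  have li (P : C2 R -> R) phi : measurable_fun (setT : set (mC2 R)) P ->
      (forall K : set (C2 R), compact K -> K `<=` H -> (@dV R).-integrable (K : set (mC2 R)) (EFin \o P)) ->
      test_function H phi -> (@dV R).-integrable (H : set (mC2 R)) (EFin \o (fun w => P w * phi w)).
    move=> mP lP [sphi [K [cK KH out]]].
    have cphi : continuous phi := (sphi [::]).1.
    have mphi := continuous_measurableC2 cphi.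
    have [C [_ hC]] : bounded_set (phi @` K).
      by apply: compact_bounded; apply: continuous_compact => //; exact: continuous_subspaceT.
    have mK : measurable (K : set (mC2 R)) by exact: compact_measurableC2.
    have mPphi : measurable_fun (setT : set (mC2 R)) (fun w => P w * phi w) by exact: measurable_funM.
    have iK : (@dV R).-integrable (K : set (mC2 R)) (fun w => (`|C| + 1)%:E * (P w)%:E)%E.
      by apply: (@integrableZl _ (mC2 R) R (@dV R) K mK _ (EFin \o P)); exact: lP.
    have : (@dV R).-integrable (K : set (mC2 R)) (EFin \o (fun w => P w * phi w)).
      apply: (@le_integrable _ (mC2 R) R (@dV R) K mK _ (fun w => (`|C| + 1)%:E * (P w)%:E)%E) => //.
        by apply: measurable_funTS; exact/measurable_EFinP.
      move=> w Kw; rewrite -EFinM !abse_EFin lee_fin !normrM mulrC ler_wpM2r// [leRHS]ger0_norm ?addr_ge0//.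
      apply: (hC (`|C| + 1)); last by exists w.
      by rewrite (le_lt_trans (ler_norm C))// ltrDl.
    move=> /integrableP[_ fin]; apply/integrableP; split.
      by apply: measurable_funTS; exact/measurable_EFinP.
    rewrite (integral_supp (@dV R) KH)// => w _ Kw.
    by rewrite /= out// mulr0 normr0.
  have V := @vanish_hartogs R (fun w => p (restrictH g w) - p (restrictH g' w)) (measurable_funB m1 m2).
  have h1 (K : set (C2 R)) : compact K -> K `<=` H ->
      (@dV R).-integrable (K : set (mC2 R)) (EFin \o (fun w => p (restrictH g w) - p (restrictH g' w))).
    move=> cK KH; have := integrableB (compact_measurableC2 cK) (l1 K cK KH) (l2 K cK KH).
    by apply: eq_integrable => //; exact: compact_measurableC2.
  have h2 phi : test_function H phi ->
      (\int[@dV R]_(w in H) ((p (restrictH g w) - p (restrictH g' w)) * phi w)%:E = 0)%E.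
    move=> tphi; have i1 := li _ _ m1 l1 tphi; have i2 := li _ _ m2 l2 tphi.
    under eq_integral do rewrite mulrBl EFinB.
    rewrite integralB// -(fineK (integrable_fin_num mH i1)) -(fineK (integrable_fin_num mH i2)) -EFinB.
    have E (f0 : C2 R -> R[i]) : (\int[@dV R]_(w in H) (EFin \o (fun w => (p (restrictH f0 w) * phi w)%R)) w =
        \int[@dV R]_(w in H) (p (f0 w) * phi w)%:E)%E.
      by apply: eq_integral => w; rewrite inE => Hw /=; rewrite restrictHE.
    rewrite !E; have := peq phi tphi; rewrite /Rintegral => ->.
    by rewrite subrr.
  have := V h1 h2; apply: filterS => w /= hw Hw.
  by have := hw Hw => -[]; rewrite !restrictHE// => /eqP; rewrite subr_eq0 => /eqP.
have hR : \forall w \ae @dV R, H w -> Re (g w) = Re (g' w).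
  apply: main; [by move=> F []|exact: normc_Re|].
  move=> phi tphi; have := congr1 Re (eqs phi tphi) => /=.
  under eq_Rintegral do rewrite ReM /= mulr0 subr0.
  by under [in RHS]eq_Rintegral do rewrite ReM /= mulr0 subr0.
have hI : \forall w \ae @dV R, H w -> Im (g w) = Im (g' w).
  apply: main; [by move=> F []|exact: normc_Im|].
  move=> phi tphi; have := congr1 Im (eqs phi tphi) => /=.
  under eq_Rintegral do rewrite ImM /= mulr0 add0r.
  by under [in RHS]eq_Rintegral do rewrite ImM /= mulr0 add0r.
apply: (@filterS2 _ _ (ae_filter_ringOfSetsType (@dV R)) _ _ _ _ hR hI) => w h1 h2 Hw; apply/eqP; rewrite eq_complex.
by rewrite h1// h2// !eqxx.
Qed.

(** Since u <= 1 + u^p and H has finite volume. *)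
Lemma Lp_L1 (p : R) (u : C2 R -> R) : 1 < p -> (forall w, 0 <= u w) ->
  measurable_fun (H : set (mC2 R)) u -> (\int[@dV R]_(w in H) (u w `^ p)%:E < +oo)%E ->
  (@dV R).-integrable (H : set (mC2 R)) (fun w => (u w)%:E).
Proof.
move=> p1 u0 mu fin.
have mup : measurable_fun (H : set (mC2 R)) (fun w => u w `^ p).
  exact: (measurableT_comp (@measurable_powR R p) mu).
have i1 : (@dV R).-integrable (H : set (mC2 R)) (cst 1%:E).
  apply/integrableP; split; first exact: measurable_cst.
  rewrite (_ : (fun x => _) = (fun=> 1%E)); last by apply/funext => x /=; rewrite normr1.
  by rewrite integral_cst// mul1e; exact: dV_hartogs_lty.
have i2 : (@dV R).-integrable (H : set (mC2 R)) (fun w => (u w `^ p)%:E).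
  apply/integrableP; split; first exact/measurable_EFinP.
  by under eq_integral do rewrite gee0_abs ?lee_fin ?powR_ge0//.
apply: (@le_integrable _ (mC2 R) R (@dV R) H mH _ _ _ _ (integrableD mH i1 i2)).
  exact/measurable_EFinP.
move=> w _; rewrite -EFinD !abse_EFin lee_fin !ger0_norm ?addr_ge0 ?powR_ge0//.
have [h|h] := leP (u w) 1; first by rewrite (le_trans h)// lerDl powR_ge0.
apply: (@le_trans _ _ (u w `^ p)); last by rewrite lerDr.
by rewrite -[leLHS]powRr1// ler_powR// ltW.
Qed.

End sobolev_tools.

(** * Norm estimates *)

Section norm_bounds.
Variable R : realType.
Local Notation H := (@hartogs R).
Local Notation nm := (@Normc.normc R).

Let mH : measurable (H : set (mC2 R)) := @measurable_hartogs R.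

Lemma measurable_abs_kernel_integral (G : C2 R -> R) : measurable_fun (setT : set (mC2 R)) G -> (forall w, 0 <= G w) ->
  measurable_fun (setT : set (mC2 R)) (fun z => (\int[@dV R]_(w in H) (abs_kernel z w * G w)%:E)%E).
Proof.
move=> mG G0.
rewrite (_ : (fun z => _) = (fun z : mC2 R => (\int[@vol R]_w (\1_H w * (abs_kernel z w * G w))%:E)%E)); last first.
  by apply/funext => z; rewrite (integral_indicM (@dV R) H).
apply: (@measurable_fun_fubini_tonelli_F _ _ (mC2 R) (mC2 R) R (@vol R)
  (fun x : mC2 R * mC2 R => (\1_H x.2 * (abs_kernel x.1 x.2 * G x.2))%:E)).
- apply/measurable_EFinP; apply: measurable_funM.
    have m1 : measurable_fun (setT : set (mC2 R)) (\1_H : mC2 R -> R) by exact: measurable_indic.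
    exact: (measurableT_comp m1 (@measurable_snd _ _ (mC2 R) (mC2 R))).
  apply: measurable_funM; first exact: measurable_abs_kernel.
  exact: (measurableT_comp mG (@measurable_snd _ _ (mC2 R) (mC2 R))).
- by move=> x; rewrite lee_fin mulr_ge0// mulr_ge0// abs_kernel_ge0.
Qed.

(** The constant c is absorbed in G. *)
Lemma hartogs_dominated (p c : R) : 1 < p -> p < 4 -> 0 <= c -> exists2 C, 0 <= C &
  forall (F : C2 R -> R[i]) (G : C2 R -> R), cmeasurable H F ->
    measurable_fun (setT : set (mC2 R)) G -> (forall w, 0 <= G w) ->
    (forall z, H z -> ((nm (F z))%:E <= c%:E * ((normsq (z2 z) `^ (- 2^-1))%:E *
      \int[@dV R]_(w in H) (abs_kernel z w * G w)%:E))%E) ->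
    (\int[@dV R]_(z in H) (nm (F z) `^ p)%:E <= C%:E * \int[@dV R]_(w in H) (G w `^ p)%:E)%E.
Proof.
move=> p1 p4 c0; have [C C0 hC] := hartogs_schur p1 p4.
exists (C * c `^ p); first by rewrite mulr_ge0// powR_ge0.
move=> F G mF mG G0 FG.
have mcG : measurable_fun (setT : set (mC2 R)) (fun w => c * G w) by exact: measurable_funM.
have cG0 w : 0 <= c * G w by rewrite mulr_ge0.
have mGp : measurable_fun (setT : set (mC2 R)) (fun w => G w `^ p).
  exact: (measurableT_comp (@measurable_powR R p) mG).
have -> : ((C * c `^ p)%:E * \int[@dV R]_(w in H) (G w `^ p)%:E =
    C%:E * \int[@dV R]_(w in H) ((c * G w) `^ p)%:E)%E.
  rewrite EFinM -muleA; congr (_ * _)%E.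
  under [in RHS]eq_integral do rewrite powRM// EFinM.
  rewrite ge0_integralZl//.
  - by apply: measurable_funTS; exact/measurable_EFinP.
  - by move=> w _; rewrite lee_fin powR_ge0.
  - by rewrite lee_fin powR_ge0.
apply: le_trans (hC _ mcG cG0).
apply: ge0_le_integral => //.
- by move=> z _; rewrite lee_fin powR_ge0.
- apply/measurable_EFinP; apply: (measurableT_comp (@measurable_powR R p)).
  exact: measurable_normcH.
- apply: measurable_funTS; apply: (measurableT_comp (measurable_poweR p)).
  apply: emeasurable_funM; last exact: measurable_abs_kernel_integral.
  apply/measurable_EFinP; apply: (measurableT_comp (@measurable_powR R (- 2^-1))).
  by apply: cmeas_normsq; exact: cmeas_z2.
- move=> z Hz; rewrite -poweR_EFin; apply: lee_poweR.
  + lra.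
  + by rewrite lee_fin normc_ge0.
  + apply: le_trans (FG z Hz) _; rewrite muleCA lee_wpmul2l ?lee_fin ?powR_ge0//.
    rewrite -ge0_integralZl//.
    * rewrite le_eqVlt; apply/orP; left; apply/eqP; apply: eq_integral => w _.
      by rewrite -EFinM mulrCA.
    * apply: measurable_funTS; apply/measurable_EFinP; apply: measurable_funM => //.
      by apply: measurable_section; exact: measurable_abs_kernel.
    * by move=> w _; rewrite lee_fin mulr_ge0// abs_kernel_ge0.
Qed.

Lemma powRD_le (p a b : R) : 0 < p -> 0 <= a -> 0 <= b -> (a + b) `^ p <= 2 `^ p * (a `^ p + b `^ p).
Proof.
move=> p0 a0 b0.
have aux (x y : R) : 0 <= x -> x <= y -> (x + y) `^ p <= 2 `^ p * y `^ p.
  move=> x0 xy; have y0 := le_trans x0 xy.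
  rewrite -powRM//; apply: ge0_ler_powR; rewrite ?nnegrE ?addr_ge0 ?mulr_ge0 ?(ltW p0)//; lra.
have [ab|ba] := leP a b.
  by apply: le_trans (aux a b a0 ab) _; rewrite ler_wpM2l ?powR_ge0// lerDr powR_ge0.
rewrite addrC; apply: le_trans (aux b a b0 (ltW ba)) _.
by rewrite ler_wpM2l ?powR_ge0// lerDl powR_ge0.
Qed.

End norm_bounds.

Section assembly.
Variable R : realType.
Local Notation H := (@hartogs R).
Local Notation nm := (@Normc.normc R).
Implicit Types (f g : C2 R -> R[i]) (z w : C2 R).

Let mH : measurable (H : set (mC2 R)) := @measurable_hartogs R.
Let I : R[i] := 0 +i* 1.

Lemma order_le1 (a : 'I_4 -> nat) : (mi_order a <= 1)%N ->
  (forall i, a i = 0%N) \/ exists j, forall i, a i = (i == j).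
Proof.
move=> a1; have [j aj|a0] := pickP (fun i => a i != 0%N); last first.
  by left => i; have := a0 i => /negbFE /eqP.
right; exists j => i; move: a1; rewrite /mi_order (bigD1 j)//=.
have [->|ij] := eqVneq i j.
  by move: aj; case: (a j) => [|[|n]].
rewrite (bigD1 i)//=; move: aj; case: (a j) => // n _.
by case: (a i) => // m; rewrite addSn addnS.
Qed.

(** The p-th power of the Sobolev norm of order one. *)
Definition power_sum (p : R) f : \bar R :=
  (\sum_(a : {ffun 'I_4 -> 'I_2} | (mi_order (fun j => a j) <= 1)%N)
      \int[@dV R]_(z in H) (nm (weak_partial H (fun j => a j) f z) `^ p)%:E)%E.

Lemma power_sum_ge0 p f : (0 <= power_sum p f)%E.
Proof. by apply: sume_ge0 => a _; apply: integral_ge0 => z _; rewrite lee_fin powR_ge0. Qed.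

Lemma sobolev_normE p f : sobolev_norm H 1 p f = (power_sum p f `^ p^-1)%E.
Proof. by []. Qed.

Lemma power_sum_lty p f : 0 < p -> (sobolev_norm H 1 p f < +oo)%E -> (power_sum p f < +oo)%E.
Proof.
move=> p0; rewrite sobolev_normE; have := power_sum_ge0 p f; case: (power_sum p f) => //= [r _ _|].
  exact: ltry.
by move=> _; rewrite invr_eq0 gt_eqF.
Qed.

Lemma integral_le_power_sum p f (a : 'I_4 -> nat) : (mi_order a <= 1)%N ->
  (\int[@dV R]_(z in H) (nm (weak_partial H a f z) `^ p)%:E <= power_sum p f)%E.
Proof.
move=> a1.
have al i : (a i < 2)%N.
  rewrite ltnS (leq_trans _ a1)// /mi_order (bigD1 i)//=; exact: leq_addr.
pose b : {ffun 'I_4 -> 'I_2} := [ffun i => Ordinal (al i)].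
have ab : (fun j => b j : nat) = a by apply/funext => j; rewrite ffunE.
rewrite /power_sum (bigD1 b) ?ab//= leeDl//.
by apply: sume_ge0 => c _; apply: integral_ge0 => z _; rewrite lee_fin powR_ge0.
Qed.

(** The representative of a weak derivative chosen in the definition of the
    norm is arbitrary up to null sets. *)
Lemma integral_nm_ae p g g' : cmeasurable H g -> cmeasurable H g' ->
  (\forall w \ae @dV R, H w -> g w = g' w) ->
  (\int[@dV R]_(z in H) (nm (g z) `^ p)%:E = \int[@dV R]_(z in H) (nm (g' z) `^ p)%:E)%E.
Proof.
have m u : cmeasurable H u -> measurable_fun (H : set (mC2 R)) (fun z => (nm (u z) `^ p)%:E).
  by move=> mu; apply/measurable_EFinP; apply: (measurableT_comp (@measurable_powR R p)); exact: measurable_normcH.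
move=> mg mg' E; apply: ae_eq_integral => //; [exact: m|exact: m|].
apply: (@filterS _ _ (ae_filter_ringOfSetsType (@dV R)) _ _ _ E) => w h Hw; by rewrite h.
Qed.

Lemma cL1_restrictH p g : 1 < p -> cmeasurable H g ->
  (\int[@dV R]_(z in H) (nm (g z) `^ p)%:E < +oo)%E -> cL1 (restrictH g).
Proof.
move=> p1 mg fin; split; first exact: cmeas_restrictH.
have := @Lp_L1 R p (fun w => nm (g w)) p1 (fun w => normc_ge0 _) (measurable_normcH mg) fin.
by apply: eq_integrable => // w; rewrite inE => Hw; rewrite restrictHE.
Qed.

(** By holomorphy in z, the derivative of the kernel in a real direction is a
    combination of the two complex partial derivatives. *)
Definition bergman_dir (j : 'I_4) z w : R[i] := bergman_d1 z w * z1 (dir R j) + bergman_d2 z w * z2 (dir R j).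

Let dirE (j : 'I_4) : [\/ z1 (dir R j) = 1 /\ z2 (dir R j) = 0, z1 (dir R j) = I /\ z2 (dir R j) = 0,
  z1 (dir R j) = 0 /\ z2 (dir R j) = 1 | z1 (dir R j) = 0 /\ z2 (dir R j) = I].
Proof.
move: j; apply: ord4P; [constructor 1|constructor 2|constructor 3|constructor 4]; split;
  by apply/eqP; rewrite eq_complex /= !eqxx.
Qed.

Let nmI : nm I = 1.
Proof. by rewrite normc_sqrt /normsq/= expr0n add0r expr1n sqrtr1. Qed.

Lemma bounded_kernel_bergman : bounded_kernel (@bergman R).
Proof. by split; [exact: cmeas_bergman|exact: bergman_le_kernel_bound]. Qed.

Lemma bounded_kernel_bergman_d1 : bounded_kernel (@bergman_d1 R).
Proof. by split; [exact: cmeas_bergman_d1|exact: bergman_d1_le_kernel_bound]. Qed.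

Lemma bounded_kernel_bergman_d2 : bounded_kernel (@bergman_d2 R).
Proof. by split; [exact: cmeas_bergman_d2|exact: bergman_d2_le_kernel_bound]. Qed.

Lemma bounded_kernel_bergman_dir j : bounded_kernel (bergman_dir j).
Proof.
split.
  apply: cmeasD.
    by apply: cmeasM; [exact: cmeas_bergman_d1|exact: cmeas_cst].
  by apply: cmeasM; [exact: cmeas_bergman_d2|exact: cmeas_cst].
move=> z w Hz Hw; rewrite /bergman_dir.
have b1 (c : R[i]) : nm c = 1 -> nm (bergman_d1 z w * c) <= kernel_bound z.
  by move=> c1; rewrite Normc.normcM c1 mulr1; exact: bergman_d1_le_kernel_bound.
have b2 (c : R[i]) : nm c = 1 -> nm (bergman_d2 z w * c) <= kernel_bound z.
  by move=> c1; rewrite Normc.normcM c1 mulr1; exact: bergman_d2_le_kernel_bound.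
by case: (dirE j) => -[-> ->]; rewrite mulr0 ?addr0 ?add0r; [apply: b1|apply: b1|apply: b2|apply: b2];
  rewrite ?nmI ?Normc.normc1.
Qed.

(** Twice the constant of the kernel estimates: the modulus of a complex
    integral is bounded by the sum of those of its two components. *)
Definition schur_const : R := 2 * (9 * disk_area R ^- 2).

Lemma schur_const_ge0 : 0 <= schur_const.
Proof. by rewrite !mulr_ge0// invr_ge0 exprn_ge0// ltW// disk_area_gt0. Qed.

Lemma cintegral_abs_kernel_le (F : C2 R -> R[i]) (G : C2 R -> R) z : cmeas (F : mC2 R -> R[i]) ->
  measurable_fun (setT : set (mC2 R)) G -> (forall w, 0 <= G w) ->
  (@dV R).-integrable (H : set (mC2 R)) (fun w => (nm (F w))%:E) ->
  (forall w, H w -> nm (F w) <= 9 * disk_area R ^- 2 * (normsq (z2 z) `^ (- 2^-1) * abs_kernel z w) * G w) ->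
  ((nm (cintegral H F))%:E <= schur_const%:E * ((normsq (z2 z) `^ (- 2^-1))%:E *
      \int[@dV R]_(w in H) (abs_kernel z w * G w)%:E))%E.
Proof.
move=> mF mG G0 iF FG.
have k0 : 0 <= 9 * disk_area R ^- 2 by rewrite mulr_ge0// invr_ge0 exprn_ge0// ltW// disk_area_gt0.
have mkG : measurable_fun (H : set (mC2 R)) (fun w => (abs_kernel z w * G w)%:E).
  apply: measurable_funTS; apply/measurable_EFinP; apply: measurable_funM => //.
  by apply: measurable_section; exact: measurable_abs_kernel.
have kG0 w : H w -> (0 <= (abs_kernel z w * G w)%:E)%E by move=> _; rewrite lee_fin mulr_ge0// abs_kernel_ge0.
apply: le_trans (cintegral_le mF iF) _; rewrite /schur_const EFinM -muleA lee_wpmul2l//.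
rewrite muleA -EFinM -ge0_integralZl//; last by rewrite lee_fin mulr_ge0// powR_ge0.
apply: ge0_le_integral => //.
- by move=> w _; rewrite lee_fin normc_ge0.
- apply: measurable_funTS; apply/measurable_EFinP; exact: cmeas_normc.
- by apply: emeasurable_funM => //; exact: measurable_cst.
- by move=> w Hw; rewrite -EFinM lee_fin mulrA -[X in _ <= X * _]mulrA; exact: FG.
Qed.

Lemma kernel_op_normc_integrable k f z : bounded_kernel k -> cL1 f -> H z ->
  (@dV R).-integrable (H : set (mC2 R)) (fun w => (nm (k z w * f w))%:E).
Proof.
move=> ck [mf fi] Hz.
apply: (@le_integrable _ (mC2 R) R (@dV R) H mH _ (fun w => (kernel_bound z)%:E * (nm (f w))%:E)%E).
- apply: measurable_funTS; apply/measurable_EFinP; apply: cmeas_normc; apply: cmeasM => //.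
  exact: (cmeas_section z ck.1).
- move=> w Hw; rewrite -EFinM !abse_EFin lee_fin [leLHS]ger0_norm ?normc_ge0//.
  by rewrite Normc.normcM (le_trans _ (ler_norm _))// ler_wpM2r ?normc_ge0// ck.2.
- exact: (@integrableZl _ (mC2 R) R (@dV R) H mH _ (fun w => (nm (f w))%:E)).
Qed.

Lemma kernel_op_bergman_le f z : cL1 f -> H z ->
  ((nm (kernel_op f (@bergman R) z))%:E <= schur_const%:E * ((normsq (z2 z) `^ (- 2^-1))%:E *
      \int[@dV R]_(w in H) (abs_kernel z w * nm (f w))%:E))%E.
Proof.
move=> cf Hz; have [mf fi] := cf; apply: cintegral_abs_kernel_le.
- exact: (cmeasM (cmeas_section z (cmeas_bergman R)) mf).
- exact: cmeas_normc.
- by move=> w; exact: normc_ge0.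
- exact: (kernel_op_normc_integrable bounded_kernel_bergman cf Hz).
- by move=> w Hw; rewrite Normc.normcM ler_wpM2r ?normc_ge0// bergman_le_abs_kernel.
Qed.

(** The coefficients of the rotation field are bounded by |w_j|, which
    compensates the size of the primitive. *)
Lemma rotated_kernel_le (jx jy : 'I_4) (M : C2 R -> C2 R -> R[i]) (Z : C2 R -> R[i]) gx gy z :
  (forall w, `|crd jx w| <= nm (Z w)) -> (forall w, `|crd jy w| <= nm (Z w)) -> bounded_kernel M ->
  (forall w, H w -> nm (M z w) * nm (Z w) <= 9 * disk_area R ^- 2 * (normsq (z2 z) `^ (- 2^-1) * abs_kernel z w)) ->
  cL1 gx -> cL1 gy -> H z ->
  ((nm (cintegral H (fun w => M z w * ((crd jx w)%:C * gy w - (crd jy w)%:C * gx w))))%:E <=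
    schur_const%:E * ((normsq (z2 z) `^ (- 2^-1))%:E *
      \int[@dV R]_(w in H) (abs_kernel z w * (nm (gx w) + nm (gy w)))%:E))%E.
Proof.
move=> hx hy cM MZ [mx ix] [my iy] Hz.
have nr (r : R) : nm r%:C = `|r| by rewrite normc_sqrt /normsq/= expr0n addr0 sqrtr_sqr.
have mcrd j : cmeas (fun w : mC2 R => (crd j w)%:C) by apply: cmeas_real; exact: measurable_crd.
have mF : cmeas (fun w : mC2 R => M z w * ((crd jx w)%:C * gy w - (crd jy w)%:C * gx w)).
  apply: cmeasM; first exact: (cmeas_section z cM.1).
  by apply: cmeasB; exact: cmeasM.
have le1 w : nm ((crd jx w)%:C * gy w - (crd jy w)%:C * gx w) <= nm (Z w) * (nm (gx w) + nm (gy w)).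
  apply: le_trans (le_normcD _ _) _; rewrite normc_opp !Normc.normcM !nr addrC mulrDr.
  by apply: lerD; rewrite ler_wpM2r ?normc_ge0.
have FG w : H w -> nm (M z w * ((crd jx w)%:C * gy w - (crd jy w)%:C * gx w)) <=
    9 * disk_area R ^- 2 * (normsq (z2 z) `^ (- 2^-1) * abs_kernel z w) * (nm (gx w) + nm (gy w)).
  move=> Hw; rewrite Normc.normcM.
  apply: le_trans (ler_wpM2l (normc_ge0 _) (le1 w)) _; rewrite mulrA ler_wpM2r//.
    by rewrite addr_ge0// normc_ge0.
  exact: MZ.
have Z1 w : H w -> nm ((crd jx w)%:C * gy w - (crd jy w)%:C * gx w) <= nm (gx w) + nm (gy w).
  move=> /hartogsE[h1 h2]; have n1 := normc_lt1 (lt_trans h1 h2); have n2 := normc_lt1 h2.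
  have c1 j : `|crd j w| <= 1.
    by move: j; apply: ord4P;
      [exact: le_trans (normc_Re (z1 w)) (ltW n1)|exact: le_trans (normc_Im (z1 w)) (ltW n1)
      |exact: le_trans (normc_Re (z2 w)) (ltW n2)|exact: le_trans (normc_Im (z2 w)) (ltW n2)].
  apply: le_trans (le_normcD _ _) _; rewrite normc_opp !Normc.normcM !nr addrC.
  by apply: lerD; rewrite ler_piMl ?normc_ge0.
apply: cintegral_abs_kernel_le FG => //.
- by apply: measurable_funD; exact: cmeas_normc.
- by move=> w; rewrite addr_ge0// normc_ge0.
- apply: (@le_integrable _ (mC2 R) R (@dV R) H mH _ (fun w => (kernel_bound z)%:E * (nm (gx w) + nm (gy w))%:E)%E).
  + by apply: measurable_funTS; apply/measurable_EFinP; exact: cmeas_normc.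
  + move=> w Hw; rewrite -EFinM !abse_EFin lee_fin ger0_norm ?normc_ge0// Normc.normcM.
    rewrite (le_trans _ (ler_norm _))// ler_pM ?normc_ge0//; [exact: cM.2|exact: Z1].
  + apply: (@integrableZl _ (mC2 R) R (@dV R)) => //.
    by under eq_fun do rewrite EFinD; exact: (integrableD mH ix iy).
Qed.

End assembly.

Section main_estimate.
Variable R : realType.
Local Notation H := (@hartogs R).
Local Notation nm := (@Normc.normc R).
Implicit Types (f g : C2 R -> R[i]) (z w : C2 R).

Let mH : measurable (H : set (mC2 R)) := @measurable_hartogs R.
Let I : R[i] := 0 +i* 1.
Let e (j i : 'I_4) : nat := (i == j).

Let nmI : nm I = 1.
Proof. by rewrite normc_sqrt /normsq/= expr0n add0r expr1n sqrtr1. Qed.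

Lemma kernel_op_scale k (c : R[i]) f z : bounded_kernel k -> cL1 f -> H z ->
  kernel_op f (fun z w => k z w * c) z = c * kernel_op f k z.
Proof.
move=> ck [mf fi] Hz; rewrite /kernel_op -cintegralZ; last exact: (kernel_op_cintegrable mf fi ck Hz).
by apply: eq_cintegral => w _; ring.
Qed.

Section derivatives.
Variables (f : C2 R -> R[i]) (g : 'I_4 -> C2 R -> R[i]).
Hypothesis cf : cL1 f.
Hypothesis cg : forall j, cL1 (g j).
Hypothesis wfg : forall j, is_weak_partial H (e j) f (g j).

(** The derivative of the projection, expressed with first derivatives of f
    and a kernel no larger than Q. *)
Lemma kernel_op_bergman_d1_rotation z : H z -> I * kernel_op f (@bergman_d1 R) z =
  cintegral H (fun w => primitive1 z w * ((crd o0 w)%:C * g o1 w - (crd o1 w)%:C * g o0 w)).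
Proof.
move=> Hz.
have hM w : H w -> exists2 c, is_deriveC (dir R o0) (primitive1 z) w c /\ is_deriveC (dir R o1) (primitive1 z) w (I^*%C * c) &
    ((crd o0 w)%:C - I * (crd o1 w)%:C) * c = bergman_d1 z w.
  move=> Hw; have [c hc cE] := primitive1_is_deriveC Hz Hw; exists c.
    split.
      have v0 : z2 (dir R o0) = 0 by [].
      by apply: is_deriveC_eq (hc _ v0) _; rewrite (_ : z1 (dir R o0) = 1)// rmorph1 mul1r.
    have v0 : z2 (dir R o1) = 0 by [].
    exact: is_deriveC_eq (hc _ v0) _.
  rewrite -cE; congr (_ * c); apply/eqP; rewrite eq_complex /crd /=.
  by apply/andP; split; apply/eqP; ring.
exact: (@rotation_by_parts R f (g o0) (g o1) (e o0) (e o1) o0 o1 (primitive1 z) (bergman_d1 z) (kernel_bound z)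
  (or_introl erefl) (wfg o0) (fun=> erefl) (wfg o1) (fun=> erefl) cf (cg o0) (cg o1)
  (cmeas_section z (cmeas_primitive1 R)) (cmeas_section z (cmeas_bergman_d1 R)) (elemC_primitive1 Hz)
  (fun w => primitive1_le_kernel_bound Hz) (fun w => bergman_d1_le_kernel_bound Hz) hM).
Qed.

Lemma kernel_op_bergman_d2_rotation z : H z -> I * kernel_op f (@bergman_d2 R) z =
  cintegral H (fun w => primitive2 z w * ((crd o2 w)%:C * g o3 w - (crd o3 w)%:C * g o2 w)).
Proof.
move=> Hz.
have hM w : H w -> exists2 c, is_deriveC (dir R o2) (primitive2 z) w c /\ is_deriveC (dir R o3) (primitive2 z) w (I^*%C * c) &
    ((crd o2 w)%:C - I * (crd o3 w)%:C) * c = bergman_d2 z w.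
  move=> Hw; have [c hc cE] := primitive2_is_deriveC Hz Hw; exists c.
    split.
      have v0 : z1 (dir R o2) = 0 by [].
      by apply: is_deriveC_eq (hc _ v0) _; rewrite (_ : z2 (dir R o2) = 1)// rmorph1 mul1r.
    have v0 : z1 (dir R o3) = 0 by [].
    exact: is_deriveC_eq (hc _ v0) _.
  rewrite -cE; congr (_ * c); apply/eqP; rewrite eq_complex /crd /=.
  by apply/andP; split; apply/eqP; ring.
exact: (@rotation_by_parts R f (g o2) (g o3) (e o2) (e o3) o2 o3 (primitive2 z) (bergman_d2 z) (kernel_bound z)
  (or_intror erefl) (wfg o2) (fun=> erefl) (wfg o3) (fun=> erefl) cf (cg o2) (cg o3)
  (cmeas_section z (cmeas_primitive2 R)) (cmeas_section z (cmeas_bergman_d2 R)) (elemC_primitive2 Hz)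
  (fun w => primitive2_le_kernel_bound Hz) (fun w => bergman_d2_le_kernel_bound Hz) hM).
Qed.

Definition grad_norm w : R := \sum_(j < 4) nm (g j w).

Lemma grad_norm_ge0 w : 0 <= grad_norm w.
Proof. by apply: sumr_ge0 => j _; exact: normc_ge0. Qed.

Lemma measurable_grad_norm : measurable_fun (setT : set (mC2 R)) grad_norm.
Proof. by apply: measurable_sum => j; apply: cmeas_normc; have [] := cg j. Qed.

Lemma grad_norm2_le (i j : 'I_4) w : i != j -> nm (g i w) + nm (g j w) <= grad_norm w.
Proof.
move=> ij; rewrite /grad_norm (bigD1 i)//= (bigD1 j) 1?eq_sym//= addrA lerDl.
by apply: sumr_ge0 => l _; exact: normc_ge0.
Qed.

Lemma abs_kernel_integral_mono z (G G' : C2 R -> R) : measurable_fun (setT : set (mC2 R)) G ->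
  measurable_fun (setT : set (mC2 R)) G' -> (forall w, 0 <= G w) -> (forall w, G w <= G' w) ->
  ((schur_const R)%:E * ((normsq (z2 z) `^ (- 2^-1))%:E * \int[@dV R]_(w in H) (abs_kernel z w * G w)%:E) <=
  (schur_const R)%:E * ((normsq (z2 z) `^ (- 2^-1))%:E * \int[@dV R]_(w in H) (abs_kernel z w * G' w)%:E))%E.
Proof.
move=> mG mG' G0 GG'.
have m u : measurable_fun (setT : set (mC2 R)) u -> measurable_fun (H : set (mC2 R)) (fun w => (abs_kernel z w * u w)%:E).
  move=> mu; apply: measurable_funTS; apply/measurable_EFinP; apply: measurable_funM => //.
  by apply: measurable_section; exact: measurable_abs_kernel.
apply: lee_wpmul2l; first by rewrite lee_fin schur_const_ge0.
apply: lee_wpmul2l; first by rewrite lee_fin powR_ge0.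
apply: ge0_le_integral => //.
- by move=> w _; rewrite lee_fin mulr_ge0// abs_kernel_ge0.
- exact: m.
- exact: m.
- by move=> w _; rewrite lee_fin ler_wpM2l// abs_kernel_ge0.
Qed.

Lemma kernel_op_dk_le (k : C2 R -> C2 R -> R[i]) z : k = @bergman_d1 R \/ k = @bergman_d2 R -> H z ->
  ((nm (kernel_op f k z))%:E <= (schur_const R)%:E * ((normsq (z2 z) `^ (- 2^-1))%:E *
      \int[@dV R]_(w in H) (abs_kernel z w * grad_norm w)%:E))%E.
Proof.
have mg i j : measurable_fun (setT : set (mC2 R)) (fun w => nm (g i w) + nm (g j w)).
  by apply: measurable_funD; apply: cmeas_normc; [have [] := cg i|have [] := cg j].
have gs0 i j w : 0 <= nm (g i w) + nm (g j w) by rewrite addr_ge0 ?normc_ge0.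
move=> kE Hz; rewrite (_ : nm (kernel_op f k z) = nm (I * kernel_op f k z)); last by rewrite Normc.normcM nmI mul1r.
case: kE => ->.
- rewrite (kernel_op_bergman_d1_rotation Hz).
  have cM : bounded_kernel (@primitive1 R) by split; [exact: cmeas_primitive1|exact: primitive1_le_kernel_bound].
  have hx w : `|crd o0 w| <= nm (z1 w) by exact: (normc_Re (z1 w)).
  have hy w : `|crd o1 w| <= nm (z1 w) by exact: (normc_Im (z1 w)).
  have MZ w : H w -> nm (primitive1 z w) * nm (z1 w) <= 9 * disk_area R ^- 2 * (normsq (z2 z) `^ (- 2^-1) * abs_kernel z w).
    by move=> Hw; exact: primitive1_le_abs_kernel.
  apply: (le_trans (rotated_kernel_le hx hy cM MZ (cg o0) (cg o1) Hz)).
  by apply: abs_kernel_integral_mono; [exact: mg|exact: measurable_grad_norm|exact: gs0|move=> w; exact: grad_norm2_le].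
- rewrite (kernel_op_bergman_d2_rotation Hz).
  have cM : bounded_kernel (@primitive2 R) by split; [exact: cmeas_primitive2|exact: primitive2_le_kernel_bound].
  have hx w : `|crd o2 w| <= nm (z2 w) by exact: (normc_Re (z2 w)).
  have hy w : `|crd o3 w| <= nm (z2 w) by exact: (normc_Im (z2 w)).
  have MZ w : H w -> nm (primitive2 z w) * nm (z2 w) <= 9 * disk_area R ^- 2 * (normsq (z2 z) `^ (- 2^-1) * abs_kernel z w).
    by move=> Hw; exact: primitive2_le_abs_kernel.
  apply: (le_trans (rotated_kernel_le hx hy cM MZ (cg o2) (cg o3) Hz)).
  by apply: abs_kernel_integral_mono; [exact: mg|exact: measurable_grad_norm|exact: gs0|move=> w; exact: grad_norm2_le].
Qed.

(** In each real direction the complex derivative is multiplied by 1 or by i. *)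
Lemma kernel_op_bergman_dir_normc j z : H z -> exists2 k, k = @bergman_d1 R \/ k = @bergman_d2 R & nm (kernel_op f (bergman_dir j) z) = nm (kernel_op f k z).
Proof.
move=> Hz.
have sc k c : bounded_kernel k -> nm c = 1 -> nm (kernel_op f (fun z w => k z w * c) z) = nm (kernel_op f k z).
  by move=> ck c1; rewrite kernel_op_scale// Normc.normcM c1 mul1r.
have E1 c : z1 (dir R j) = c -> z2 (dir R j) = 0 -> nm c = 1 -> nm (kernel_op f (bergman_dir j) z) = nm (kernel_op f (@bergman_d1 R) z).
  move=> c1 c2 n1; rewrite -(sc _ _ (bounded_kernel_bergman_d1 R) n1); congr nm.
  by apply: eq_cintegral => w _; rewrite /bergman_dir c1 c2 mulr0 addr0.
have E2 c : z1 (dir R j) = 0 -> z2 (dir R j) = c -> nm c = 1 -> nm (kernel_op f (bergman_dir j) z) = nm (kernel_op f (@bergman_d2 R) z).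
  move=> c1 c2 n1; rewrite -(sc _ _ (bounded_kernel_bergman_d2 R) n1); congr nm.
  by apply: eq_cintegral => w _; rewrite /bergman_dir c1 c2 mulr0 add0r.
have n1 : nm 1 = 1 by exact: Normc.normc1.
move: j E1 E2; apply: ord4P => E1 E2.
- by exists (@bergman_d1 R); [left|exact: (E1 1)].
- by exists (@bergman_d1 R); [left|exact: (E1 I)].
- by exists (@bergman_d2 R); [right|exact: (E2 1)].
- by exists (@bergman_d2 R); [right|exact: (E2 I)].
Qed.

Lemma kernel_op_bergman_weak j : is_weak_partial H (e j) (kernel_op f (@bergman R)) (kernel_op f (bergman_dir j)).
Proof.
have [mf fi] := cf.
have dk z w : H z -> H w -> is_deriveC (dir R j) (fun z => bergman z w) z (bergman_dir j z w) by exact: bergman_is_deriveC.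
exact: (kernel_op_weak mf fi (fun=> erefl) (bounded_kernel_bergman R) (bounded_kernel_bergman_dir R j) (@elemC_bergman_l R) dk).
Qed.

End derivatives.

Lemma powR_sum4_le (p : R) (u : 'I_4 -> R) : 0 < p -> (forall j, 0 <= u j) ->
  (\sum_(j < 4) u j) `^ p <= 2 `^ p * 2 `^ p * \sum_(j < 4) u j `^ p.
Proof.
move=> p0 u0; rewrite !big_ord_recr !big_ord0/= !add0r.
have P := powR_ge0; have T0 : 0 <= 2 `^ p by exact: powR_ge0.
rewrite -!addrA addrA -!addrA.
have -> : forall a b c d : R, a + (b + (c + d)) = (a + b) + (c + d) by move=> *; ring.
apply: le_trans (powRD_le p0 (addr_ge0 (u0 _) (u0 _)) (addr_ge0 (u0 _) (u0 _))) _.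
rewrite -mulrA ler_wpM2l// (_ : forall a b c d : R, a + (b + (c + d)) = (a + b) + (c + d)); last by move=> *; ring.
by rewrite mulrDr; apply: lerD; exact: powRD_le.
Qed.

End main_estimate.

(** * The projection on the Sobolev space *)

Section conclusion.
Variable R : realType.
Local Notation H := (@hartogs R).
Local Notation nm := (@Normc.normc R).
Implicit Types (f g : C2 R -> R[i]) (z w : C2 R).

Let mH : measurable (H : set (mC2 R)) := @measurable_hartogs R.
Let e (j i : 'I_4) : nat := (i == j).

Lemma sume_cst (J : finType) (P : pred J) (c : R) (N : \bar R) : 0 <= c ->
  (\sum_(i | P i) c%:E * N = (\sum_(i | P i) c)%:E * N)%E.
Proof.
by move=> c0; rewrite -sumEFin ge0_sume_distrl// => i _; rewrite lee_fin.
Qed.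

(** The norm of the sum of the four derivatives, with the crude constant
    4^(p+1). *)
Lemma grad_norm_Lp (p : R) (g : 'I_4 -> C2 R -> R[i]) (N : \bar R) : 1 < p ->
  (forall j, cL1 (g j)) ->
  (forall j, \int[@dV R]_(w in H) (nm (g j w) `^ p)%:E <= N)%E ->
  (\int[@dV R]_(w in H) (grad_norm g w `^ p)%:E <= (2 `^ p * 2 `^ p * 4)%:E * N)%E.
Proof.
move=> p1 cg gN.
have p0 : 0 < p by lra.
have c0 : 0 <= 2 `^ p * 2 `^ p :> R by rewrite mulr_ge0 ?powR_ge0.
have mg j : measurable_fun (H : set (mC2 R)) (fun w => (nm (g j w) `^ p)%:E).
  apply: measurable_funTS; apply/measurable_EFinP; apply: (measurableT_comp (@measurable_powR R p)).
  by apply: cmeas_normc; have [] := cg j.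
apply: (@le_trans _ _ (\int[@dV R]_(w in H) ((2 `^ p * 2 `^ p)%:E * \sum_(j < 4) (nm (g j w) `^ p)%:E))%E).
  apply: ge0_le_integral => //.
  - by move=> w _; rewrite lee_fin powR_ge0.
  - apply: measurable_funTS; apply/measurable_EFinP; apply: (measurableT_comp (@measurable_powR R p)).
    exact: measurable_grad_norm.
  - apply: emeasurable_funM; first exact: measurable_cst.
    by apply: emeasurable_sum => j; exact: mg.
  - move=> w _; rewrite sumEFin -EFinM lee_fin; apply: powR_sum4_le => // j; exact: normc_ge0.
have s0 w : H w -> (0 <= \sum_(j < 4) (nm (g j w) `^ p)%:E)%E.
  by move=> _; apply: sume_ge0 => j _; rewrite lee_fin powR_ge0.
rewrite ge0_integralZl//; last by apply: emeasurable_sum => j; exact: mg.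
rewrite (EFinM (2 `^ p * 2 `^ p) 4) -muleA lee_wpmul2l//.
rewrite ge0_integral_sum//; last by move=> j w _; rewrite lee_fin powR_ge0.
apply: (@le_trans _ _ (\sum_(j < 4) 1%:E * N)%E).
  by apply: lee_sum => j _; rewrite mul1e.
rewrite (sume_cst _ _ ler01) (_ : \sum_(j < 4) 1 = 4 :> R)//.
by rewrite sumr_const card_ord.
Qed.

Variables (p : R) (p_gt1 : 1 < p) (p_lt4 : p < 4).

Section one_function.
Variables (f : C2 R -> R[i]) (C : R).
Hypothesis C0 : 0 <= C.
Hypothesis sf : sobolev H 1 p f.
Hypothesis dom : forall (F : C2 R -> R[i]) (G : C2 R -> R), cmeasurable H F ->
    measurable_fun (setT : set (mC2 R)) G -> (forall w, 0 <= G w) ->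
    (forall z, H z -> ((nm (F z))%:E <= (schur_const R)%:E * ((normsq (z2 z) `^ (- 2^-1))%:E *
      \int[@dV R]_(w in H) (abs_kernel z w * G w)%:E))%E) ->
    (\int[@dV R]_(z in H) (nm (F z) `^ p)%:E <= C%:E * \int[@dV R]_(w in H) (G w `^ p)%:E)%E.

Let p0 : 0 < p. Proof. exact: lt_trans ltr01 p_gt1. Qed.
Let N := power_sum p f.
Let Nlty : (N < +oo)%E. Proof. exact: power_sum_lty p0 sf.2. Qed.
Let W (a : 'I_4 -> nat) := weak_partial H a f.

Let wW a : (mi_order a <= 1)%N -> is_weak_partial H a f (W a).
Proof. by move=> a1; apply: (@xgetPex _ _ [set g | is_weak_partial H a f g]); exact: sf.1. Qed.

Let ord0 : (mi_order (fun _ : 'I_4 => 0) <= 1)%N.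
Proof. by rewrite /mi_order big1. Qed.

Let orde j : (mi_order (e j) <= 1)%N.
Proof. by have [_ ->] := @multi_partial1 R (e j) j (fun=> 0) (fun=> erefl). Qed.

Let lf : clocally_integrable H f. Proof. by have [] := wW ord0. Qed.

Let weak_self u : clocally_integrable H u -> is_weak_partial H (fun=> 0%N) u u.
Proof.
move=> lu; split => // phi _.
by have [-> ->] := multi_partial0 phi (fun=> erefl (0%N)); rewrite expr0 mul1r.
Qed.

Let cut_Lp u : (\int[@dV R]_(w in H) (nm (restrictH u w) `^ p)%:E =
  \int[@dV R]_(w in H) (nm (u w) `^ p)%:E)%E.
Proof. by apply: eq_integral => w; rewrite inE => Hw; rewrite restrictHE. Qed.

Let f_Lp : (\int[@dV R]_(w in H) (nm (f w) `^ p)%:E <= N)%E.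
Proof.
have w0 := wW ord0; have [_ [mW _] _] := w0.
rewrite (integral_nm_ae p lf.1 mW (weak_partial_ae (weak_self lf) w0)).
exact: integral_le_power_sum.
Qed.

Let g j := restrictH (W (e j)).

Let g_Lp j : (\int[@dV R]_(w in H) (nm (g j w) `^ p)%:E <= N)%E.
Proof. by rewrite cut_Lp; exact: integral_le_power_sum. Qed.

Let cf : cL1 (restrictH f).
Proof. by apply: (cL1_restrictH p_gt1 lf.1); exact: le_lt_trans f_Lp Nlty. Qed.

Let cg j : cL1 (g j).
Proof.
have [_ [mW _] _] := wW (orde j).
apply: (cL1_restrictH p_gt1 mW); apply: le_lt_trans Nlty; exact: integral_le_power_sum.
Qed.

Let wfg j : is_weak_partial H (e j) (restrictH f) (g j).
Proof.
by apply: is_weak_partial_ext (wW (orde j)) => w Hw; rewrite /g restrictHE.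
Qed.

Let B := sub_bergman f.

Let integrandE z w : H z -> H w -> sub_bergman_integrand f z w = bergman z w * restrictH f w.
Proof. by move=> Hz Hw; rewrite /sub_bergman_integrand sub_bergman_kernelE// restrictHE. Qed.

Let BE z : H z -> kernel_op (restrictH f) (@bergman R) z = B z.
Proof. by move=> Hz; apply: eq_cintegral => w Hw; rewrite integrandE. Qed.

Lemma sub_bergman_cintegrable z : H z -> cintegrable H (sub_bergman_integrand f z).
Proof.
move=> Hz; have [mf fi] := cf; have [i1 i2] := kernel_op_cintegrable mf fi (bounded_kernel_bergman R) Hz.
split; [apply: eq_integrable i1|apply: eq_integrable i2] => // w; rewrite inE => Hw;
  by rewrite integrandE.
Qed.

Let K := C * (1 + 2 `^ p * 2 `^ p * 4).

Let K0 : 0 <= K.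
Proof. by rewrite mulr_ge0// addr_ge0// mulr_ge0// mulr_ge0// powR_ge0. Qed.

Let N0 : (0 <= N)%E. Proof. exact: power_sum_ge0. Qed.

Let CK c : 0 <= c -> c <= 1 + 2 `^ p * 2 `^ p * 4 -> (C%:E * (c%:E * N) <= K%:E * N)%E.
Proof. by move=> c0 cK; rewrite muleA -EFinM lee_wpmul2r// lee_fin ler_wpM2l. Qed.

(** For order 0 use the size of the kernel; for order 1 differentiate under
    the integral and rotate. *)
Lemma sub_bergman_weak_partial (a : 'I_4 -> nat) : (mi_order a <= 1)%N ->
  exists2 G, is_weak_partial H a B G &
    (\int[@dV R]_(z in H) (nm (G z) `^ p)%:E <= K%:E * N)%E.
Proof.
have [mf fi] := cf.
have q0 : 0 <= 2 `^ p * 2 `^ p * 4 :> R by rewrite mulr_ge0// mulr_ge0// powR_ge0.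
move=> /order_le1[a0|[j aj]].
- have -> : a = fun=> 0%N by apply/funext.
  have lT := kernel_op_locint mf fi (bounded_kernel_bergman R).
  exists (kernel_op (restrictH f) (@bergman R)).
    by apply: is_weak_partial_ext (weak_self lT) => // z Hz; rewrite BE.
  apply: (le_trans (dom lT.1 (cmeas_normc mf) (fun w => normc_ge0 _) (fun z Hz => kernel_op_bergman_le cf Hz))).
  rewrite cut_Lp; apply: (@le_trans _ _ (C%:E * (1%:E * N))%E).
    by rewrite mul1e lee_wpmul2l.
  by apply: CK => //; rewrite lerDl.
- have -> : a = e j by apply/funext => i; rewrite aj.
  have wT := kernel_op_bergman_weak cf j; have [_ lG _] := wT.
  exists (kernel_op (restrictH f) (bergman_dir j)).
    by apply: is_weak_partial_ext wT => // z Hz; rewrite BE.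
  have bd z : H z -> ((nm (kernel_op (restrictH f) (bergman_dir j) z))%:E <= (schur_const R)%:E * ((normsq (z2 z) `^ (- 2^-1))%:E *
      \int[@dV R]_(w in H) (abs_kernel z w * grad_norm g w)%:E))%E.
    move=> Hz; have [k kE ->] := kernel_op_bergman_dir_normc cf j Hz.
    exact: kernel_op_dk_le.
  apply: (le_trans (dom lG.1 (measurable_grad_norm cg) (grad_norm_ge0 g) bd)).
  apply: (@le_trans _ _ (C%:E * ((2 `^ p * 2 `^ p * 4)%:E * N))%E).
    by rewrite lee_wpmul2l//; exact: grad_norm_Lp.
  by apply: CK => //; rewrite lerDr.
Qed.

Let cnt : R := \sum_(a : {ffun 'I_4 -> 'I_2} | (mi_order (fun j => a j) <= 1)%N) K.

(** The chosen representatives agree almost everywhere with the explicit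
    derivatives. *)
Lemma sub_bergman_power_sum : (power_sum p B <= cnt%:E * N)%E.
Proof.
rewrite /cnt -sume_cst//; apply: lee_sum => a a1.
have [G wG GN] := sub_bergman_weak_partial a1.
have wB : is_weak_partial H (fun j => a j) B (weak_partial H (fun j => a j) B).
  by apply: (@xgetPex _ _ [set g | is_weak_partial H (fun j => a j) B g]); exists G.
have [_ [mG _] _] := wG; have [_ [mB _] _] := wB.
by rewrite (integral_nm_ae p mB mG (weak_partial_ae wB wG)).
Qed.

Lemma sub_bergman_sobolev : sobolev H 1 p B /\
  (sobolev_norm H 1 p B <= (cnt `^ p^-1)%:E * sobolev_norm H 1 p f)%E.
Proof.
have cnt0 : 0 <= cnt by apply: sumr_ge0.
have ip0 : 0 <= p^-1 by rewrite invr_ge0 ltW.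
have le : (sobolev_norm H 1 p B <= (cnt `^ p^-1)%:E * sobolev_norm H 1 p f)%E.
  rewrite !sobolev_normE -poweR_EFin -poweRM//.
  exact: (lee_poweR ip0 (power_sum_ge0 p B) sub_bergman_power_sum).
split; last exact: le.
split; first by move=> a a1; have [G wG _] := sub_bergman_weak_partial a1; exists G; exact: wG.
have fin0 : (0 <= (cnt `^ p^-1)%:E)%E by rewrite lee_fin powR_ge0.
apply: (le_lt_trans le); apply: (lte_mul_pinfty fin0 _ sf.2); exact: isT.
Qed.

End one_function.
End conclusion.

Theorem corollary5p8 (R : realType) (p : R) (p_gt1 : 1 < p) (p_lt4 : p < 4) :
  exists2 C : R, 0 <= C &
    forall f : C2 R -> R[i], sobolev hartogs 1 p f ->
      [/\ forall z, hartogs z ->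
            cintegrable hartogs (sub_bergman_integrand f z),
          sobolev hartogs 1 p (sub_bergman f) &
          (sobolev_norm hartogs 1 p (sub_bergman f)
             <= C%:E * sobolev_norm hartogs 1 p f)%E].
Proof.
have [C C0 dom] := @hartogs_dominated R p (schur_const R) p_gt1 p_lt4 (schur_const_ge0 R).
eexists; last first.
  move=> f sf; have [h1 h2] := sub_bergman_sobolev p_gt1 C0 sf dom.
  split; [exact: (sub_bergman_cintegrable p_gt1 sf)|exact: h1|exact: h2].
exact: powR_ge0.
Qed.
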